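(* For every graph $G$, the following are equivalent: (a) $G$ is $(2P_3,C_4,C_6,C_7,T_0)$-free and contains no simplicial vertices; (b) $G$ has exactly one nontrivial anticomponent, and this anticomponent is a 5-basket, a villa, a mansion, or a 5-crown; (c) $G$ can be obtained from a 5-basket, a villa, a mansion, or a 5-crown by possibly adding universal vertices to it.
   Context: All graphs are finite, simple, nonnull. A graph is $(H_1,\dots,H_m)$-free if it has no induced subgraph isomorphic to any $H_i$. $P_k$, $C_k$ are the path and cycle on $k$ vertices; $2P_3$ is two disjoint copies of $P_3$. $T_0$ is the graph with vertices $p,q,u_0,u_1,u_2,u_3,w_1,w_2,w_3$ and edges $pq,pu_0,pu_2,pu_3,qu_1,qu_2,qu_3,u_0w_1,u_1w_1,u_2w_2,u_3w_3,w_1w_2,w_1w_3,w_2w_3$. A clique (stable set) is a possibly empty set of pairwise adjacent (nonadjacent) vertices. A vertex is simplicial if its neighbours form a clique, universal if adjacent to all other vertices. For disjoint vertex sets $X,Y$, $X$ is complete (anticomplete) to $Y$ if every vertex of $X$ is adjacent (nonadjacent) to every vertex of $Y$. An anticomponent of $G$ is a maximal induced subgraph whose complement is connected; it is nontrivial if it has at least two vertices. ''$G$ can be obtained from $Q$ by possibly adding universal vertices'' means $Q$ is an induced subgraph of $G$ and $V(G)\setminus V(Q)$ is a (possibly empty) clique complete to $V(Q)$. 5-basket: a graph $Q$ whose vertex set partitions into $A,B_1,B_2,B_3,C_1,C_2,C_3,F$ where $A,B_i,C_i$ are nonempty cliques, $F$ is a possibly empty clique, $B_1,B_2,B_3$ are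 pairwise anticomplete, $C_1,C_2,C_3$ are pairwise complete; there is $i^*\in\{1,2,3\}$ such that $A$ is complete to $(B_1\cup B_2\cup B_3)\setminus B_{i^*}$ and $A$ can be ordered $a_1,\dots,a_t$ with $N(a_t)\cap B_{i^*}\subseteq\cdots\subseteq N(a_1)\cap B_{i^*}=B_{i^*}$; $A$ is anticomplete to $C_1\cup C_2\cup C_3$; each $B_i$ is complete to $C_i$ and anticomplete to $C_j$ for $j\ne i$; and there is $j^*\in\{1,2,3\}$ such that $F$ is complete to $V(Q)\setminus(B_{j^*}\cup C_{j^*}\cup F)$ and anticomplete to $B_{j^*}\cup C_{j^*}$. $t$-villa ($t\ge3$): a graph $Q$ whose vertex set partitions into nonempty cliques $A,B_1,\dots,B_t,C_1,\dots,C_t$ such that $A$ is complete to $B_1\cup\dots\cup B_t$ and anticomplete to $C_1\cup\dots\cup C_t$; the $B_i$ are pairwise anticomplete; the $C_i$ are pairwise complete; $B_i$ is anticomplete to $C_j$ for $i\ne j$; and each $B_i$ can be ordered $b^i_1,\dots,b^i_{r_i}$ with $\emptyset\ne N(b^i_{r_i})\cap C_i\subseteq\dots\subseteq N(b^i_1)\cap C_i=C_i$. Then $(A;B_1,\dots,B_t;C_1,\dots,C_t)$ is a $t$-villa partition. A villa is a $t$-villa for some $t\ge3$. $t$-mansion ($t\ge3$): a graph $Q$ whose vertex set partitions into cliques $A,B_1,\dots,B_t,C_1,\dots,C_t,F,X,Y$, with $A,B_i,C_i,F$ nonempty ($X,Y$ possibly empty), such that $Q[A\cup B_1\cup\dots\cup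 C_t]$ is a $t$-villa with $t$-villa partition $(A;B_1,\dots,B_t;C_1,\dots,C_t)$; there is $j^*$ such that $F$ is complete to $A$, to $\bigcup_{i\ne j^*}B_i$ and to $\bigcup_{i\ne j^*}C_i$ and anticomplete to $B_{j^*}\cup C_{j^*}$, $B_{j^*}$ is complete to $C_{j^*}$, and $X$ is complete to $A\cup B_{j^*}$ and anticomplete to $\bigcup_{i\ne j^*}B_i$ and to $C_1\cup\dots\cup C_t$; $F$ is complete to $X\cup Y$; $X$ is anticomplete to $Y$; $Y$ is complete to $C_1\cup\dots\cup C_t$ and anticomplete to $A\cup B_1\cup\dots\cup B_t$. A mansion is a $t$-mansion for some $t\ge3$. $k$-ring ($k\ge4$): a graph $R$ whose vertex set partitions into nonempty sets $X_0,\dots,X_{k-1}$ (indices mod $k$) such that each $X_i$ can be ordered $u^i_1,\dots,u^i_{|X_i|}$ with $X_i\subseteq N[u^i_{|X_i|}]\subseteq\dots\subseteq N[u^i_1]=X_{i-1}\cup X_i\cup X_{i+1}$ (closed neighbourhoods); $(X_0,\dots,X_{k-1})$ is a ring partition. A 5-crown is a 5-ring with ring partition $(X_0,\dots,X_4)$ such that for some $i^*\in\mathbb{Z}_5$, $X_{i^*-1}$ is complete to $X_{i^*-2}$ and $X_{i^*+1}$ is complete to $X_{i^*+2}$. *)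

(* Defs.v *)
From mathcomp Require Import all_boot.
Set Implicit Arguments. Unset Strict Implicit. Unset Printing Implicit Defensive.

(* A graph is a finite type T with an adjacency relation e : rel T,
   assumed symmetric and irreflexive (hypotheses of the theorem).
   An induced subgraph is given by a vertex subset Q : {set T}; all
   structural predicates below describe the induced subgraph G[Q]. *)

Section Graphs.
Variables (T : finType) (e : rel T).

Definition clique (X : {set T}) : Prop :=
  forall x y, x \in X -> y \in X -> x != y -> e x y.
Definition complete (X Y : {set T}) : Prop :=
  forall x y, x \in X -> y \in Y -> e x y.
Definition anticomplete (X Y : {set T}) : Prop :=
  forall x y, x \in X -> y \in Y -> ~~ e x y.

Definition nbhd (x : T) : {set T} := [set y | e x y].
Definition cnbhd (S : {set T}) (x : T) : {set T} := [set y in S | (y == x) || e x y].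

Definition simplicial (v : T) : Prop := clique (nbhd v).

Definition induced_sub (n : nat) (h : rel 'I_n) : Prop :=
  exists f : 'I_n -> T, injective f /\ forall i j, e (f i) (f j) = h i j.

Definition is_partition (l : seq {set T}) (S : {set T}) : Prop :=
  (forall i j, i < size l -> j < size l -> i != j ->
     [disjoint nth set0 l i & nth set0 l j]) /\
  \bigcup_(X <- l) X = S.

Definition chain_rel (B : {set T}) : rel T :=
  fun x y => (nbhd y :&: B) \subset (nbhd x :&: B).

Definition ordered_chain (A B : {set T}) : Prop :=
  exists a l, uniq (a :: l) /\ (a :: l) =i A /\
    sorted (chain_rel B) (a :: l) /\ nbhd a :&: B = B.

Definition villa_chain (B C : {set T}) : Prop :=
  exists b l, uniq (b :: l) /\ (b :: l) =i B /\
    sorted (chain_rel C) (b :: l) /\ nbhd b :&: C = C /\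
    nbhd (last b l) :&: C != set0.

Definition basket5 (Q : {set T}) : Prop :=
  exists (A F : {set T}) (B C : 'I_3 -> {set T}) (istar jstar : 'I_3),
    is_partition ([:: A; F] ++ [seq B i | i <- enum 'I_3] ++ [seq C i | i <- enum 'I_3]) Q /\
    A != set0 /\ (forall i, B i != set0 /\ C i != set0) /\
    clique A /\ clique F /\ (forall i, clique (B i) /\ clique (C i)) /\
    (forall i j, i != j -> anticomplete (B i) (B j) /\ complete (C i) (C j)) /\
    (forall i, i != istar -> complete A (B i)) /\
    ordered_chain A (B istar) /\
    (forall i, anticomplete A (C i)) /\
    (forall i, complete (B i) (C i)) /\
    (forall i j, i != j -> anticomplete (B i) (C j)) /\
    complete F (Q :\: (B jstar :|: C jstar :|: F)) /\
    anticomplete F (B jstar :|: C jstar).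

Definition villa_part (t : nat) (A : {set T}) (B C : 'I_t -> {set T}) : Prop :=
  A != set0 /\ (forall i, B i != set0 /\ C i != set0) /\
  clique A /\ (forall i, clique (B i) /\ clique (C i)) /\
  (forall i, complete A (B i) /\ anticomplete A (C i)) /\
  (forall i j, i != j ->
     anticomplete (B i) (B j) /\ complete (C i) (C j) /\ anticomplete (B i) (C j)) /\
  (forall i, villa_chain (B i) (C i)).

Definition tvilla (t : nat) (Q : {set T}) : Prop :=
  3 <= t /\ exists (A : {set T}) (B C : 'I_t -> {set T}),
    is_partition (A :: [seq B i | i <- enum 'I_t] ++ [seq C i | i <- enum 'I_t]) Q /\
    villa_part A B C.

Definition villa (Q : {set T}) : Prop := exists t, tvilla t Q.

Definition tmansion (t : nat) (Q : {set T}) : Prop :=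
  3 <= t /\ exists (A F X Y : {set T}) (B C : 'I_t -> {set T}) (jstar : 'I_t),
    is_partition (A :: F :: X :: Y :: [seq B i | i <- enum 'I_t] ++ [seq C i | i <- enum 'I_t]) Q /\
    villa_part A B C /\
    F != set0 /\ clique F /\ clique X /\ clique Y /\
    complete F A /\
    (forall i, i != jstar -> complete F (B i) /\ complete F (C i)) /\
    anticomplete F (B jstar :|: C jstar) /\
    complete (B jstar) (C jstar) /\
    complete X (A :|: B jstar) /\
    (forall i, i != jstar -> anticomplete X (B i)) /\
    (forall i, anticomplete X (C i)) /\
    complete F (X :|: Y) /\
    anticomplete X Y /\
    (forall i, complete Y (C i) /\ anticomplete Y (B i)) /\
    anticomplete Y A.

Definition mansion (Q : {set T}) : Prop := exists t, tmansion t Q.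

Definition ring_adj (k : nat) (i j : 'I_k) : bool :=
  [|| val j == val i, val j == (val i).+1 %% k | (val j).+1 %% k == val i].

Definition ring_chain (S X U : {set T}) : Prop :=
  exists u l, uniq (u :: l) /\ (u :: l) =i X /\
    sorted (fun x y => cnbhd S y \subset cnbhd S x) (u :: l) /\
    X \subset cnbhd S (last u l) /\ cnbhd S u = U.

Definition ring_partition (k : nat) (S : {set T}) (X : 'I_k -> {set T}) : Prop :=
  is_partition [seq X i | i <- enum 'I_k] S /\
  (forall i, X i != set0) /\
  (forall i, ring_chain S (X i) (\bigcup_(j | ring_adj i j) X j)).

Definition kring (k : nat) (S : {set T}) : Prop :=
  4 <= k /\ exists X : 'I_k -> {set T}, ring_partition S X.

Definition crown5 (S : {set T}) : Prop :=
  exists (X : 'I_5 -> {set T}) (istar : 'I_5),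
    ring_partition S X /\
    (forall j j' : 'I_5, (val j + 1) %% 5 == val istar ->
        (val j' + 2) %% 5 == val istar -> complete (X j) (X j')) /\
    (forall j j' : 'I_5, (val istar + 1) %% 5 == val j ->
        (val istar + 2) %% 5 == val j' -> complete (X j) (X j')).

Definition co_rel (S : {set T}) : rel T :=
  fun x y => [&& x \in S, y \in S, x != y & ~~ e x y].
Definition anticonnected (S : {set T}) : Prop :=
  forall x y, x \in S -> y \in S -> connect (co_rel S) x y.
Definition anticomponent (S : {set T}) : Prop :=
  S != set0 /\ anticonnected S /\
  forall S' : {set T}, S \subset S' -> anticonnected S' -> S' = S.

End Graphs.

Definition edge_in (n : nat) (l : seq (nat * nat)) : rel 'I_n :=
  fun i j => ((val i, val j) \in l) || ((val j, val i) \in l).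

Definition twoP3 : rel 'I_6 := @edge_in 6 [:: (0,1); (1,2); (3,4); (4,5)].

Definition cycle_graph (k : nat) : rel 'I_k :=
  fun i j => (val j == (val i).+1 %% k) || (val i == (val j).+1 %% k).

(* T_0 with p=0, q=1, u0=2, u1=3, u2=4, u3=5, w1=6, w2=7, w3=8 *)
Definition T0 : rel 'I_9 :=
  @edge_in 9 [:: (0,1); (0,2); (0,4); (0,5); (1,3); (1,4); (1,5);
                (2,6); (3,6); (4,7); (5,8); (6,7); (6,8); (7,8)].

Definition cond_a (T : finType) (e : rel T) : Prop :=
  ~ induced_sub e twoP3 /\ ~ induced_sub e (@cycle_graph 4) /\
  ~ induced_sub e (@cycle_graph 6) /\ ~ induced_sub e (@cycle_graph 7) /\
  ~ induced_sub e T0 /\ (forall v : T, ~ simplicial e v).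

Definition special (T : finType) (e : rel T) (Q : {set T}) : Prop :=
  basket5 e Q \/ villa e Q \/ mansion e Q \/ crown5 e Q.

Definition cond_b (T : finType) (e : rel T) : Prop :=
  exists S : {set T}, anticomponent e S /\ 1 < #|S| /\
    (forall S' : {set T}, anticomponent e S' -> 1 < #|S'| -> S' = S) /\
    special e S.

Definition cond_c (T : finType) (e : rel T) : Prop :=
  exists Q : {set T}, special e Q /\ clique e (~: Q) /\ complete e (~: Q) Q.

(* Main.v *)
Require Import Defs.
From mathcomp Require Import all_boot.
Set Implicit Arguments. Unset Strict Implicit. Unset Printing Implicit Defensive.

(* Suppose G satisfies (a).  Two closure principles do most of the work: a
   nonempty clique whose outside neighbours form a clique contains a simplicial
   vertex, and a clique cutset leaves a P_3-free side, hence such a clique.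
   Together they show that the nonneighbours of any vertex are connected.
   A pyramid is a claw (a; b1, b2, b3) whose leaves are matched to the vertices
   of a triangle c1 c2 c3.  If G has no pyramid, then outside a 5-hole with a
   maximal ring of clones every vertex is complete to the ring, and the ring is
   a 5-crown.  Otherwise choose a pyramid whose apex a has fewest nonneighbours;
   these form a clique K.  A maximum stable set of neighbours of a that meet K
   indexes the classes B_i and C_i.  If some neighbour of a with no neighbour
   in K is attached to exactly two of three classes B_i, a 5-basket results;
   if not, one gets a mansion or a villa, according to whether some neighbour of
   both a and K is attached to all the classes B_i but one.
   Conversely, each structure is a blow-up of a labelled pattern in which the
   vertices of one class have nested neighbourhoods, so a forbidden subgraph
   would yield one of finitely many labellings, all excluded by computation.
   The many small configuration arguments of the first part are decided by
   reflection too. *)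

(** * Refuting partially known adjacency matrices *)

(** Two features shape the argument. In a configuration some vertices may coincide and only part of
    the adjacencies is known; hence the refutation procedure works on partial adjacency matrices and
    asks for evidence of distinctness only where the forbidden graph has nonadjacent twins. And the
    exceptional indices of the definitions are forced rather than chosen: 4-holes make all vertices
    that see [a] and [K] and are attached to several but not all classes B_i miss one and the same
    class, which yields [jstar]; in a basket, [istar] is the class missed by the vertex attached to
    exactly two of three. Those attached to every class become the added universal vertices.
    Minimality of the apex is used once: a neighbour of [a] that would spoil the clique K is itself
    an apex, and its nonneighbours form a proper subset of those of [a]. The equivalence with (b) is
    an argument in the complement: vertices outside the structure are singleton anticomponents, and
    two nontrivial anticomponents inside it would contain a 4-hole. *)

Definition pmat := seq (seq (option bool)).
Definition mget (s : pmat) i j := nth None (nth [::] s i) j.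
Definition mupd (s : pmat) i j b :=
  set_nth [::] s i (set_nth None (nth [::] s i) j (Some b)).
Definition mput (s : pmat) i j b := mupd (mupd s i j b) j i b.

(* [if] is used instead of [&&], [||], [has], [all]: under [vm_compute] only
   [if] is lazy. *)
Fixpoint lhas (A : Type) (p : A -> bool) (s : seq A) : bool :=
  if s is x :: s' then (if p x then true else lhas p s') else false.
Fixpoint lall (A : Type) (p : A -> bool) (s : seq A) : bool :=
  if s is x :: s' then (if p x then lall p s' else false) else true.

Definition oeqb (o : option bool) (b : bool) : bool :=
  match o with Some b' => if b then b' else (if b' then false else true)
             | None => false end.
Definition differ (o o' : option bool) : bool :=
  match o with Some b => oeqb o' (if b then false else true)
             | None => false end.

(* A graph on [0 .. k-1]: row [i] lists the adjacencies of [i] to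
   [i-1, ..., 0], in this order. *)
Definition rows := seq (seq bool).
Definition radj (p : rows) i j :=
  if j < i then nth false (nth [::] p i) (i - j.+1)
  else nth false (nth [::] p j) (j - i.+1).

Section Search.
Variables (n : nat) (pats : seq rows) (neqs : seq (nat * nat))
  (clauses : seq (seq (nat * nat * bool))).

(** Two positions of the list may hold the same vertex. They certainly do not if a third position is
    adjacent to exactly one of them, or if an inequality was supplied. *)
Definition mdist (s : pmat) i j :=
  if lhas (fun z => differ (mget s i z) (mget s j z)) (iota 0 n) then true
  else lhas (fun p => if p.1 == i then p.2 == j else
                      if p.1 == j then p.2 == i else false) neqs.

Fixpoint fits (s : pmat) (r : seq bool) (m : seq nat) (x : nat) : bool :=
  match r, m with
  | b :: r', y :: m' => if oeqb (mget s y x) b then fits s r' m' x else false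
  | _, _ => true
  end.

(** Injectivity of the copy. Two vertices of the pattern that are separated by a third one, or
    adjacent, have distinct images automatically; only nonadjacent twins require evidence from the
    matrix. *)
Definition twin_free (s : pmat) (p : rows) (m : seq nat) : bool :=
  let k := size p in
  lall (fun i => lall (fun j =>
    if lhas (fun z => differ (Some (radj p i z)) (Some (radj p j z)))
         (filter (fun z => (z != i) && (z != j)) (iota 0 k))
    then true else
    if radj p i j then true else
    mdist s (nth 0 m (k - i.+1)) (nth 0 m (k - j.+1))) (iota 0 i)) (iota 0 k).

(** Backtracking: [m] lists the images chosen so far, latest first, in agreement with the order
    inside a row, and [r] holds the rows still to be placed. *)
Fixpoint embed (s : pmat) (p : rows) (r : rows) (m : seq nat) : bool :=
  match r with
  | [::] => twin_free s p m
  | r0 :: r' => lhas (fun x => if fits s r0 m x then embed s p r' (x :: m)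
                               else false) (iota 0 n)
  end.

(** Only copies through the pair decided last are sought, with this pair as the first two vertices
    of the pattern; each pattern is therefore needed in several vertex orders. *)
Definition embed2 (s : pmat) (i j : nat) (p : rows) : bool :=
  match p with
  | _ :: r1 :: r => if fits s r1 [:: i] j then embed s p r [:: j; i] else false
  | _ => false
  end.

Definition conflict (s : pmat) i j : bool :=
  if lhas (embed2 s i j) pats then true else
  if lhas (embed2 s j i) pats then true else
  lhas (lall (fun l => oeqb (mget s l.1.1 l.1.2) l.2)) clauses.

(** Unit propagation: if one value of an unknown pair causes a conflict, the other value is
    recorded; [None] means that both do. The flag tells whether anything was learnt, in which case
    another pass precedes any case split. *)
Fixpoint pass (ps : seq (nat * nat)) (s : pmat) (ch : bool)
  : option (pmat * bool) :=
  match ps with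
  | [::] => Some (s, ch)
  | (i, j) :: ps' =>
    match mget s i j with
    | Some _ => pass ps' s ch
    | None =>
      let s1 := mput s i j true in
      let s0 := mput s i j false in
      if conflict s1 i j then
        if conflict s0 i j then None else pass ps' s0 true
      else if conflict s0 i j then pass ps' s1 true else pass ps' s ch
    end
  end.

(* The test at the leaves is not redundant: two vertices may have become
   distinguishable after the last pair of a copy was set. *)
Fixpoint search (fuel : nat) (ps : seq (nat * nat)) (s : pmat) : bool :=
  match fuel with
  | 0 => false
  | f.+1 =>
    match pass ps s false with
    | None => true
    | Some (s', true) => search f ps s'
    | Some (s', false) =>
      (fix branch qs := match qs with
       | [::] => lhas (fun p => conflict s' p.1 p.2) ps
       | (i, j) :: qs' =>
         match mget s' i j with
         | Some _ => branch qs'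
         | None => if search f ps (mput s' i j true)
                   then search f ps (mput s' i j false) else false
         end
       end) ps
    end
  end.

Definition pairs : seq (nat * nat) :=
  flatten [seq [seq (i, j) | i <- iota 0 j] | j <- iota 0 n].

Fixpoint load (fs : seq (nat * nat * bool)) : pmat :=
  match fs with
  | [::] => [::]
  | (i, j, b) :: fs' => mput (load fs') i j b
  end.

Definition refutable (fs : seq (nat * nat * bool)) : bool :=
  let s := load fs in
  if lhas (fun f => conflict s f.1.1 f.1.2) fs then true
  else search 200 pairs s.

End Search.

(** * Soundness of the search with respect to an actual graph *)

Section Soundness.
Variables (T : finType) (e : rel T) (e_sym : symmetric e) (e_irr : irreflexive e).

Definition rows_copy (p : rows) (w : seq T) (x0 : T) : Prop :=
  forall i j, j < i -> i < size p ->
    nth x0 w i != nth x0 w j /\ e (nth x0 w i) (nth x0 w j) = radj p i j.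

Definition rows_free (p : rows) : Prop :=
  forall w x0, size w = size p -> ~ rows_copy p w x0.

Definition rows_wf (p : rows) : bool :=
  (2 <= size p) && all (fun i => size (nth [::] p i) == i) (iota 0 (size p)).

Variables (x0 : T) (v : seq T).
Local Notation "$ i" := (nth x0 v i) (at level 0, i at level 0).

Definition models (s : pmat) : Prop :=
  forall i j b, mget s i j = Some b -> e $i $j = b.

Definition lit_holds (l : nat * nat * bool) := e $(l.1.1) $(l.1.2) == l.2.

Variables (n : nat) (pats : seq rows) (neqs : seq (nat * nat))
  (clauses : seq (seq (nat * nat * bool))).
Hypothesis pats_wf : all rows_wf pats.
Hypothesis pats_free : forall p, p \in pats -> rows_free p.
Hypothesis neqs_hold : all (fun p => $(p.1) != $(p.2)) neqs.
Hypothesis clauses_hold : all (fun c => ~~ all lit_holds c) clauses.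

Lemma lhasE A (p : A -> bool) s : lhas p s = has p s.
Proof. by elim: s => //= x s ->; case: (p x). Qed.

Lemma lallE A (p : A -> bool) s : lall p s = all p s.
Proof. by elim: s => //= x s ->; case: (p x). Qed.

Lemma oeqbP o b : oeqb o b -> o = Some b.
Proof. by case: o => [[]|]; case: b. Qed.

Lemma differP o o' : differ o o' -> exists b, o = Some b /\ o' = Some (~~ b).
Proof. by case: o => //= b; case: o' => //= -[]; case: b => //=; eexists. Qed.

Lemma mget_upd s i j b i' j' :
  mget (mupd s i j b) i' j' =
  if (i' == i) && (j' == j) then Some b else mget s i' j'.
Proof.
rewrite /mget /mupd nth_set_nth /=; case: (eqVneq i' i) => [->|] //=.
by rewrite nth_set_nth /=; case: eqP.
Qed.

Lemma models_put s i j b : models s -> e $i $j = b -> models (mput s i j b).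
Proof.
move=> Ms eb i' j' c; rewrite /mput !mget_upd.
case: ifP => [/andP[/eqP-> /eqP->] [<-]|_]; first by rewrite e_sym.
by case: ifP => [/andP[/eqP-> /eqP->] [<-]|_ /Ms].
Qed.

Lemma mdistP s i j : models s -> mdist n neqs s i j -> $i != $j.
Proof.
move=> Ms; rewrite /mdist !lhasE; case: ifP => [|_].
  case/hasP=> z _ d _; have [b [/Ms h1 /Ms h2]] := differP d.
  by apply/eqP=> E; move: h2; rewrite -E h1; case: (b).
case/hasP=> -[p q] /(allP neqs_hold) /= h.
by case: ifP => [/eqP <- /eqP <-|_] //; case: ifP => // /eqP<- /eqP<-; rewrite eq_sym.
Qed.

Lemma fitsP s r m x : size r = size m -> fits s r m x ->
  forall t, t < size m -> mget s (nth 0 m t) x = Some (nth false r t).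
Proof.
elim: r m => [|b r IH] [|y m] //= [sz]; case: ifP => // /oeqbP h /IH {}IH.
by case=> //= t; rewrite ltnS => /IH; apply.
Qed.

Lemma twin_freeP s p m w : models s -> rows_wf p -> size m = size p ->
  w = [seq $i | i <- rev m] ->
  (forall i j, j < i -> i < size p -> e (nth x0 w i) (nth x0 w j) = radj p i j) ->
  twin_free n neqs s p m -> rows_copy p w x0.
Proof.
move=> Ms wf sz wE ew; rewrite /twin_free lallE => /allP h i j ji ip.
have jp := ltn_trans ji ip.
split; last exact: ew.
have: i \in iota 0 (size p) by rewrite mem_iota.
move/h; rewrite lallE => /allP /(_ j); rewrite mem_iota => /(_ ji).
have radjC a b : a != b -> radj p a b = radj p b a.
  by rewrite /radj; case: ltngtP.
have ew' a b : a != b -> a < size p -> b < size p ->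
    e (nth x0 w a) (nth x0 w b) = radj p a b.
  move=> ab ap bp; case: (ltngtP a b) => [lt|lt|E]; last by rewrite E eqxx in ab.
  + by rewrite e_sym ew // radjC // eq_sym.
  + exact: ew.
rewrite lhasE; case: ifP => [|_].
  case/hasP=> z; rewrite mem_filter mem_iota /= => /andP[/andP[zi zj] zp].
  move=> d _; have [b [[Ei] [Ej]]] := @differP (Some (radj p i z)) (Some (radj p j z)) d; apply/eqP=> E.
  have := ew' j z; rewrite -E ew' // 1?eq_sym // => /(_ zj jp zp).
  by rewrite Ei Ej; case: (b).
case: ifP => [rij _|_].
  by apply/eqP=> E; move: (ew i j ji ip); rewrite rij E e_irr.
move/mdistP => /(_ Ms).
have nthw k : k < size p -> nth x0 w k = $(nth 0 m (size p - k.+1)).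
  by move=> kp; rewrite wE (nth_map 0) ?size_rev ?sz // nth_rev ?sz.
by rewrite !nthw.
Qed.

Lemma embedP s p r m : models s -> rows_wf p -> rows_free p ->
  r = drop (size m) p -> size m <= size p ->
  (forall i j, j < i -> i < size m ->
     e $(nth 0 m (size m - i.+1)) $(nth 0 m (size m - j.+1)) = radj p i j) ->
  embed n neqs s p r m -> False.
Proof.
move=> Ms wf fr; elim: r m => [|r0 r IH] m rE szm em /=.
  have {}szm : size m = size p.
    apply/eqP; rewrite eqn_leq szm /=; move/(congr1 size)/eqP: rE.
    by rewrite size_drop /= eq_sym subn_eq0.
  move/(twin_freeP Ms wf szm (erefl _)) => h; apply: fr (h _).
    by rewrite size_map size_rev.
  move=> i j ji ip; have jp := ltn_trans ji ip.
  rewrite !(nth_map 0) ?size_rev ?szm // !nth_rev ?szm //.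
  by move: (em i j ji); rewrite szm; apply.
rewrite lhasE => /hasP[x _]; case: ifP => // ft /IH; apply => {IH} /=.
- have := congr1 behead rE; rewrite /= => ->.
  by rewrite -!drop1 drop_drop add1n.
- by move: (congr1 size rE); rewrite /= size_drop => h; rewrite -subn_gt0 -h.
have mp : size m < size p.
  by move: (congr1 size rE); rewrite /= size_drop => h; rewrite -subn_gt0 -h.
have r0E : nth [::] p (size m) = r0 by rewrite -[size m]addn0 -nth_drop -rE.
have szr : size r0 = size m.
  case/andP: wf => _ /allP /(_ (size m)); rewrite mem_iota r0E => h.
  by apply/eqP/h.
move=> i j ji; rewrite ltnS leq_eqVlt => /orP[/eqP Ei|im].
  rewrite Ei subnn /= {1}/nth -/(nth _).
  have jm : j < size m by rewrite -Ei.
  rewrite subSS -(prednK (n := size m - j)) ?subn_gt0 //=.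
  have h1 : (size m - j).-1 < size m.
    by rewrite prednK ?subn_gt0 // leq_subr.
  have := fitsP szr ft h1; move/Ms; rewrite e_sym => ->.
  by rewrite /radj jm r0E subnS.
have jm := ltn_trans ji im.
rewrite !subSS.
rewrite -(prednK (n := size m - i)) ?subn_gt0 // -(prednK (n := size m - j)) ?subn_gt0 //=.
by rewrite -!subnS; apply: em.
Qed.

Lemma embed2P s i j p : models s -> rows_wf p -> rows_free p ->
  embed2 n neqs s i j p -> False.
Proof.
move=> Ms wf fr; case: p wf fr => [|r0 [|r1 r]] //= wf fr.
case: ifP => // ft; apply: (embedP Ms wf fr) => //=.
  by rewrite drop0.
have szr : size r1 = 1 by case/and3P: (wf) => _ _ /= /andP[/eqP].
have := @fitsP _ _ [:: i] _ szr ft 0 isT; move/Ms => /= E.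
by case=> [|[|]] // [|] //= _ _; rewrite e_sym E.
Qed.

Lemma conflictP s i j : models s -> conflict n pats neqs clauses s i j -> False.
Proof.
move=> Ms; rewrite /conflict !lhasE; have E a b p : p \in pats -> ~ embed2 n neqs s a b p.
  by move=> pin; apply: (embed2P Ms (allP pats_wf _ pin) (pats_free pin)).
case: ifP => [/hasP[p pin /(E _ _ _ pin)] //|_].
case: ifP => [/hasP[p pin /(E _ _ _ pin)] //|_].
case/hasP=> c /(allP clauses_hold) /negP nc; rewrite lallE => /allP h.
by apply: nc; apply/allP=> l /h /oeqbP /Ms /eqP.
Qed.

Lemma passP ps s ch : models s ->
  if pass n pats neqs clauses ps s ch is Some (s', _) then models s' else False.
Proof.
elim: ps s ch => [|[i j] ps IH] s ch Ms //=.
case: (mget s i j) => [_|]; first exact: IH.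
have P b : e $i $j = b -> models (mput s i j b) by apply: models_put.
case: ifP => [c1|_]; last first.
  case: ifP => [c0|_]; last exact: IH.
  by apply: IH; apply: (P); apply/negPn/negP=> /negbTE/P /conflictP/(_ c0).
have {}c1 : e $i $j = false by apply/negP=> /P /conflictP/(_ c1).
case: ifP => [c0|_]; last by apply/IH/P.
exact: conflictP (P _ c1) c0.
Qed.

(** The actual graph is followed down the search tree: propagation records only values it has, and
    at a case split it satisfies one of the two branches. It would thus reach a leaf where a
    conflict contradicts [conflictP]. *)
Lemma searchP f ps s : models s -> ~~ search n pats neqs clauses f ps s.
Proof.
elim: f s => [|f IH] s Ms //=.
have := @passP ps s false Ms; case: (pass _ _ _ _ _ _ _) => // -[s' ch] Ms'.
case: ch; first exact: IH.
move: {4}ps => qs.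
elim: qs => [|[i j] qs IHq].
  by apply/negP; rewrite lhasE => /hasP[p _ /(conflictP Ms')].
case: (mget s' i j) => [_|] //.
have [eij|eij] := boolP (e $i $j).
  by rewrite (negbTE (IH _ (models_put Ms' eij))).
by case: ifP => // _; apply: IH; apply: models_put => //; apply: negbTE.
Qed.

Lemma models_load fs : all lit_holds fs -> models (load fs).
Proof.
elim: fs => [|[[i j] b] fs IH] /=; first by move=> _ i j b; rewrite /mget !nth_nil.
by case/andP=> /eqP h /IH; move/models_put; apply.
Qed.

Lemma refutableP fs : all lit_holds fs ->
  refutable n pats neqs clauses fs -> False.
Proof.
move=> /models_load Ms; rewrite /refutable; case: ifP => [|_].
  by rewrite lhasE => /hasP[f _ /(conflictP Ms)].
by move: (searchP 200 (pairs n) Ms) => /negP.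
Qed.

End Soundness.

Definition relabel k (E : seq (nat * nat)) (ord : seq nat) : rows :=
  [seq [seq let x := nth 0 ord i in let y := nth 0 ord (i - t.+1) in
        ((x, y) \in E) || ((y, x) \in E) | t <- iota 0 i] | i <- iota 0 k].

Lemma radj_relabel k E ord i j : j < i -> i < k ->
  radj (relabel k E ord) i j =
  ((nth 0 ord i, nth 0 ord j) \in E) || ((nth 0 ord j, nth 0 ord i) \in E).
Proof.
move=> ji ik; rewrite /radj ji /relabel.
rewrite (nth_map 0) ?size_iota // nth_iota // add0n.
rewrite (nth_map 0) ?size_iota ?nth_iota ?add0n; last 2 first.
- by rewrite ltn_subrL; case: (i) ji.
- by rewrite ltn_subrL; case: (i) ji.
by rewrite subnSK // subKn // ltnW.
Qed.

Lemma relabel_free (T : finType) (e : rel T) k E ord :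
  symmetric e -> irreflexive e -> (forall x, (x, x) \notin E) ->
  perm_eq ord (iota 0 k) ->
  ~ induced_sub e (@edge_in k E) -> rows_free e (relabel k E ord).
Proof.
move=> es ei Eirr po nF w x0 _ cp; apply: nF.
have szo : size ord = k by rewrite (perm_size po) size_iota.
have ino (i : 'I_k) : val i \in ord by rewrite (perm_mem po) mem_iota /=; apply: ltn_ord.
have ltk (i : 'I_k) : index (val i) ord < k by rewrite -[X in _ < X]szo index_mem ino.
have szr : size (relabel k E ord) = k by rewrite size_map size_iota.
exists (fun i => nth x0 w (index (val i) ord)).
have P (i j : 'I_k) : index (val j) ord < index (val i) ord ->
    nth x0 w (index (val i) ord) != nth x0 w (index (val j) ord) /\
    e (nth x0 w (index (val i) ord)) (nth x0 w (index (val j) ord)) = edge_in E i j.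
  move=> ji; have [||h1 h2] := cp (index (val i) ord) (index (val j) ord) => //.
    by rewrite szr.
  by split=> //; rewrite h2 radj_relabel // !nth_index.
have idx_inj (i j : 'I_k) : index (val i) ord = index (val j) ord -> i = j.
  move=> h; apply: val_inj.
  by rewrite -(nth_index 0 (ino i)) h nth_index.
split=> [i j E1|i j].
  apply: idx_inj; case: (ltngtP (index (val i) ord) (index (val j) ord)) => // /P [].
    by rewrite E1 eqxx.
  by rewrite E1 eqxx.
case: (ltngtP (index (val i) ord) (index (val j) ord)) => [/P [_]|/P [_] //|/idx_inj ->].
  by rewrite es => ->; rewrite /edge_in orbC.
by rewrite ei /edge_in orbb; apply/esym/negbTE/Eirr.
Qed.

Definition cycle_edges k := [seq (i, i.+1 %% k) | i <- iota 0 k].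
Definition pyramid_edges :=
  [:: (0,1); (0,2); (0,3); (1,4); (2,5); (3,6); (4,5); (4,6); (5,6)].
Definition pyramid : rel 'I_7 := @edge_in 7 pyramid_edges.

(* Each list contains one relabelling for every orbit of pairs of vertices, so
   that a copy can be searched starting from any given pair. *)
Definition base_pats : seq rows :=
  [seq relabel 4 (cycle_edges 4) o | o <- [:: [:: 0; 1; 2; 3]; [:: 0; 2; 1; 3]]] ++
  [seq relabel 6 [:: (0,1); (1,2); (3,4); (4,5)] o | o <-
   [:: [:: 0; 1; 2; 3; 4; 5]; [:: 0; 2; 1; 3; 4; 5]; [:: 0; 3; 1; 2; 4; 5];
       [:: 0; 4; 1; 2; 3; 5]; [:: 1; 4; 0; 2; 3; 5]]] ++
  [seq relabel 6 (cycle_edges 6) o | o <-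
   [:: [:: 0; 1; 2; 3; 4; 5]; [:: 0; 2; 1; 3; 4; 5]; [:: 0; 3; 1; 2; 4; 5]]] ++
  [seq relabel 7 (cycle_edges 7) o | o <-
   [:: [:: 0; 1; 2; 3; 4; 5; 6]; [:: 0; 2; 1; 3; 4; 5; 6];
       [:: 0; 3; 1; 2; 4; 5; 6]]] ++
  [seq relabel 9 [:: (0,1); (0,2); (0,4); (0,5); (1,3); (1,4); (1,5);
                (2,6); (3,6); (4,7); (5,8); (6,7); (6,8); (7,8)] o | o <-
   [:: [:: 0; 1; 4; 5; 2; 3; 6; 7; 8]; [:: 0; 2; 1; 4; 5; 3; 6; 7; 8];
       [:: 0; 3; 1; 4; 5; 2; 6; 7; 8]; [:: 0; 4; 1; 5; 2; 3; 6; 7; 8];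
       [:: 0; 6; 2; 1; 3; 4; 5; 7; 8]; [:: 0; 7; 4; 1; 5; 8; 6; 2; 3];
       [:: 2; 3; 6; 0; 1; 4; 5; 7; 8]; [:: 2; 4; 0; 1; 5; 3; 6; 7; 8];
       [:: 2; 6; 0; 1; 3; 4; 5; 7; 8]; [:: 2; 7; 6; 8; 0; 4; 1; 5; 3];
       [:: 4; 5; 0; 1; 2; 3; 6; 7; 8]; [:: 4; 6; 7; 8; 0; 1; 5; 2; 3];
       [:: 4; 7; 0; 1; 5; 8; 6; 2; 3]; [:: 4; 8; 7; 6; 0; 1; 5; 2; 3];
       [:: 6; 7; 8; 2; 0; 4; 1; 5; 3]; [:: 7; 8; 6; 2; 0; 4; 1; 5; 3]]].

Definition pyramid_pats : seq rows :=
  [seq relabel 7 pyramid_edges o | o <-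
   [:: [:: 0; 1; 2; 3; 4; 5; 6]; [:: 0; 4; 1; 2; 5; 6; 3];
       [:: 1; 2; 0; 3; 4; 5; 6]; [:: 1; 4; 0; 2; 5; 6; 3];
       [:: 1; 5; 4; 6; 0; 2; 3]; [:: 4; 5; 6; 1; 0; 2; 3]]].

Lemma cycle_edges_irr k x : 1 < k -> (x, x) \notin cycle_edges k.
Proof.
move=> k1; apply/mapP=> -[i]; rewrite mem_iota => /= ik [-> h].
case: (ltngtP i.+1 k) ik => // [lt|E] _.
  by move: h; rewrite modn_small // => /n_Sn.
by move: h; rewrite E modnn => i0; move: E; rewrite i0 => E1; move: k1; rewrite -E1.
Qed.

Lemma cycle_edge_in k : 1 < k -> forall i j : 'I_k,
  edge_in (cycle_edges k) i j = cycle_graph i j.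
Proof.
move=> k1 i j; rewrite /edge_in /cycle_graph.
have P (a b : 'I_k) : ((val a, val b) \in cycle_edges k) = (val b == (val a).+1 %% k).
  apply/mapP/eqP => [[x _ [Ea Eb]]|h]; first by rewrite /= Ea Eb.
  by exists (val a); rewrite ?mem_iota /= ?ltn_ord // -h.
by rewrite !P.
Qed.

Lemma induced_sub_ext (T : finType) (e : rel T) n (h h' : rel 'I_n) :
  (forall i j, h i j = h' i j) -> induced_sub e h -> induced_sub e h'.
Proof. by move=> hh [f [fi fe]]; exists f; split=> // i j; rewrite fe hh. Qed.

Definition free_pats (T : finType) (e : rel T) (ps : seq rows) : Prop :=
  forall p, p \in ps -> rows_free e p.

Lemma cat_free_pats (T : finType) (e : rel T) ps qs :
  free_pats e ps -> free_pats e qs -> free_pats e (ps ++ qs).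
Proof. by move=> h1 h2 p; rewrite mem_cat => /orP[/h1|/h2]. Qed.

Lemma map_free_pats (T : finType) (e : rel T) k E os :
  symmetric e -> irreflexive e -> (forall x, (x, x) \notin E) ->
  all (fun o => perm_eq o (iota 0 k)) os ->
  ~ induced_sub e (@edge_in k E) -> free_pats e [seq relabel k E o | o <- os].
Proof.
move=> es ei Ei /allP po nF p /mapP[o oin ->].
by apply: relabel_free => //; apply: po.
Qed.

Lemma cycle_free_pats (T : finType) (e : rel T) k os :
  symmetric e -> irreflexive e -> 1 < k ->
  all (fun o => perm_eq o (iota 0 k)) os ->
  ~ induced_sub e (@cycle_graph k) ->
  free_pats e [seq relabel k (cycle_edges k) o | o <- os].
Proof.
move=> es ei k1 po nF; apply: map_free_pats => //.
  by move=> x; apply: cycle_edges_irr.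
by apply: contra_not nF; apply: induced_sub_ext; apply: cycle_edge_in.
Qed.

Lemma irr_edges (E : seq (nat * nat)) : all (fun p => p.1 != p.2) E ->
  forall x, (x, x) \notin E.
Proof. by move=> /allP h x; apply/negP=> /h; rewrite eqxx. Qed.

Lemma base_free_pats (T : finType) (e : rel T) :
  symmetric e -> irreflexive e ->
  ~ induced_sub e twoP3 -> ~ induced_sub e (@cycle_graph 4) ->
  ~ induced_sub e (@cycle_graph 6) -> ~ induced_sub e (@cycle_graph 7) ->
  ~ induced_sub e T0 -> free_pats e base_pats.
Proof.
move=> es ei h1 h2 h3 h4 h5.
apply: cat_free_pats; first exact: cycle_free_pats.
apply: cat_free_pats; first by apply: map_free_pats => //; apply: irr_edges.
do 2 (apply: cat_free_pats; first exact: cycle_free_pats).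
by apply: map_free_pats => //; apply: irr_edges.
Qed.

Lemma pyramid_free_pats (T : finType) (e : rel T) :
  symmetric e -> irreflexive e -> ~ induced_sub e pyramid ->
  free_pats e pyramid_pats.
Proof. by move=> es ei h; apply: map_free_pats => //; apply: irr_edges. Qed.

(** * The refutation tactic *)

Section Lits.
Variables (T : finType) (e : rel T) (x0 : T) (v : seq T).
Local Notation "$ i" := (nth x0 v i) (at level 0, i at level 0).
Local Notation lits := (all (lit_holds e x0 v)).

(** This lemma and the next ones are the constructors from which the tactic assembles, one
    hypothesis of the context at a time, the proof term for the list of facts together with the list
    itself. *)
Lemma lits_pos i j fs : e $i $j -> lits fs -> lits ((i, j, true) :: fs).
Proof. by move=> h hs; rewrite /= /lit_holds /= h. Qed.
Lemma lits_neg i j fs : ~~ e $i $j -> lits fs -> lits ((i, j, false) :: fs).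
Proof. by move=> /negbTE h hs; rewrite /= /lit_holds /= h. Qed.

Local Notation difs := (all (fun p : nat * nat => $(p.1) != $(p.2))).
Lemma difs_cons i j fs : $i != $j -> difs fs -> difs ((i, j) :: fs).
Proof. by move=> h hs; rewrite /= h. Qed.

Local Notation clss := (all (fun c => ~~ all (lit_holds e x0 v) c)).
Lemma clss_cons i j k fs : ~~ (e $i $j && e $i $k) -> clss fs ->
  clss ([:: (i, j, true); (i, k, true)] :: fs).
Proof. by move=> h hs /=; rewrite hs andbT /lit_holds /= !eqb_id andbT. Qed.
End Lits.

Ltac nat_succ j := eval cbv in (S j).

Ltac lits_row e x0 v x i ys j acc :=
  lazymatch ys with
  | cons ?y ?ys' =>
    let acc' := match goal with
      | H : is_true (e x y) |- _ => constr:(@lits_pos _ e x0 v i j _ H acc)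
      | H : is_true (e y x) |- _ => constr:(@lits_pos _ e x0 v j i _ H acc)
      | H : is_true (~~ e x y) |- _ => constr:(@lits_neg _ e x0 v i j _ H acc)
      | H : is_true (~~ e y x) |- _ => constr:(@lits_neg _ e x0 v j i _ H acc)
      | _ => acc end in
    let j' := nat_succ j in lits_row e x0 v x i ys' j' acc'
  | _ => acc
  end.
Ltac lits_all e x0 v xs i acc :=
  lazymatch xs with
  | cons ?x ?ys => let i' := nat_succ i in
    let acc' := lits_row e x0 v x i ys i' acc in lits_all e x0 v ys i' acc'
  | _ => acc
  end.
Ltac difs_row x0 v x i ys j acc :=
  lazymatch ys with
  | cons ?y ?ys' =>
    let acc' := match goal with
      | H : is_true (x != y) |- _ => constr:(@difs_cons _ x0 v i j _ H acc)
      | H : is_true (y != x) |- _ => constr:(@difs_cons _ x0 v j i _ H acc)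
      | _ => acc end in
    let j' := nat_succ j in difs_row x0 v x i ys' j' acc'
  | _ => acc
  end.
Ltac difs_all x0 v xs i acc :=
  lazymatch xs with
  | cons ?x ?ys => let i' := nat_succ i in
    let acc' := difs_row x0 v x i ys i' acc in difs_all x0 v ys i' acc'
  | _ => acc
  end.
Ltac clss_row2 e x0 v x i y j zs k acc :=
  lazymatch zs with
  | cons ?z ?zs' =>
    let acc' := match goal with
      | H : is_true (~~ (e x y && e x z)) |- _ =>
          constr:(@clss_cons _ e x0 v i j k _ H acc)
      | _ => acc end in
    let k' := nat_succ k in clss_row2 e x0 v x i y j zs' k' acc'
  | _ => acc
  end.
Ltac clss_row e x0 v x i ys j acc :=
  lazymatch ys with
  | cons ?y ?ys' =>
    let acc' := clss_row2 e x0 v x i y j v 0 acc in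
    let j' := nat_succ j in clss_row e x0 v x i ys' j' acc'
  | _ => acc
  end.
Ltac clss_all e x0 v xs i acc :=
  lazymatch xs with
  | cons ?x ?ys => let i' := nat_succ i in
    let acc' := clss_row e x0 v x i v 0 acc in clss_all e x0 v ys i' acc'
  | _ => acc
  end.

Ltac refute_false b vs :=
  lazymatch goal with
  | Hs : symmetric ?e, Hi : irreflexive ?e, Hf : free_pats ?e ?ps |- False =>
    let T := lazymatch type of vs with seq ?T => T | list ?T => T end in
    let x0 := lazymatch vs with cons ?x _ => x end in
    let ls := lits_all e x0 vs vs 0 (isT : all (lit_holds e x0 vs) [::]) in
    let ds := difs_all x0 vs vs 0
      (isT : all (fun p : nat * nat => nth x0 vs p.1 != nth x0 vs p.2) [::]) in
    let c0 := constr:(isT : all (fun c => ~~ all (lit_holds e x0 vs) c) [::]) in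
    let cs := lazymatch b with
      | true => clss_all e x0 vs vs 0 c0 | false => c0 end in
    let n := eval cbv in (size vs) in
    refine (@refutableP _ e Hs Hi x0 vs n ps _ _ _ Hf ds cs _ ls _);
    [vm_compute; exact isT | vm_compute; exact isT]
  end.
Ltac to_false :=
  lazymatch goal with
  | |- False => idtac
  | |- is_true (~~ _) => apply/negP => ?
  | |- is_true _ => apply/negPn/negP => ?
  | |- _ = true => apply/negPn/negP => ?
  | |- _ = false => apply/negbTE/negP => ?
  end.

(* [ref vs] closes the goal by exhibiting a forbidden induced subgraph on [vs],
   whatever the values of the adjacencies that are not in the context;
   [refc vs] also uses the hypotheses of the form [~~ (e x y && e x z)]. *)
Tactic Notation "ref" constr(vs) := to_false; refute_false false vs.
Tactic Notation "refc" constr(vs) := to_false; refute_false true vs.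

(** * Clique cutsets and nonneighbours *)

Section Basic.
Variables (T : finType) (e : rel T) (es : symmetric e) (ei : irreflexive e).
Hypothesis fr : free_pats e base_pats.
Hypothesis nosimp : forall v, ~ simplicial e v.

Definition nn a : {set T} := [set x | (x != a) && ~~ e a x].

Lemma edge_neq x y : e x y -> x != y.
Proof. by apply: contraTneq => ->; rewrite ei. Qed.

(** Choose w in W with the smallest closed neighbourhood. If some x in W missed a neighbour y of w
    outside W, then by minimality x would have a neighbour z that w misses; z lies outside W, so y
    and z are adjacent and w x z y is a 4-hole. Hence the neighbourhood of w is a clique. *)
Lemma clique_with_clique_nbhd (W : {set T}) w0 : w0 \in W -> clique e W ->
  (forall w w' x y, w \in W -> w' \in W -> x \notin W -> y \notin W ->
     e w x -> e w' y -> x != y -> e x y) -> False.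
Proof.
move=> w0W clW out.
pose N w := [set x | (x == w) || e w x].
case: (arg_minnP (fun w => #|N w|) w0W) => w wW minw.
have mixed x y : x \in W -> y \notin W -> e w y -> x != w -> e x y.
  move=> xW yW wy xw; apply/negPn/negP => xy.
  have wx : e w x by apply: clW => //; rewrite eq_sym.
  have [z zx zw] : exists2 z, z \in N x & z \notin N w.
    apply/subsetPn; apply/negP => sub.
    have : N x \proper N w.
      apply/properP; split=> //; exists y; first by rewrite inE wy orbT.
      by rewrite inE negb_or xy andbT; apply: contraNneq yW => ->.
    by move/proper_card; rewrite ltnNge minw.
  have xz : e x z.
    move: zx; rewrite inE => /orP[/eqP Ez|//].
    by move: zw; rewrite inE Ez wx orbT.
  have zW : z \notin W.
    apply: contra zw => zW; rewrite inE; case: (eqVneq z w) => //= zw.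
    by apply: clW => //; rewrite eq_sym.
  have wz : ~~ e w z by apply: contra zw => wz; rewrite inE wz orbT.
  have yz : e y z by apply: (out w x) => //; apply: contraNneq wz => <-.
  have wnz : w != z by apply: contraNneq zW => <-.
  have xny : x != y by apply: contraNneq yW => <-.
  by ref [:: w; x; y; z].
apply: (nosimp (v := w)) => x y; rewrite !inE => wx wy xy.
have xw : x != w by rewrite eq_sym edge_neq.
have yw : y != w by rewrite eq_sym edge_neq.
case: (boolP (x \in W)) => xW; case: (boolP (y \in W)) => yW.
- exact: clW.
- exact: mixed.
- by rewrite es; apply: mixed.
- exact: (out w w).
Qed.

(** The two sides [D] and [R] are anticomplete, so induced three-vertex paths in both would form a
    2P3. On a side without such a path the closed neighbourhood of a vertex, taken within the side,
    is a clique and a whole component, and its outside neighbours lie in the clique [S]. *)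
Lemma clique_cutset (D S : {set T}) d0 a :
  d0 \in D -> a \notin D -> a \notin S ->
  (forall d x, d \in D -> x \notin D -> e d x -> x \in S) ->
  [disjoint D & S] -> clique e S -> False.
Proof.
move=> d0D aD aS DS dis clS.
pose R := ~: (D :|: S).
pose P3free (Z : {set T}) := [forall x in Z, forall y in Z, forall z in Z,
  e x y ==> e y z ==> (x != z) ==> e x z].
have main (Z : {set T}) z0 : z0 \in Z -> P3free Z ->
    (forall d x, d \in Z -> x \notin Z -> e d x -> x \in S) -> False.
  move=> z0Z P3 ZS.
  have {}P3 x y z : x \in Z -> y \in Z -> z \in Z -> e x y -> e y z ->
      x != z -> e x z.
    move=> xZ yZ zZ xy yz xz; move/forall_inP/(_ x xZ)/forall_inP: P3 => h.
    by move/(_ y yZ)/forall_inP/(_ z zZ): h; rewrite xy yz xz.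
  pose W := [set x in Z | (x == z0) || e z0 x].
  have toS w x : w \in W -> x \notin W -> e w x -> x \in S.
    rewrite inE => /andP[wZ /orP wz] xW wx; apply: (ZS w) => //.
    apply: contra xW => xZ; rewrite inE xZ /=.
    case: (eqVneq x z0) => //= xz.
    case: wz => [/eqP <-//|zw]; apply: (P3 z0 w) => //.
    by rewrite eq_sym.
  apply: (@clique_with_clique_nbhd W z0).
  - by rewrite inE z0Z eqxx.
  - move=> x y; rewrite !inE => /andP[xZ /orP[/eqP->|zx]] /andP[yZ /orP[/eqP->|zy]] xy //.
    + by rewrite eqxx in xy.
    + by rewrite es.
    + by apply: (P3 x z0 y) => //; rewrite es.
  - move=> w w' x y wW w'W xW yW wx wy; apply: clS; first exact: (toS w).
    exact: (toS w').
case: (boolP (P3free D)) => [|nD]; first by move/(main D d0 d0D); apply.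
case: (boolP (P3free R)) => [|nR].
  move/(main R a); apply; first by rewrite !inE negb_or aD.
  move=> r x; rewrite !inE negb_or negbK => /andP[rD rS] /orP[xD|//] rx.
  by case/negP: rS; apply: (DS x) => //; rewrite es.
have getP3 Z : ~~ P3free Z -> exists x y z,
    [/\ x \in Z, y \in Z, z \in Z & [/\ e x y, e y z, x != z & ~~ e x z]].
  case/forall_inPn=> x xZ /forall_inPn[y yZ] /forall_inPn[z zZ].
  by rewrite !negb_imply => /and4P[]; exists x, y, z.
have [x [y [z [xD yD zD [xy yz xz nxz]]]]] := getP3 _ nD.
have [p [q [r [pR qR rR [pq qr pr npr]]]]] := getP3 _ nR.
have anti d t : d \in D -> t \in R -> ~~ e d t.
  move=> dD; rewrite !inE negb_or => /andP[tD tS]; apply/negP => dt.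
  by case/negP: tS; apply: (DS d).
have := (anti x p xD pR, anti x q xD qR, anti x r xD rR).
have := (anti y p yD pR, anti y q yD qR, anti y r yD rR).
have := (anti z p zD pR, anti z q zD qR, anti z r zD rR).
move=> [[? ?] ?] [[? ?] ?] [[? ?] ?].
by ref [:: x; y; z; p; q; r].
Qed.

Definition within (D : {set T}) : rel T := fun x y => [&& x \in D, y \in D & e x y].

(** A shortest path between y and z with inner vertices in the component of d has at most four inner
    vertices: otherwise y with the first two and z with the last two would form a 2P3. The listed
    nonadjacencies all express minimality. *)
Lemma short_path (D : {set T}) d d' y z :
  d \in D -> connect (within D) d d' -> e y d -> e d' z ->
  y \notin D -> z \notin D -> ~~ e y z ->
  let C := connect (within D) d in
  [\/ exists d1, [/\ C d1, e y d1 & e d1 z],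
      exists d1 d2, [/\ C d1, C d2, e y d1, e d1 d2 & e d2 z] /\
                    [/\ ~~ e y d2 & ~~ e d1 z],
      exists d1 d2 d3, [/\ C d1, C d2, C d3 & e y d1] /\
         [/\ e d1 d2, e d2 d3 & e d3 z] /\
         [/\ ~~ e y d2, ~~ e y d3, ~~ e d1 z, ~~ e d2 z & ~~ e d1 d3] |
      exists d1 d2 d3 d4, [/\ C d1, C d2, C d3, C d4 & e y d1] /\
         [/\ e d1 d2, e d2 d3, e d3 d4 & e d4 z] /\
         [/\ ~~ e y d2, ~~ e y d3, ~~ e y d4 & ~~ e d1 z] /\
         [/\ ~~ e d2 z, ~~ e d3 z, ~~ e d1 d3, ~~ e d1 d4 & ~~ e d2 d4]].
Proof.
move=> dD cdd' yd d'z yD zD yz C.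
pose good s := if s is d1 :: s' then
  [&& e y d1, path (within D) d1 s', e (last d1 s') z & C d1] else false.
have ex0 : exists n, [exists t : n.-tuple T, good t].
  case/connectP: cdd' => s ps Ed'; exists (size s).+1.
  apply/existsP; exists (in_tuple (d :: s)).
  by rewrite /= yd ps -Ed' d'z /C connect0.
have [n /existsP[t gt] minn] := ex_minnP ex0.
have {}minn s : good s -> size t <= size s.
  move=> gs; rewrite size_tuple; apply: minn; apply/existsP.
  by exists (in_tuple s).
move: (tval t) gt minn => {ex0 n}{}t gt minn.
have inD x : C x -> x \in D.
  by case/connectP=> s; elim/last_ind: s => [_ -> //|s u _]; rewrite rcons_path last_rcons
    => /andP[_ /and3P[_ uD _]] ->.
have conn x x' : C x -> within D x x' -> C x'.
  by move=> Cx xx'; apply: connect_trans Cx _; apply: connect1.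
have inD2 x x' : C x -> C x' -> e x x' -> within D x x'.
  by move=> Cx Cx' ex; rewrite /within !inD.
have no s : size s < size t -> ~~ good s.
  by rewrite ltnNge; apply: contra => /minn.
case: t gt minn no => [//|d1 [|d2 [|d3 [|d4 [|d5 s]]]]] /=; rewrite ?andbT.
- by case/and3P=> ? ? ? _ _; apply: Or41; exists d1.
- move=> /and4P[yd1 w12 d2z C1] _ no.
  have C2 := conn _ _ C1 w12; have e12 : e d1 d2 by case/and3P: w12.
  apply: Or42; exists d1, d2; do !split=> //; apply/negP => h.
  + by have := no [:: d2] isT; rewrite /= h d2z C2.
  + by have := no [:: d1] isT; rewrite /= h yd1 C1.
- move=> /and4P[yd1 /andP[w12 w23] d3z C1] _ no.
  have C2 := conn _ _ C1 w12; have e12 : e d1 d2 by case/and3P: w12.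
  have C3 := conn _ _ C2 w23; have e23 : e d2 d3 by case/and3P: w23.
  apply: Or43; exists d1, d2, d3; do !split=> //; apply/negP => h.
  + by have := no [:: d2; d3] isT; rewrite /= h d3z C2 w23.
  + by have := no [:: d3] isT; rewrite /= h d3z C3.
  + by have := no [:: d1] isT; rewrite /= h yd1 C1.
  + by have := no [:: d1; d2] isT; rewrite /= h yd1 C1 w12.
  + by have := no [:: d1; d3] isT; rewrite /= yd1 C1 inD2 // d3z.
- move=> /and4P[yd1 /and3P[w12 w23 w34] d4z C1] _ no.
  have C2 := conn _ _ C1 w12; have e12 : e d1 d2 by case/and3P: w12.
  have C3 := conn _ _ C2 w23; have e23 : e d2 d3 by case/and3P: w23.
  have C4 := conn _ _ C3 w34; have e34 : e d3 d4 by case/and3P: w34.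
  apply: Or44; exists d1, d2, d3, d4; do !split=> //; apply/negP => h.
  + by have := no [:: d2; d3; d4] isT; rewrite /= h d4z C2 w23 w34.
  + by have := no [:: d3; d4] isT; rewrite /= h d4z C3 w34.
  + by have := no [:: d4] isT; rewrite /= h d4z C4.
  + by have := no [:: d1] isT; rewrite /= h yd1 C1.
  + by have := no [:: d1; d2] isT; rewrite /= h yd1 C1 w12.
  + by have := no [:: d1; d2; d3] isT; rewrite /= h yd1 C1 w12 w23.
  + by have := no [:: d1; d3; d4] isT; rewrite /= yd1 C1 inD2 // w34 d4z.
  + by have := no [:: d1; d4] isT; rewrite /= yd1 C1 inD2 // d4z.
  + by have := no [:: d1; d2; d4] isT; rewrite /= yd1 C1 w12 inD2 // d4z.
set w := d4 :: d5 :: s => gt minn no.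
have {gt} : good (d1 :: d2 :: d3 :: w) by [].
have [w' [p [q Ew]]] : exists w' p q, w = rcons (rcons w' p) q.
  rewrite /w; case/lastP: s {w minn no} => [|s q]; first by exists [::], d4, d5.
  case/lastP: s => [|s p]; first by exists [:: d4], d5, q.
  by exists (d4 :: d5 :: s), p, q; rewrite -!rcons_cons.
rewrite Ew /= !rcons_path !last_rcons.
move=> /and4P[yd1 /and3P[w12 w23 /andP[/andP[pw wp] wpq]] qz C1].
have szw : size w' <= size s by rewrite -ltnS -ltnS -(size_rcons w' p) -(size_rcons _ q) -Ew.
exfalso.
have C2 := conn _ _ C1 w12; have e12 : e d1 d2 by case/and3P: w12.
have C3 := conn _ _ C2 w23.
have Cl : C (last d3 w').
  by apply: connect_trans C3 _; apply/connectP; exists w'.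
have Cp := conn _ _ Cl wp; have Cq := conn _ _ Cp wpq.
have epq : e p q by case/and3P: wpq.
have ny u : C u -> y != u by move=> /inD uD; apply: contraNneq yD => ->.
have nz u : C u -> z != u by move=> /inD uD; apply: contraNneq zD => ->.
have [y2 zp] := (ny _ C2, nz _ Cp).
have h1 : ~~ e y d2.
  apply/negP => h; have := no (d2 :: d3 :: w); rewrite Ew /= !rcons_path !last_rcons.
  by rewrite h w23 pw wp wpq qz C2 !size_rcons /= !ltnS szw => /(_ isT).
have h2 : ~~ e p z.
  apply/negP => h; have := no (d1 :: d2 :: d3 :: rcons w' p).
  rewrite /= !rcons_path !last_rcons yd1 w12 w23 pw wp h C1 size_rcons /= !ltnS szw.
  by move/(_ isT).
have h3 : ~~ e y p by apply/negP => h; have := no [:: p; q] isT; rewrite /= h wpq qz Cp.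
have h4 : ~~ e y q by apply/negP => h; have := no [:: q] isT; rewrite /= h qz Cq.
have h5 : ~~ e d1 p.
  by apply/negP => h; have := no [:: d1; p; q] isT; rewrite /= yd1 inD2 // wpq qz C1.
have h6 : ~~ e d1 q.
  by apply/negP => h; have := no [:: d1; q] isT; rewrite /= yd1 inD2 // qz C1.
have h7 : ~~ e d2 p.
  by apply/negP => h; have := no [:: d1; d2; p; q] isT; rewrite /= yd1 w12 inD2 // wpq qz C1.
have h8 : ~~ e d2 q.
  by apply/negP => h; have := no [:: d1; d2; q] isT; rewrite /= yd1 w12 inD2 // qz C1.
have h9 : ~~ e d1 z by apply/negP => h; have := no [:: d1] isT; rewrite /= h yd1 C1.
have h10 : ~~ e d2 z by apply/negP => h; have := no [:: d1; d2] isT; rewrite /= h yd1 C1 w12.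
by ref [:: y; d1; d2; p; q; z].
Qed.

(** The attachments of the component of [d0] among the nonneighbours of [a] are neighbours of [a],
    and they are not a clique, since this would be a clique cutset. A shortest path through the
    component between two nonadjacent attachments closes with [a] to a hole; lengths 4, 6 and 7 are
    forbidden, so there are exactly two inner vertices. *)
Lemma hole_through a d0 : d0 \in nn a ->
  exists y z d d', [/\ e a y, e a z, ~~ e y z & y != z] /\
    [/\ e y d, e d d', e d' z, ~~ e y d' & ~~ e d z] /\
    [/\ connect (within (nn a)) d0 d & connect (within (nn a)) d0 d'] /\
    [/\ d \in nn a & d' \in nn a].
Proof.
move=> d0a; pose D := [set x | connect (within (nn a)) d0 x].
have Da x : x \in D -> x \in nn a.
  rewrite inE => /connectP[s]; elim/last_ind: s => [_ -> //|s u _].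
  by rewrite rcons_path last_rcons => /andP[_ /and3P[_ uD _]] ->.
have step x x' : x \in D -> x' \in nn a -> e x x' -> x' \in D.
  move=> xD x'a xx'; rewrite inE; apply: (connect_trans (y := x)).
    by rewrite inE in xD.
  by apply: connect1; rewrite /within x'a xx' Da.
pose S := [set x in ~: D | [exists d in D, e d x]].
have Sa x : x \in S -> e a x.
  rewrite !inE => /andP[xD /exists_inP[d dD dx]].
  have := Da d dD; rewrite inE => /andP[da nad].
  apply/negPn/negP => ax; case/negP: xD.
  have /(step d x dD)/(_ dx) : x \in nn a; last by rewrite inE.
  by rewrite inE ax andbT; apply: contraTneq dx => ->; rewrite es.
have ncl : ~ clique e S.
  have d0D : d0 \in D by rewrite inE connect0.
  apply: (clique_cutset d0D (a := a)).
  - by apply/negP => /Da; rewrite inE eqxx.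
  - by apply/negP => /Sa; rewrite ei.
  - move=> d x dD xD dx; rewrite inE [x \in ~: D]inE xD /=.
    by apply/exists_inP; exists d.
  - apply/pred0P => x /=; rewrite [x \in S]inE [x \in ~: D]inE.
    by case: (x \in D).
have [y [z [yS zS yz nyz]]] : exists y z, [/\ y \in S, z \in S, y != z & ~~ e y z].
  case: (boolP [exists y in S, exists z in S, (y != z) && ~~ e y z]).
    by case/exists_inP=> y yS /exists_inP[z zS /andP[]]; exists y, z.
  move=> h; case: ncl => y z yS zS yz; apply/negPn/negP => nyz.
  case/negP: h; apply/exists_inP; exists y => //; apply/exists_inP; exists z => //.
  by rewrite yz.
have ay := Sa _ yS; have az := Sa _ zS.
have ya : y \notin nn a by rewrite inE ay andbF.
have za : z \notin nn a by rewrite inE az andbF.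
move: yS zS; rewrite !inE => /andP[_ /exists_inP[d dD dy]] /andP[_ /exists_inP[d' dD' dz]].
have cs : connect_sym (within (nn a)).
  by apply: sym_connect_sym => u u'; rewrite /within es andbCA.
rewrite es in dy.
have cdd' : connect (within (nn a)) d d'.
  by apply: (connect_trans (y := d0)); [rewrite cs|]; [move: dD|move: dD']; rewrite inE.
have conn u : connect (within (nn a)) d u -> u \in D.
  by move=> h; rewrite inE; apply: connect_trans h; move: dD; rewrite inE.
have nna u : u \in D -> ~~ e a u by move/Da; rewrite inE => /andP[].
case: (short_path (Da _ dD) cdd' dy dz ya za nyz).
- case=> d1 [/conn/Da + ? ?]; rewrite inE => /andP[? ?]; exfalso.
  by ref [:: a; y; d1; z].
- case=> d1 [d2 [[/conn C1 /conn C2 yd1 d12 d2z] [yd2 d1z]]].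
  exists y, z, d1, d2; do !split=> //; try exact: Da.
    by rewrite inE in C1.
  by rewrite inE in C2.
- case=> d1 [d2 [d3 [[/conn/nna ? /conn/nna ? /conn/nna ? ?] [[? ? ?] [? ? ? ? ?]]]]].
  by exfalso; ref [:: a; y; d1; d2; d3; z].
- case=> d1 [d2 [d3 [d4 [[/conn/nna ? /conn/nna ? /conn/nna ? /conn/nna ? ?]
    [[? ? ? ?] [[? ? ? ?] [? ? ? ? ?]]]]]]].
  by exfalso; ref [:: a; y; d1; d2; d3; d4; z].
Qed.

(* Two components of [nn a] would give two 5-holes through [a] whose parts
   outside the closed neighbourhood of [a] are anticomplete. *)
Lemma nn_connected a (W : {set T}) w0 u0 :
  w0 \in W -> w0 \in nn a -> u0 \notin W -> u0 \in nn a ->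
  (forall w u, w \in W -> w \in nn a -> u \notin W -> u \in nn a -> ~~ e w u) -> False.
Proof.
move=> w0W w0a u0W u0a cl.
have [y [z [d [d' [[ay az yz nyz] [[yd dd' d'z yd' dz] [[cd cd'] [da d'a]]]]]]]] :=
  hole_through w0a.
have [y2 [z2 [f [f' [[ay2 az2 yz2 nyz2] [[yf ff' f'z2 yf' fz2] [[cf cf'] [fa f'a]]]]]]]] :=
  hole_through u0a.
have stay (b : bool) x x' : (x \in W) = b -> connect (within (nn a)) x x' -> (x' \in W) = b.
  move=> xb /connectP[s]; elim: s x xb => [|u s IH] x xb /=; first by move=> _ ->.
  case/andP=> /and3P[xa ua xu]; apply: IH; rewrite -xb.
  apply/idP/idP => h; apply/negPn/negP => h'.
    by case/negP: (cl u x h ua h' xa); rewrite es.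
  by case/negP: (cl x u h xa h' ua).
have dW := stay true _ _ w0W cd; have d'W := stay true _ _ w0W cd'.
have fW := stay false _ _ (negbTE u0W) cf; have f'W := stay false _ _ (negbTE u0W) cf'.
have := (cl d f dW da (negbT fW) fa, cl d f' dW da (negbT f'W) f'a).
have := (cl d' f d'W d'a (negbT fW) fa, cl d' f' d'W d'a (negbT f'W) f'a).
move: da d'a fa f'a; rewrite !inE.
move=> /andP[_ ?] /andP[_ ?] /andP[_ ?] /andP[_ ?] [? ?] [? ?].
case: (eqVneq y y2) => [?|?]; case: (eqVneq z z2) => [?|?];
  case: (eqVneq y z2) => [?|?]; case: (eqVneq z y2) => [?|?]; subst;
  try by rewrite eqxx in nyz.
all: try by rewrite eqxx in nyz2.
- by ref [:: a; y2; z2; d; d'; f; f'].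
- by ref [:: a; y2; z; d; d'; z2; f; f'].
- by ref [:: a; y; z2; d; d'; y2; f; f'].
- by ref [:: a; z2; y2; d; d'; f; f'].
- by ref [:: a; z2; z; d; d'; y2; f; f'].
- by ref [:: a; y; y2; d; d'; z2; f; f'].
- by ref [:: a; y; z; d; d'; y2; z2; f; f'].
Qed.

End Basic.

(** Sorting by cardinality suffices: of two comparable sets, the one with no more elements is
    contained in the other. *)
Lemma chain_order (T : finType) (X : {set T}) (f : T -> {set T}) x0 : x0 \in X ->
  (forall x y, x \in X -> y \in X -> (f x \subset f y) || (f y \subset f x)) ->
  exists u l, [/\ uniq (u :: l), (u :: l) =i X,
    sorted (fun x y => f y \subset f x) (u :: l) &
    forall x, x \in X -> f x \subset f u].
Proof.
move=> x0X nest.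
have sub x y : x \in X -> y \in X -> #|f y| <= #|f x| -> f y \subset f x.
  move=> xX yX le; case/orP: (nest x y xX yX) => // s.
  by rewrite subEproper eq_sym eqEcard s le.
pose s := sort (fun x y => #|f y| <= #|f x|) (enum X).
have sE : s =i X by move=> x; rewrite mem_sort mem_enum.
have us : uniq s by rewrite sort_uniq enum_uniq.
have ss : sorted (fun x y => f y \subset f x) s.
  have : sorted (fun x y => #|f y| <= #|f x|) s.
    by apply: sort_sorted => x y; apply: leq_total.
  apply: (@sub_in_sorted _ (mem X)); last by apply/allP => x; rewrite sE.
  by move=> x y; apply: sub.
case: s sE us ss => [|u l] sE us ss; first by move: (sE x0); rewrite x0X.
exists u, l; split=> // x; rewrite -sE inE => /orP[/eqP-> //|xl].
have tr : transitive (fun x y => f y \subset f x).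
  by move=> a b c ba ca; apply: subset_trans ca ba.
by have /allP/(_ x xl) := order_path_min tr ss.
Qed.

(** * Graphs without pyramids *)

Section NoPyramid.
Variables (T : finType) (e : rel T) (es : symmetric e) (ei : irreflexive e).
Hypothesis fr : free_pats e (base_pats ++ pyramid_pats).

Definition hole5 h0 h1 h2 h3 h4 := [&& [&& e h0 h1, e h1 h2, e h2 h3, e h3 h4 & e h4 h0]
  & [&& ~~ e h0 h2, ~~ e h1 h3, ~~ e h2 h4, ~~ e h3 h0 & ~~ e h4 h1]].

(* [rcls a b c d] is the class of the vertices that can replace the vertex
   between [a] and [b] in the hole with remaining vertices [c, d]. *)
Definition rcls a b c d : {set T} := [set v | [&& e v a, e v b, ~~ e v c & ~~ e v d]].
Definition ring h0 h1 h2 h3 h4 : {set T} :=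
  rcls h4 h1 h2 h3 :|: (rcls h0 h2 h3 h4 :|: (rcls h1 h3 h4 h0 :|:
  (rcls h2 h4 h0 h1 :|: rcls h3 h0 h1 h2))).
Definition centre h0 h1 h2 h3 h4 : {set T} :=
  [set v | [&& e v h0, e v h1, e v h2, e v h3 & e v h4]].

Lemma hole5_rot h0 h1 h2 h3 h4 : hole5 h0 h1 h2 h3 h4 -> hole5 h1 h2 h3 h4 h0.
Proof.
by case/andP=> /and5P[? ? ? ? ?] /and5P[? ? ? ? ?]; apply/andP; split; apply/and5P.
Qed.

Lemma ring_rot h0 h1 h2 h3 h4 : ring h1 h2 h3 h4 h0 = ring h0 h1 h2 h3 h4.
Proof. by rewrite /ring [RHS]setUC -!setUA. Qed.

Lemma centre_rot h0 h1 h2 h3 h4 : centre h1 h2 h3 h4 h0 = centre h0 h1 h2 h3 h4.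
Proof. by apply/setP=> v; rewrite !inE [RHS]andbC -!andbA. Qed.

Lemma rotations h0 h1 h2 h3 h4 (R := ring h0 h1 h2 h3 h4) (C := centre h0 h1 h2 h3 h4) :
  [/\ (ring h1 h2 h3 h4 h0 = R) * (centre h1 h2 h3 h4 h0 = C),
      (ring h2 h3 h4 h0 h1 = R) * (centre h2 h3 h4 h0 h1 = C),
      (ring h3 h4 h0 h1 h2 = R) * (centre h3 h4 h0 h1 h2 = C) &
      (ring h4 h0 h1 h2 h3 = R) * (centre h4 h0 h1 h2 h3 = C)].
Proof.
by do !split; rewrite /R /C; do ?[by rewrite ring_rot | by rewrite 2!ring_rot
  | by rewrite 3!ring_rot | by rewrite 4!ring_rot | by rewrite centre_rot
  | by rewrite 2!centre_rot | by rewrite 3!centre_rot | by rewrite 4!centre_rot].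
Qed.

Lemma rclsP a b c d v : reflect [/\ e v a, e v b, ~~ e v c & ~~ e v d] (v \in rcls a b c d).
Proof. by rewrite inE; apply: and4P. Qed.

Lemma ringP h0 h1 h2 h3 h4 v : reflect
  [\/ v \in rcls h4 h1 h2 h3, v \in rcls h0 h2 h3 h4, v \in rcls h1 h3 h4 h0 |
      v \in rcls h2 h4 h0 h1 \/ v \in rcls h3 h0 h1 h2] (v \in ring h0 h1 h2 h3 h4).
Proof.
rewrite /ring !in_setU; apply: (iffP idP).
  case/orP=> [?|/orP[?|/orP[?|/orP[?|?]]]];
    [exact: Or41|exact: Or42|exact: Or43|apply: Or44; left|apply: Or44; right] => //.
by case=> [->|->|->|[->|->]]; rewrite ?orbT.
Qed.

(** A vertex seeing h4 and h1 escapes the class of h0 only by seeing h2 or h3, and then the absence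
    of 4-holes makes it adjacent to the whole hole. *)
Lemma outside_pair0 h0 h1 h2 h3 h4 v : hole5 h0 h1 h2 h3 h4 ->
  v \notin ring h0 h1 h2 h3 h4 -> v \notin centre h0 h1 h2 h3 h4 ->
  ~~ (e v h4 && e v h1).
Proof.
move=> /andP[/and5P[? ? ? ? ?] /and5P[? ? ? ? ?]] vr vc; apply/andP => -[? ?].
have [? ?] : ~~ e v h2 /\ ~~ e v h3; last first.
  by case/negP: vr; apply/ringP; apply: Or41; apply/rclsP.
split; apply/negP => ?; case/negP: vc; rewrite inE;
  by apply/and5P; split=> //; ref [:: h0; h1; h2; h3; h4; v].
Qed.

Definition outside h0 h1 h2 h3 h4 v :=
  [/\ ~~ (e v h4 && e v h1), ~~ (e v h0 && e v h2), ~~ (e v h1 && e v h3),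
      ~~ (e v h2 && e v h4) & ~~ (e v h3 && e v h0)].

Lemma outside_pairs h0 h1 h2 h3 h4 v : hole5 h0 h1 h2 h3 h4 ->
  v \notin ring h0 h1 h2 h3 h4 -> v \notin centre h0 h1 h2 h3 h4 ->
  outside h0 h1 h2 h3 h4 v.
Proof.
move=> H vr vc; have H1 := hole5_rot H; have H2 := hole5_rot H1.
have H3 := hole5_rot H2; have H4 := hole5_rot H3.
have [R1 R2 R3 R4] := rotations h0 h1 h2 h3 h4.
split.
- exact: outside_pair0 H vr vc.
- by apply: (outside_pair0 H1); rewrite ?R1 ?R2 ?R3 ?R4.
- by apply: (outside_pair0 H2); rewrite ?R1 ?R2 ?R3 ?R4.
- by apply: (outside_pair0 H3); rewrite ?R1 ?R2 ?R3 ?R4.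
- by apply: (outside_pair0 H4); rewrite ?R1 ?R2 ?R3 ?R4.
Qed.

(* If [v] is adjacent to [h1], the vertex [h1] itself must be kept in the new
   hole: a ring vertex of the next class can miss [z]. *)
Lemma ring_grow h0 h1 h2 h3 h4 v y z : hole5 h0 h1 h2 h3 h4 ->
  v \notin ring h0 h1 h2 h3 h4 -> v \notin centre h0 h1 h2 h3 h4 ->
  y \in rcls h3 h0 h1 h2 -> z \in rcls h0 h2 h3 h4 -> e v y -> e v z ->
  ~~ e v h1 \/ z = h1 -> ~~ e v h4 \/ y = h4 ->
  hole5 h0 z h2 h3 y /\ ring h0 h1 h2 h3 h4 \proper ring h0 z h2 h3 y.
Proof.
move=> /andP[/and5P[? ? ? ? ?] /and5P[? ? ? ? ?]] vr vc.
move=> /rclsP[? ? ? ?] /rclsP[? ? ? ?] vy vz z1 y4.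
have nyz : ~~ e y z by ref [:: h0; h1; h2; h3; h4; y; z].
have nv2 : ~~ e v h2.
  apply/negP => v2; case/negP: vc; rewrite inE v2 /=.
  by apply/and4P; split; ref [:: h0; h1; h2; h3; h4; y; z; v].
have nv3 : ~~ e v h3.
  apply/negP => v3; case/negP: vc; rewrite inE v3 /=.
  by apply/and4P; split; ref [:: h0; h1; h2; h3; h4; y; z; v].
split; first by apply/andP; split; apply/and5P; split=> //; rewrite es.
have vcl : ~~ (e v h4 && e v h1).
  by apply: contra vr => /andP[? ?]; apply/ringP; apply: Or41; apply/rclsP.
apply/properP; split; last first.
  by exists v => //; apply/ringP; apply: Or41; apply/rclsP.
apply/subsetP=> w /ringP[|||[]] /rclsP[? ? ? ?]; apply/ringP;
  [apply: Or41|apply: Or42|apply: Or43|apply: Or44; left|apply: Or44; right];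
  apply/rclsP; split=> //; case: z1 => ?; case: y4 => ?; subst => //;
  by refc [:: h0; h1; h2; h3; h4; y; z; v; w] || refc [:: h0; h1; h2; h3; h4; y; v; w]
   || refc [:: h0; h1; h2; h3; h4; z; v; w] || refc [:: h0; h1; h2; h3; h4; v; w].
Qed.

Lemma ring_grow_ex h0 h1 h2 h3 h4 v y z : hole5 h0 h1 h2 h3 h4 ->
  v \notin ring h0 h1 h2 h3 h4 -> v \notin centre h0 h1 h2 h3 h4 ->
  y \in rcls h3 h0 h1 h2 -> z \in rcls h0 h2 h3 h4 -> e v y -> e v z ->
  exists y z, hole5 h0 z h2 h3 y /\ ring h0 h1 h2 h3 h4 \proper ring h0 z h2 h3 y.
Proof.
move=> H vr vc yX zX vy vz.
have [z' [z'X vz' z1]] : exists z', [/\ z' \in rcls h0 h2 h3 h4, e v z' &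
    ~~ e v h1 \/ z' = h1].
  case: (boolP (e v h1)) => v1; last by exists z; split=> //; left.
  exists h1; split=> //; last by right.
  case/andP: H => /and5P[? ? ? ? ?] /and5P[? ? ? ? ?].
  by apply/rclsP; split; rewrite // es.
have [y' [y'X vy' y4]] : exists y', [/\ y' \in rcls h3 h0 h1 h2, e v y' &
    ~~ e v h4 \/ y' = h4].
  case: (boolP (e v h4)) => v4; last by exists y; split=> //; left.
  exists h4; split=> //; last by right.
  case/andP: H => /and5P[? ? ? ? ?] /and5P[? ? ? ? ?].
  by apply/rclsP; split; rewrite // es.
by exists y', z'; apply: (ring_grow H vr vc).
Qed.

Definition maximal_ring (R : {set T}) := forall a b c d f,
  hole5 a b c d f -> ~~ (R \proper ring a b c d f).

(** The only use of maximality: if y and z lie two classes apart, then v could join the class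
    between them in a hole through y and z or their hole representatives, whose ring is larger. In
    equal or consecutive classes the adjacency follows from the forbidden subgraphs. *)
Lemma ring_attach0 h0 h1 h2 h3 h4 v y z : hole5 h0 h1 h2 h3 h4 ->
  maximal_ring (ring h0 h1 h2 h3 h4) ->
  v \notin ring h0 h1 h2 h3 h4 -> v \notin centre h0 h1 h2 h3 h4 ->
  y \in rcls h4 h1 h2 h3 -> z \in ring h0 h1 h2 h3 h4 -> e v y -> e v z ->
  y != z -> e y z.
Proof.
move=> H mx vr vc yX /ringP zX vy vz yz.
have [? ? ? ? ?] := outside_pairs H vr vc.
case: zX => [zX|zX|zX|[zX|zX]].
- move: H yX zX => /andP[/and5P[? ? ? ? ?] /and5P[? ? ? ? ?]].
  move=> /rclsP[? ? ? ?] /rclsP[? ? ? ?].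
  by ref [:: h0; h1; h2; h3; h4; y; z].
- move: H yX zX => /andP[/and5P[? ? ? ? ?] /and5P[? ? ? ? ?]].
  move=> /rclsP[? ? ? ?] /rclsP[? ? ? ?].
  by refc [:: h0; h1; h2; h3; h4; y; z; v].
- exfalso; have H1 := hole5_rot H.
  have [R1 _ _ _] := rotations h0 h1 h2 h3 h4; rewrite -!R1 in vr vc mx.
  have [y' [z' [h' p]]] := ring_grow_ex H1 vr vc yX zX vy vz.
  by case/negP: (mx _ _ _ _ _ h').
- exfalso; have H1 := hole5_rot (hole5_rot (hole5_rot (hole5_rot H))).
  have [_ _ _ R4] := rotations h0 h1 h2 h3 h4; rewrite -!R4 in vr vc mx.
  have [y' [z' [h' p]]] := ring_grow_ex H1 vr vc zX yX vz vy.
  by case/negP: (mx _ _ _ _ _ h').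
- move: H yX zX => /andP[/and5P[? ? ? ? ?] /and5P[? ? ? ? ?]].
  move=> /rclsP[? ? ? ?] /rclsP[? ? ? ?].
  by refc [:: h0; h1; h2; h3; h4; y; z; v].
Qed.

Lemma ring_attach h0 h1 h2 h3 h4 v y z : hole5 h0 h1 h2 h3 h4 ->
  maximal_ring (ring h0 h1 h2 h3 h4) ->
  v \notin ring h0 h1 h2 h3 h4 -> v \notin centre h0 h1 h2 h3 h4 ->
  y \in ring h0 h1 h2 h3 h4 -> z \in ring h0 h1 h2 h3 h4 -> e v y -> e v z ->
  y != z -> e y z.
Proof.
move=> H mx vr vc yR zR vy vz yz.
have H1 := hole5_rot H; have H2 := hole5_rot H1.
have H3 := hole5_rot H2; have H4 := hole5_rot H3.
have [R1 R2 R3 R4] := rotations h0 h1 h2 h3 h4.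
case/ringP: (yR) => [yX|yX|yX|[yX|yX]].
- exact: ring_attach0 H mx vr vc yX zR vy vz yz.
- by apply: (ring_attach0 H1) vy vz yz; rewrite ?R1 ?R2 ?R3 ?R4.
- by apply: (ring_attach0 H2) vy vz yz; rewrite ?R1 ?R2 ?R3 ?R4.
- by apply: (ring_attach0 H3) vy vz yz; rewrite ?R1 ?R2 ?R3 ?R4.
- by apply: (ring_attach0 H4) vy vz yz; rewrite ?R1 ?R2 ?R3 ?R4.
Qed.

Lemma base_of_all : free_pats e base_pats.
Proof. by move=> p pin; apply: fr; rewrite mem_cat pin. Qed.

Lemma ring_clique h0 h1 h2 h3 h4 x y : hole5 h0 h1 h2 h3 h4 ->
  x \in rcls h4 h1 h2 h3 -> y \in rcls h4 h1 h2 h3 -> x != y -> e x y.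
Proof.
move=> /andP[/and5P[? ? ? ? ?] /and5P[? ? ? ? ?]].
by move=> /rclsP[? ? ? ?] /rclsP[? ? ? ?] ?; ref [:: h0; h1; h2; h3; h4; x; y].
Qed.

Lemma hole_in_class h0 h1 h2 h3 h4 : hole5 h0 h1 h2 h3 h4 -> h0 \in rcls h4 h1 h2 h3.
Proof.
by move=> /andP[/and5P[? ? ? ? ?] /and5P[? ? ? ? ?]]; apply/rclsP; split; rewrite // es.
Qed.

Lemma centre_complete h0 h1 h2 h3 h4 u x : hole5 h0 h1 h2 h3 h4 ->
  u \in centre h0 h1 h2 h3 h4 -> x \in ring h0 h1 h2 h3 h4 -> e u x.
Proof.
move=> /andP[/and5P[? ? ? ? ?] /and5P[? ? ? ? ?]]; rewrite inE => /and5P[? ? ? ? ?].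
by move=> /ringP[|||[]] /rclsP[? ? ? ?]; ref [:: h0; h1; h2; h3; h4; u; x].
Qed.

Lemma centre_clique h0 h1 h2 h3 h4 : hole5 h0 h1 h2 h3 h4 ->
  clique e (centre h0 h1 h2 h3 h4).
Proof.
move=> /andP[/and5P[? ? ? ? ?] /and5P[? ? ? ? ?]] x y.
rewrite !inE => /and5P[? ? ? ? ?] /and5P[? ? ? ? ?] ?.
by ref [:: h0; h1; h2; h3; h4; x; y].
Qed.

Lemma attach_far0 h0 h1 h2 h3 h4 v w : hole5 h0 h1 h2 h3 h4 ->
  maximal_ring (ring h0 h1 h2 h3 h4) ->
  v \notin ring h0 h1 h2 h3 h4 -> v \notin centre h0 h1 h2 h3 h4 ->
  w \in rcls h4 h1 h2 h3 -> ~~ (e v w && e v h2) /\ ~~ (e v w && e v h3).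
Proof.
move=> H mx vr vc wX; have /rclsP[w4 w1 nw2 nw3] := wX.
have H1 := hole5_rot H; have H2 := hole5_rot H1; have H3 := hole5_rot H2.
have [_ R2 R3 _] := rotations h0 h1 h2 h3 h4.
have wR : w \in ring h0 h1 h2 h3 h4 by apply/ringP; apply: Or41.
have h2R : h2 \in ring h0 h1 h2 h3 h4.
  by rewrite -R2; apply/ringP; apply: Or41; apply: hole_in_class.
have h3R : h3 \in ring h0 h1 h2 h3 h4.
  by rewrite -R3; apply/ringP; apply: Or41; apply: hole_in_class.
have att x : x \in ring h0 h1 h2 h3 h4 -> ~~ e w x -> w != x -> ~~ (e v w && e v x).
  move=> xR nwx wx; apply: contra nwx => /andP[vw vx].
  exact: (ring_attach H mx vr vc wR xR vw vx wx).
case/andP: H => /and5P[? ? ? ? ?] /and5P[? ? ? ? ?].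
split; apply: att => //.
  by apply: contraTneq w4 => ->.
by apply: contraTneq w1 => ->; rewrite es.
Qed.

(** These are the three longer outcomes of [short_path] for a path outside the ring and its centre.
    Which hole vertices the inner vertices see is not known; the restrictions from [outside_pairs]
    and [attach_far0] are disjunctive and enter the search as clauses. *)
Lemma no_long_attach h0 h1 h2 h3 h4 y z : hole5 h0 h1 h2 h3 h4 ->
  maximal_ring (ring h0 h1 h2 h3 h4) ->
  y \in rcls h4 h1 h2 h3 -> z \in ring h0 h1 h2 h3 h4 -> ~~ e y z -> y != z ->
  let O d := (d \notin ring h0 h1 h2 h3 h4) && (d \notin centre h0 h1 h2 h3 h4) in
  [/\ forall d1 d2, O d1 -> O d2 -> e y d1 -> e d1 d2 -> e d2 z ->
        ~~ e y d2 -> ~~ e d1 z -> False,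
      forall d1 d2 d3, O d1 -> O d2 -> O d3 -> e y d1 -> e d1 d2 -> e d2 d3 ->
        e d3 z -> ~~ e y d2 -> ~~ e y d3 -> ~~ e d1 z -> ~~ e d2 z ->
        ~~ e d1 d3 -> False &
      forall d1 d2 d3 d4, O d1 -> O d2 -> O d3 -> O d4 -> e y d1 -> e d1 d2 ->
        e d2 d3 -> e d3 d4 -> e d4 z -> ~~ e y d2 -> ~~ e y d3 -> ~~ e y d4 ->
        ~~ e d1 z -> ~~ e d2 z -> ~~ e d3 z -> ~~ e d1 d3 -> ~~ e d1 d4 ->
        ~~ e d2 d4 -> False].
Proof.
move=> H mx yX zR nyz yz O.
have out d : O d -> outside h0 h1 h2 h3 h4 d by case/andP; apply: outside_pairs.
have ay d : O d -> ~~ (e d y && e d h2) /\ ~~ (e d y && e d h3).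
  by case/andP=> dr dc; apply: attach_far0 H mx dr dc yX.
have [R1 R2 R3 R4] := rotations h0 h1 h2 h3 h4.
have H1 := hole5_rot H; have H2 := hole5_rot H1.
have H3 := hole5_rot H2; have H4 := hole5_rot H3.
case/ringP: zR => [zX|zX|zX|[zX|zX]].
- by case/negP: nyz; apply: ring_clique H yX zX yz.
1: have az d (Od : O d) : ~~ (e d z && e d h3) /\ ~~ (e d z && e d h4) by
  case/andP: Od => dr dc; apply: (attach_far0 H1); rewrite ?R1.
2: have az d (Od : O d) : ~~ (e d z && e d h4) /\ ~~ (e d z && e d h0) by
  case/andP: Od => dr dc; apply: (attach_far0 H2); rewrite ?R2.
3: have az d (Od : O d) : ~~ (e d z && e d h0) /\ ~~ (e d z && e d h1) by
  case/andP: Od => dr dc; apply: (attach_far0 H3); rewrite ?R3.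
4: have az d (Od : O d) : ~~ (e d z && e d h1) /\ ~~ (e d z && e d h2) by
  case/andP: Od => dr dc; apply: (attach_far0 H4); rewrite ?R4.
all: case/andP: H => /and5P[? ? ? ? ?] /and5P[? ? ? ? ?].
all: case/rclsP: yX => ? ? ? ?; case/rclsP: zX => ? ? ? ?.
all: split=> [d1 d2 O1 O2|d1 d2 d3 O1 O2 O3|d1 d2 d3 d4 O1 O2 O3 O4] *.
all: have [[? ?] [? ? ? ? ?] [? ? ? ? ?]] := And3 (ay _ O1) (out _ O1) (out _ O2).
1,4,7,10: by have [? ?] := az _ O2; refc [:: h0; h1; h2; h3; h4; y; z; d1; d2].
all: have [? ? ? ? ?] := out _ O3.
1,3,5,7: by have [? ?] := az _ O3; refc [:: h0; h1; h2; h3; h4; y; z; d1; d2; d3].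
all: have [[? ?] [? ? ? ? ?]] := conj (az _ O4) (out _ O4).
all: by refc [:: h0; h1; h2; h3; h4; y; z; d1; d2; d3; d4].
Qed.

End NoPyramid.

Lemma map_nth_enum (A : Type) (d : A) (s : seq A) n : size s = n ->
  [seq nth d s (val i) | i <- enum 'I_n] = s.
Proof.
move=> <-; rewrite (map_comp (nth d s) val) val_enum_ord.
exact: mkseq_nth.
Qed.

(** * The ring and its centre cover the graph, and the ring is a 5-crown *)

Section Cover.
Variables (T : finType) (e : rel T) (es : symmetric e) (ei : irreflexive e).
Hypothesis fr : free_pats e (base_pats ++ pyramid_pats).
Hypothesis nosimp : forall v, ~ simplicial e v.

Lemma two_nonadjacent (v0 : T) : exists a d, d \in nn e a.
Proof.
case: (boolP [exists a, exists d, d \in nn e a]).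
  by case/existsP=> a /existsP[d ad]; exists a, d.
move=> no; case: (nosimp (v := v0)) => x y _ _ xy; apply/negPn/negP => nxy.
case/negP: no; apply/existsP; exists x; apply/existsP; exists y.
by rewrite inE nxy eq_sym xy.
Qed.

Lemma max_hole (v0 : T) : exists h0 h1 h2 h3 h4, hole5 e h0 h1 h2 h3 h4 /\
  maximal_ring e (ring e h0 h1 h2 h3 h4).
Proof.
have [a [d0 /(hole_through es ei (base_of_all fr) nosimp)]] := two_nonadjacent v0.
case=> y [z [d [d' [[ay az yz _] [[yd dd' d'z yd' dz] [_ [da d'a]]]]]]].
pose P (p : T * T * T * T * T) := hole5 e p.1.1.1.1 p.1.1.1.2 p.1.1.2 p.1.2 p.2.
pose R (p : T * T * T * T * T) := ring e p.1.1.1.1 p.1.1.1.2 p.1.1.2 p.1.2 p.2.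
have P0 : P (a, y, d, d', z).
  move: da d'a; rewrite !inE => /andP[_ ?] /andP[_ ?].
  by apply/andP; split; apply/and5P; split; rewrite //= es.
case: (arg_maxnP (fun p => #|R p|) P0) => -[[[[h0 h1] h2] h3] h4] H mx.
exists h0, h1, h2, h3, h4; split=> // b0 b1 b2 b3 b4 Hb.
apply/negP => /proper_card; rewrite ltnNge => /negP; apply.
exact: (mx (b0, b1, b2, b3, b4)).
Qed.

Variables h0 h1 h2 h3 h4 : T.
Hypotheses (H : hole5 e h0 h1 h2 h3 h4)
  (mx : maximal_ring e (ring e h0 h1 h2 h3 h4)).
Local Notation R := (ring e h0 h1 h2 h3 h4).
Local Notation U := (centre e h0 h1 h2 h3 h4).

(** Rotating the hole brings any ring vertex into the class of the first hole vertex, without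
    changing the ring or the centre. *)
Lemma ring_induct (P : T -> T -> T -> T -> T -> T -> Prop) :
  (forall a b c d f x, hole5 e a b c d f -> ring e a b c d f = R ->
     x \in rcls e f b c d -> P a b c d f x) ->
  forall x, x \in R -> exists a b c d f,
    [/\ hole5 e a b c d f, ring e a b c d f = R, centre e a b c d f = U,
        x \in rcls e f b c d & P a b c d f x].
Proof.
move=> IH x /ringP xR.
have [R1 R2 R3 R4] := rotations e h0 h1 h2 h3 h4.
have H1 := hole5_rot H; have H2 := hole5_rot H1.
have H3 := hole5_rot H2; have H4 := hole5_rot H3.
case: xR => [xX|xX|xX|[xX|xX]].
- by exists h0, h1, h2, h3, h4; split=> //; apply: IH.
- by exists h1, h2, h3, h4, h0; split; rewrite ?R1 //; apply: IH; rewrite ?R1.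
- by exists h2, h3, h4, h0, h1; split; rewrite ?R2 //; apply: IH; rewrite ?R2.
- by exists h3, h4, h0, h1, h2; split; rewrite ?R3 //; apply: IH; rewrite ?R3.
- by exists h4, h0, h1, h2, h3; split; rewrite ?R4 //; apply: IH; rewrite ?R4.
Qed.

(** A component outside the ring and the centre would have two nonadjacent attachments, as they do
    not form a clique cutset. Both lie in the ring because the centre is a clique complete to the
    ring. A shortest path between them through the component contradicts [ring_attach] when it has
    one inner vertex and [no_long_attach] otherwise. *)
Lemma ring_cover v : (v \in R) || (v \in U).
Proof.
pose O := ~: (R :|: U).
have inO x : (x \in O) = (x \notin R) && (x \notin U).
  by rewrite /O in_setC in_setU negb_or.
case: (boolP (v \in O)) => [vO|]; last by rewrite inO negb_and !negbK.
exfalso.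
have frb := base_of_all fr.
pose D := [set x | connect (within e O) v x].
have cs : connect_sym (within e O).
  by apply: sym_connect_sym => u u'; rewrite /within es andbCA.
have DO x : x \in D -> x \in O.
  rewrite inE => /connectP[s]; elim/last_ind: s => [_ -> //|s u _].
  by rewrite rcons_path last_rcons => /andP[_ /and3P[_ uD _]] ->.
have step x x' : x \in D -> x' \in O -> e x x' -> x' \in D.
  move=> xD x'O xx'; rewrite inE; apply: (connect_trans (y := x)).
    by rewrite inE in xD.
  by apply: connect1; rewrite /within x'O xx' DO.
pose S := [set x in ~: D | [exists d in D, e d x]].
have SRU x : x \in S -> x \in R :|: U.
  rewrite [x \in S]inE [x \in ~: D]inE => /andP[xD /exists_inP[d dD dx]].
  by apply/negPn/negP => xO; case/negP: xD; apply: (step d) => //; rewrite in_setC.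
have [[yn [y0 y1]] _] : (~~ e h0 h2 /\ h0 \in R /\ h2 \in R) /\ True.
  have [_ R2 _ _] := rotations e h0 h1 h2 h3 h4; split=> //.
  split; first by case/andP: H => _ /and5P[].
  split; first by apply/ringP; apply: Or41; apply: (hole_in_class es).
  have H2 := hole5_rot (hole5_rot H).
  by rewrite -R2; apply/ringP; apply: Or41; apply: (hole_in_class es).
have RD x : x \in R -> x \notin D.
  by move=> xR; apply/negP => /DO; rewrite inO xR.
have h02 : h0 != h2.
  case/andP: H => /and5P[_ _ h23 _ _] /and5P[_ _ _ h30 _].
  by apply: contraNneq h30 => ->; rewrite es.
have ncl : ~ clique e S.
  move=> clS; have [a aR aS] : exists2 a, a \in R & a \notin S.
    case: (boolP (h0 \in S)) => h0S; last by exists h0.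
    case: (boolP (h2 \in S)) => h2S; last by exists h2.
    by case/negP: yn; apply: clS.
  have vD : v \in D by rewrite inE connect0.
  apply: (clique_cutset es ei frb nosimp vD (RD _ aR) aS _ _ clS).
    move=> d x dD xD dx; rewrite inE [x \in ~: D]inE xD /=.
    by apply/exists_inP; exists d.
  by apply/pred0P => x /=; rewrite [x \in S]inE [x \in ~: D]inE; case: (x \in D).
have [y [z [yS zS yz nyz]]] : exists y z, [/\ y \in S, z \in S, y != z & ~~ e y z].
  case: (boolP [exists y in S, exists z in S, (y != z) && ~~ e y z]).
    by case/exists_inP=> y yS /exists_inP[z zS /andP[]]; exists y, z.
  move=> h; case: ncl => y z yS zS yz; apply/negPn/negP => nyz.
  case/negP: h; apply/exists_inP; exists y => //; apply/exists_inP; exists z => //.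
  by rewrite yz.
have [yR zR] : y \in R /\ z \in R.
  have Uc := centre_complete es ei fr H; have Ucl := centre_clique es ei fr H.
  case/setUP: (SRU _ yS) => yy; case/setUP: (SRU _ zS) => zz; split=> //.
  - by case/negP: nyz; rewrite es; apply: Uc.
  - by case/negP: nyz; apply: Uc.
  - by case/negP: nyz; apply: Ucl.
  - by case/negP: nyz; apply: Ucl.
have yO : y \notin O by rewrite inO yR.
have zO : z \notin O by rewrite inO zR.
move: yS zS; rewrite [y \in S]inE [z \in S]inE.
move=> /andP[_ /exists_inP[d dD dy]] /andP[_ /exists_inP[d' dD' dz]].
rewrite es in dy.
have cdd' : connect (within e O) d d'.
  by apply: (connect_trans (y := v)); [rewrite cs|]; [move: dD|move: dD']; rewrite inE.
have conn u : connect (within e O) d u -> u \in O.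
  move=> h; apply: DO; rewrite inE; apply: connect_trans h; move: dD; rewrite inE //.
have [a [b [c [f [g [Hh Rh Uh yX _]]]]]] :=
  ring_induct (P := fun _ _ _ _ _ _ => True) (fun _ _ _ _ _ _ _ _ _ => I) yR.
have mxh : maximal_ring e (ring e a b c f g) by rewrite Rh.
have zh : z \in ring e a b c f g by rewrite Rh.
have Oh u : connect (within e O) d u ->
    (u \notin ring e a b c f g) && (u \notin centre e a b c f g).
  by move=> /conn; rewrite Rh Uh inO.
have [N2 N3 N4] := no_long_attach es ei fr Hh mxh yX zh nyz yz.
case: (short_path es ei frb (DO _ dD) cdd' dy dz yO zO nyz).
- case=> d1 [/Oh/andP[dr dc] yd d1z]; case/negP: nyz.
  by apply: (ring_attach es ei fr Hh mxh dr dc) => //; rewrite ?Rh // es.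
- by case=> d1 [d2 [[/Oh C1 /Oh C2 yd1 d12 d2z] [yd2 d1z]]]; apply: (N2 d1 d2).
- case=> d1 [d2 [d3 [[/Oh C1 /Oh C2 /Oh C3 a1] [[a2 a3 a4] [a5 a6 a7 a8 a9]]]]].
  by apply: (N3 d1 d2 d3).
- case=> d1 [d2 [d3 [d4 [[/Oh C1 /Oh C2 /Oh C3 /Oh C4 a1]
    [[? ? ? ?] [[? ? ? ?] [? ? ? ? ?]]]]]]].
  by apply: (N4 d1 d2 d3 d4).
Qed.

Lemma in_cnbhd (S : {set T}) x y :
  (y \in cnbhd e S x) = (y \in S) && ((y == x) || e x y).
Proof. by rewrite inE. Qed.

Lemma ring_nested0 a b c d f x y : hole5 e a b c d f -> ring e a b c d f = R ->
  x \in rcls e f b c d -> y \in rcls e f b c d ->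
  (cnbhd e R x \subset cnbhd e R y) || (cnbhd e R y \subset cnbhd e R x).
Proof.
move=> Hh Rh xX yX; apply/orP.
case: (boolP (cnbhd e R x \subset _)) => [|/subsetPn[p px py]]; first by left.
right; apply/subsetP => q qy; apply/negPn/negP => qx.
case: (eqVneq x y) => [E|xy]; first by rewrite -E px in py.
have exy := ring_clique es ei fr Hh xX yX xy.
move: px py qx qy; rewrite !in_cnbhd -Rh => /andP[/ringP pR xp] + + /andP[/ringP qR yq].
have -> : p \in ring e a b c d f by apply/ringP.
have -> : q \in ring e a b c d f by apply/ringP.
rewrite /= !negb_or => /andP[py nyp] /andP[qx nxq].
have {}xp : e x p by case/orP: xp => // /eqP E; rewrite E es exy in nyp.
have {}yq : e y q by case/orP: yq => // /eqP E; rewrite E exy in nxq.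
move: (Hh) => /andP[/and5P[? ? ? ? ?] /and5P[? ? ? ? ?]].
case/rclsP: xX => ? ? ? ?; case/rclsP: yX => ? ? ? ?.
case: pR => [|||[]] /rclsP[? ? ? ?]; case: qR => [|||[]] /rclsP[? ? ? ?];
  by ref [:: a; b; c; d; f; x; y; p; q].
Qed.

Lemma cnbhd_top a b c d f : hole5 e a b c d f -> ring e a b c d f = R ->
  cnbhd e R a = rcls e f b c d :|: rcls e a c d f :|: rcls e d a b c.
Proof.
move=> Hh Rh; apply/setP => x; rewrite in_cnbhd -Rh 2!in_setU.
have [aX ] := conj (hole_in_class es Hh) Hh.
move=> /andP[/and5P[? ? ? ? ?] /and5P[? ? ? ? ?]].
apply/andP/idP => [[/ringP xR /orP[/eqP ->|ax]]|xN]; first by rewrite aX.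
  case: xR => [->|->|xX|[xX|->]]; rewrite ?orbT //; exfalso;
    by case/rclsP: xX => ? ? ? ?; ref [:: a; b; c; d; f; x].
split.
  apply/ringP; case/orP: xN => [/orP[?|?]|?];
   [exact: Or41|exact: Or42|by apply: Or44; right].
case/orP: xN => [/orP[xX|]|]; last 2 first.
- by case/rclsP=> ? ? ? ?; rewrite [e a x]es; apply/orP; right.
- by case/rclsP=> ? ? ? ?; rewrite [e a x]es; apply/orP; right.
by case: eqVneq => //= xa; apply: (ring_clique es ei fr Hh aX xX); rewrite eq_sym.
Qed.

Lemma cnbhd_max a b c d f x : hole5 e a b c d f -> ring e a b c d f = R ->
  x \in rcls e f b c d -> cnbhd e R x \subset cnbhd e R a.
Proof.
move=> Hh Rh xX; rewrite (cnbhd_top Hh Rh); apply/subsetP => y.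
rewrite in_cnbhd -Rh 2!in_setU => /andP[/ringP yR /orP[/eqP ->|xy]]; first by rewrite xX.
move: (Hh) => /andP[/and5P[? ? ? ? ?] /and5P[? ? ? ? ?]].
case/rclsP: xX => ? ? ? ?.
case: yR => [->|->|yX|[yX|->]]; rewrite ?orbT //; exfalso;
  by case/rclsP: yX => ? ? ? ?; ref [:: a; b; c; d; f; x; y].
Qed.

Lemma ring_chainP a b c d f N : hole5 e a b c d f -> ring e a b c d f = R ->
  N = rcls e f b c d :|: rcls e a c d f :|: rcls e d a b c ->
  ring_chain e R (rcls e f b c d) N.
Proof.
move=> Hh Rh ->; have aX := hole_in_class es Hh.
have [u [l [ul ulX so top]]] := chain_order aX (fun x y => ring_nested0 Hh Rh (x := x) (y := y)).
have inX x : x \in u :: l -> x \in rcls e f b c d by rewrite ulX.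
exists u, l; split=> //; split=> //; split=> //; split.
  apply/subsetP => x xX; rewrite in_cnbhd -Rh; apply/andP; split.
    by apply/ringP; apply: Or41.
  case: eqVneq => //= xl; apply: (ring_clique es ei fr Hh) => //.
    by apply: inX; apply: mem_last.
  by rewrite eq_sym.
apply/eqP; rewrite -(cnbhd_top Hh Rh) eqEsubset top // andbT.
by apply: (cnbhd_max Hh Rh); apply: inX; rewrite mem_head.
Qed.

Definition ncomplete (X Y : {set T}) := [exists x in X, exists y in Y, ~~ e x y].

Lemma ncompletePn X Y : ~~ ncomplete X Y -> complete e X Y.
Proof.
move=> h x y xX yY; apply/negPn/negP => n; case/negP: h.
by apply/exists_inP; exists x => //; apply/exists_inP; exists y.
Qed.

Lemma min_cnbhd a b c d f : hole5 e a b c d f -> ring e a b c d f = R ->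
  exists2 m, m \in rcls e f b c d & forall x, x \in rcls e f b c d ->
    cnbhd e R m \subset cnbhd e R x.
Proof.
move=> Hh Rh; have aX := hole_in_class es Hh.
case: (arg_minnP (fun x => #|cnbhd e R x|) aX) => m mX mn.
exists m => // x xX; case/orP: (ring_nested0 Hh Rh mX xX) => // s.
by rewrite subEproper eq_sym eqEcard s mn.
Qed.

(** The three missing edges are witnessed by unrelated vertices. Since closed neighbourhoods within
    a class are nested, the minimal vertices m1 and m2 of the two middle classes miss everything
    that is missed in their class, so that x0, m1, m2, z3 carry all three nonadjacencies at once. *)
Lemma three_ncomplete a b c d f : hole5 e a b c d f -> ring e a b c d f = R ->
  ncomplete (rcls e f b c d) (rcls e a c d f) ->
  ncomplete (rcls e a c d f) (rcls e b d f a) ->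
  ncomplete (rcls e b d f a) (rcls e c f a b) -> False.
Proof.
move=> Hh Rh /exists_inP[x0 x0X /exists_inP[x1 x1X n01]].
move=> /exists_inP[y1 y1X /exists_inP[y2 y2X n12]].
move=> /exists_inP[z2 z2X /exists_inP[z3 z3X n23]].
have H1 := hole5_rot Hh; have H2 := hole5_rot H1.
have [R1 R2 _ _] := rotations e a b c d f.
have [m1 m1X mn1] := min_cnbhd H1 (etrans R1.1 Rh).
have [m2 m2X mn2] := min_cnbhd H2 (etrans R2.1 Rh).
have sub m x y : cnbhd e R m \subset cnbhd e R x -> y \in R -> ~~ e x y -> y != x -> ~~ e m y.
  move=> s yR nxy yx; apply/negP => my.
  by have := subsetP s y; rewrite !in_cnbhd yR my (negbTE nxy) (negbTE yx) orbT => /(_ isT).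
have inR i x : x \in nth set0 [:: rcls e f b c d; rcls e a c d f; rcls e b d f a;
    rcls e c f a b] i -> i < 4 -> x \in R.
  rewrite -Rh => xX; case: i xX => [|[|[|[|//]]]] /= xX _; apply/ringP;
    [exact: Or41|exact: Or42|exact: Or43|by apply: Or44; left].
have ne x y : x \in rcls e f b c d -> y \in rcls e a c d f -> x != y.
  by case/rclsP=> _ _ xc _ /rclsP[_ yc _ _]; apply: contraNneq xc => ->.
have ne12 x y : x \in rcls e a c d f -> y \in rcls e b d f a -> x != y.
  by case/rclsP=> _ _ xc _ /rclsP[_ yc _ _]; apply: contraNneq xc => ->.
have ne23 x y : x \in rcls e b d f a -> y \in rcls e c f a b -> x != y.
  by case/rclsP=> _ _ xc _ /rclsP[_ yc _ _]; apply: contraNneq xc => ->.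
have nm10 : ~~ e m1 x0.
  by apply: (sub m1 x1) (mn1 _ x1X) (inR 0 _ x0X isT) _ (ne _ _ x0X x1X); rewrite es.
have nm12 : ~~ e m1 m2.
  have h : ~~ e m1 y2.
    by apply: (sub m1 y1) (mn1 _ y1X) (inR 2 _ y2X isT) n12 _; rewrite eq_sym ne12.
  rewrite es; apply: (sub m2 y2) (mn2 _ y2X) (inR 1 _ m1X isT) _ (ne12 _ _ m1X y2X).
  by rewrite es.
have nm23 : ~~ e m2 z3.
  by apply: (sub m2 z2) (mn2 _ z2X) (inR 3 _ z3X isT) n23 _; rewrite eq_sym ne23.
move: (Hh) => /andP[/and5P[? ? ? ? ?] /and5P[? ? ? ? ?]].
case/rclsP: x0X => ? ? ? ?; case/rclsP: m1X => ? ? ? ?.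
case/rclsP: m2X => ? ? ? ?; case/rclsP: z3X => ? ? ? ?.
by ref [:: a; b; c; d; f; x0; m1; m2; z3].
Qed.

Definition rcl i : {set T} := nth set0 [:: rcls e h4 h1 h2 h3; rcls e h0 h2 h3 h4;
  rcls e h1 h3 h4 h0; rcls e h2 h4 h0 h1; rcls e h3 h0 h1 h2] i.

Lemma rcl_partition : is_partition [seq rcl (val i) | i <- enum 'I_5] R.
Proof.
rewrite map_nth_enum //; split; last first.
  by rewrite !big_cons big_nil setU0.
have dis x (i j : nat) : i < 5 -> j < 5 -> x \in rcl i -> x \in rcl j -> i = j.
  rewrite /rcl.
  by case: i => [|[|[|[|[|//]]]]]; case: j => [|[|[|[|[|//]]]]] //= _ _;
    move=> /rclsP[p1 p2 p3 p4] /rclsP[q1 q2 q3 q4];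
    rewrite ?p1 ?p2 in q3 q4; rewrite ?q1 ?q2 in p3 p4.
move=> i j /= i5 j5 ij; apply/pred0P => x /=; apply/negP => /andP[xi xj].
by case/eqP: ij; apply: dis xi xj.
Qed.

(** A crown needs two complete pairs of consecutive classes that are not themselves cyclically
    consecutive. If there were none, at most two of the five pairs would be complete, and these
    would be consecutive; the remaining ones would include three consecutive incomplete pairs,
    contrary to [three_ncomplete]. *)
Lemma rcl_crown : crown5 e R.
Proof.
have [R1 R2 R3 R4] := rotations e h0 h1 h2 h3 h4.
have H1 := hole5_rot H; have H2 := hole5_rot H1.
have H3 := hole5_rot H2; have H4 := hole5_rot H3.
have RP : ring_partition e R (fun i : 'I_5 => rcl (val i)).
  split; first exact: rcl_partition.
  have bigU (F : 'I_5 -> {set T}) P : \bigcup_(j < 5 | P j) F j =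
      \bigcup_(j < 5) (if P j then F j else set0) by rewrite big_mkcond.
  split=> i.
    apply/set0Pn; case: i => -[|[|[|[|[|//]]]]] ?; rewrite /rcl /=;
      [exists h0|exists h1|exists h2|exists h3|exists h4]; exact: (hole_in_class es).
  rewrite bigU !big_ord_recl big_ord0.
  case: i => -[|[|[|[|[|//]]]]] ?; rewrite /rcl /ring_adj /= ?setU0 ?set0U.
  - apply: (ring_chainP H) => //; apply/setP => x; rewrite !in_setU; do ?case: (x \in _) => //.
  - apply: (ring_chainP H1); rewrite ?R1 //; apply/setP => x; rewrite !in_setU; do ?case: (x \in _) => //.
  - apply: (ring_chainP H2); rewrite ?R2 //; apply/setP => x; rewrite !in_setU; do ?case: (x \in _) => //.
  - apply: (ring_chainP H3); rewrite ?R3 //; apply/setP => x; rewrite !in_setU; do ?case: (x \in _) => //.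
  - apply: (ring_chainP H4); rewrite ?R4 //; apply/setP => x; rewrite !in_setU; do ?case: (x \in _) => //.
pose nc i j := ncomplete (rcl i) (rcl j).
have n012 : nc 0 1 -> nc 1 2 -> nc 2 3 -> False by apply: (three_ncomplete H).
have n123 : nc 1 2 -> nc 2 3 -> nc 3 4 -> False.
  by apply: (three_ncomplete H1); rewrite ?R1.
have n234 : nc 2 3 -> nc 3 4 -> nc 4 0 -> False.
  by apply: (three_ncomplete H2); rewrite ?R2.
have n340 : nc 3 4 -> nc 4 0 -> nc 0 1 -> False.
  by apply: (three_ncomplete H3); rewrite ?R3.
have n401 : nc 4 0 -> nc 0 1 -> nc 1 2 -> False.
  by apply: (three_ncomplete H4); rewrite ?R4.
have cC X Y : complete e X Y -> complete e Y X by move=> h x y xX yY; rewrite es; apply: h.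
have cn i j : ~~ nc i j -> complete e (rcl i) (rcl j) by apply: ncompletePn.
have pick (i : 'I_5) : ~~ nc ((val i + 3) %% 5) ((val i + 4) %% 5) ->
    ~~ nc ((val i + 1) %% 5) ((val i + 2) %% 5) -> crown5 e R.
  move=> /cn c1 /cn c2; exists (fun i : 'I_5 => rcl (val i)), i.
  split=> //; split=> j j'.
    move=> /eqP ji /eqP j'i; apply: cC; move: c1; rewrite -{2}ji -{1}j'i.
    by case: j j' {ji j'i} => -[|[|[|[|[|//]]]]] ? [] [|[|[|[|[|//]]]]].
  by move=> /eqP <- /eqP <-.
have p0 := pick (@Ordinal 5 0 isT); have p1 := pick (@Ordinal 5 1 isT).
have p2 := pick (@Ordinal 5 2 isT); have p3 := pick (@Ordinal 5 3 isT).
have p4 := pick (@Ordinal 5 4 isT).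
case: (boolP (nc 0 1)) => a0; case: (boolP (nc 1 2)) => a1;
case: (boolP (nc 2 3)) => a2; case: (boolP (nc 3 4)) => a3;
case: (boolP (nc 4 0)) => a4;
  by first [exact: (p0 a3 a1) | exact: (p1 a4 a2) | exact: (p2 a0 a3)
    | exact: (p3 a1 a4) | exact: (p4 a2 a0) | case: (n012 a0 a1 a2)
    | case: (n123 a1 a2 a3) | case: (n234 a2 a3 a4) | case: (n340 a3 a4 a0)
    | case: (n401 a4 a0 a1)].
Qed.

End Cover.

Lemma pyramid_free_crown (T : finType) (e : rel T) (v0 : T) : symmetric e ->
  irreflexive e -> free_pats e (base_pats ++ pyramid_pats) ->
  (forall v, ~ simplicial e v) ->
  exists Q, crown5 e Q /\ clique e (~: Q) /\ complete e (~: Q) Q.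
Proof.
move=> es ei fr ns.
have [h0 [h1 [h2 [h3 [h4 [H mx]]]]]] := max_hole es ei fr ns v0.
have U x : x \in ~: ring e h0 h1 h2 h3 h4 -> x \in centre e h0 h1 h2 h3 h4.
  by rewrite in_setC => xR; have := ring_cover es ei fr ns H mx x; rewrite (negbTE xR).
exists (ring e h0 h1 h2 h3 h4); split; first exact: rcl_crown.
split=> x y xU yU; first by apply: (centre_clique es ei fr H); apply: U.
exact: (centre_complete es ei fr H (U _ xU) yU).
Qed.

(** * Apexes of pyramids *)

Ltac pyr_facts P :=
  move: (P); case/and5P=> /and3P[? ? ?] /and3P[? ? ?] /and3P[? ? ?] /and3P[? ? ?];
  case/and3P=> /and3P[? ? ?] /and3P[? ? ?] /and3P[? ? ?].

Section Apex.
Variables (T : finType) (e : rel T) (es : symmetric e) (ei : irreflexive e).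
Hypothesis fr : free_pats e base_pats.
Hypothesis nosimp : forall v, ~ simplicial e v.

Definition pyr a b1 b2 b3 c1 c2 c3 :=
  [&& [&& e a b1, e a b2 & e a b3], [&& e b1 c1, e b2 c2 & e b3 c3],
      [&& e c1 c2, e c1 c3 & e c2 c3], [&& ~~ e a c1, ~~ e a c2 & ~~ e a c3] &
   [&& [&& ~~ e b1 b2, ~~ e b1 b3 & ~~ e b2 b3], [&& ~~ e b1 c2, ~~ e b1 c3 & ~~ e b2 c1] &
      [&& ~~ e b2 c3, ~~ e b3 c1 & ~~ e b3 c2]]].

Lemma pyr_swap a b1 b2 b3 c1 c2 c3 :
  pyr a b1 b2 b3 c1 c2 c3 -> pyr a b2 b1 b3 c2 c1 c3.
Proof.
case/and5P=> /and3P[? ? ?] /and3P[? ? ?] /and3P[? ? ?] /and3P[? ? ?].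
case/and3P=> /and3P[? ? ?] /and3P[? ? ?] /and3P[? ? ?].
by rewrite /pyr [e c2 c1]es [e b2 b1]es; do !(apply/andP; split).
Qed.

Lemma pyr_rot a b1 b2 b3 c1 c2 c3 :
  pyr a b1 b2 b3 c1 c2 c3 -> pyr a b2 b3 b1 c2 c3 c1.
Proof.
case/and5P=> /and3P[? ? ?] /and3P[? ? ?] /and3P[? ? ?] /and3P[? ? ?].
case/and3P=> /and3P[? ? ?] /and3P[? ? ?] /and3P[? ? ?].
by rewrite /pyr [e c2 c1]es [e c3 c1]es [e b2 b1]es [e b3 b1]es; do !(apply/andP; split).
Qed.

Lemma nnP a v : reflect (v != a /\ ~~ e a v) (v \in nn e a).
Proof. by rewrite inE; apply: andP. Qed.

(** The nonneighbours of [a] are connected and include c2. Those without a neighbour in the triangle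
    have no edge to the others, by the forbidden subgraphs, so there are none. *)
Lemma nn_meets_base a b1 b2 b3 c1 c2 c3 v : pyr a b1 b2 b3 c1 c2 c3 ->
  v \in nn e a -> [|| e v c1, e v c2 | e v c3].
Proof.
move=> P va; apply/negPn/negP => vn; pyr_facts P.
pose W := [set v | [&& ~~ e v c1, ~~ e v c2 & ~~ e v c3]].
have vW : v \in W by move: vn; rewrite !negb_or inE.
apply: (nn_connected es ei fr nosimp vW va (u0 := c2)).
- by rewrite inE [e c2 c1]es negb_and negbK; apply/orP; left.
- by apply/nnP; split=> //; apply: contraNneq (_ : ~~ e b1 c2) => // ->; rewrite es.
move=> w u; rewrite inE => /and3P[? ? ?] /nnP[? ?].
by rewrite inE !negb_and !negbK => /or3P[] ? /nnP[? ?];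
  ref [:: a; b1; b2; b3; c1; c2; c3; w; u].
Qed.

(** Here connectivity is applied to the nonneighbours of b1, among which b2 lies on the other side
    of the cut. *)
Lemma nn_one_base a b1 b2 b3 c1 c2 c3 v : pyr a b1 b2 b3 c1 c2 c3 ->
  ~~ e a v -> e v c1 -> ~~ e v c2 -> ~~ e v c3 -> e v b1.
Proof.
move=> P ? ? ? ?; apply/negPn/negP => ?; pyr_facts P.
pose W := [set v | [&& ~~ e a v, e v c1, ~~ e v c2 & ~~ e v c3]].
have vW : v \in W by rewrite inE; apply/and4P.
have vb1 : v \in nn e b1.
  apply/nnP; split; last by rewrite es.
  by apply: contraNneq (_ : ~~ e a v) => // ->.
have b2b1 : b2 \in nn e b1.
  by apply/nnP; split=> //; apply: contraNneq (_ : ~~ e b1 c2) => // <-.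
apply: (nn_connected es ei fr nosimp vW vb1 (u0 := b2)) => //.
  by rewrite inE !negb_and negbK; apply/orP; left.
move=> w u; rewrite inE => /and4P[? ? ? ?] /nnP[? ?].
by rewrite inE !negb_and !negbK => /or4P[] ? /nnP[? ?];
  ref [:: a; b1; b2; b3; c1; c2; c3; w; u].
Qed.

(** The exceptional vertices form a clique [W]. Its outside neighbours are c1, c2, and vertices
    complete to both that see b1 or b2; these are pairwise adjacent, so [W] would contain a
    simplicial vertex. *)
Lemma nn_two_base a b1 b2 b3 c1 c2 c3 v : pyr a b1 b2 b3 c1 c2 c3 ->
  ~~ e a v -> e v c1 -> e v c2 -> v != c3 -> e v c3.
Proof.
move=> P ? ? ? ?; apply/negPn/negP => ?; pyr_facts P.
pose W := [set v | [&& [&& ~~ e a v, e v c1 & e v c2], ~~ e v c3 & v != c3]].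
have WP w : w \in W -> [/\ ~~ e a w, e w c1, e w c2, ~~ e w c3 & w != c3].
  by rewrite inE => /and3P[/and3P[? ? ?] ? ?].
have vW : v \in W by rewrite inE; apply/and3P; split=> //; apply/and3P.
have nW x : x \notin W -> [\/ e a x, ~~ e x c1, ~~ e x c2 | e x c3 \/ x = c3].
  rewrite inE !negb_and !negbK => /or3P[/or3P[]|?|/eqP ?] *;
   [exact: Or41|exact: Or42|exact: Or43|by apply: Or44; left|by apply: Or44; right].
apply: (clique_with_clique_nbhd es ei fr nosimp vW).
  move=> x y /WP[? ? ? ? ?] /WP[? ? ? ? ?] ?.
  by ref [:: a; b1; b2; b3; c1; c2; c3; x; y].
move=> w w' x y /WP[? ? ? w3 ?] /WP[? ? ? w'3 ?] /nW xW /nW yW wx w'y xy.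
have Wnb u z : e u z -> ~~ e a u -> e u c1 -> e u c2 -> ~~ e u c3 -> u != c3 ->
    [\/ e a z, ~~ e z c1, ~~ e z c2 | e z c3 \/ z = c3] ->
    [\/ z = c1, z = c2 | [/\ e z c1, e z c2 & e z b1 || e z b2]].
  move=> uz ? ? ? u3 ? zW.
  case: (eqVneq z c1) => [|?]; first by constructor 1.
  case: (eqVneq z c2) => [|?]; first by constructor 2.
  constructor 3; case: zW => [?|?|?|[?|E]]; last by rewrite -E uz in u3.
  - by split; [| |apply/negPn; rewrite negb_or; apply/andP => -[? ?]];
      ref [:: a; b1; b2; b3; c1; c2; c3; u; z].
  - by exfalso; ref [:: a; b1; b2; b3; c1; c2; c3; u; z].
  - by exfalso; ref [:: a; b1; b2; b3; c1; c2; c3; u; z].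
  - by split; [| |apply/negPn; rewrite negb_or; apply/andP => -[? ?]];
      ref [:: a; b1; b2; b3; c1; c2; c3; u; z].
have [?|?|[? ? /orP xb]] : [\/ x = c1, x = c2 | [/\ e x c1, e x c2 & e x b1 || e x b2]].
  by apply: (Wnb w).
all: have [?|?|[? ? /orP yb]] : [\/ y = c1, y = c2 | [/\ e y c1, e y c2 & e y b1 || e y b2]]
  by apply: (Wnb w').
all: subst; try by [rewrite eqxx in xy | rewrite // es].
by case: xb => ?; case: yb => ?; ref [:: a; b1; b2; b3; c1; c2; c3; w; w'; x; y].
Qed.

Definition apex_minimal a := forall a' b1 b2 b3 c1 c2 c3,
  pyr a' b1 b2 b3 c1 c2 c3 -> #|nn e a| <= #|nn e a'|.

(** This is where minimality of the apex is used. If x missed c1, it would see b1, b2, b3 and miss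
    the triangle, hence be an apex of the same pyramid. Its nonneighbours would all be nonneighbours
    of [a], and v would be lost. *)
Lemma nn_leg_noadj a b1 b2 b3 c1 c2 c3 v x : pyr a b1 b2 b3 c1 c2 c3 ->
  apex_minimal a -> ~~ e a v -> e v b1 -> e v c1 -> ~~ e v c2 -> ~~ e v c3 ->
  e a x -> e v x -> e x c1.
Proof.
move=> P mn ? ? ? ? ? ? ?; apply/negPn/negP => ?; pyr_facts P.
have [? ? ?] : [/\ e x b1, e x b2 & e x b3].
  by split; ref [:: a; b1; b2; b3; c1; c2; c3; v; x].
have [? ?] : ~~ e x c2 /\ ~~ e x c3.
  by split; ref [:: a; b1; b2; b3; c1; c2; c3; v; x].
have /mn : pyr x b1 b2 b3 c1 c2 c3 by do !(apply/andP; split).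
rewrite leqNgt => /negP; apply; apply: proper_card; apply/properP; split.
  apply/subsetP => u /nnP[ux xu]; apply/nnP; split.
    by apply: contraNneq xu => ->; rewrite es.
  by apply/negP => ?; ref [:: a; b1; b2; b3; c1; c2; c3; v; x; u].
exists v; last by apply/nnP => -[_]; rewrite es => /negP; apply.
apply/nnP; split=> //; apply: contraTneq (_ : e v c1) => // -> //.
Qed.

(** Such vertices form a clique whose outside neighbours are b1, c1, and vertices adjacent to both;
    [nn_leg_noadj] provides the adjacency to c1 for those that see [a]. The outside neighbours turn
    out to be a clique. *)
Lemma nn_no_leg a b1 b2 b3 c1 c2 c3 v : pyr a b1 b2 b3 c1 c2 c3 ->
  apex_minimal a -> ~~ e a v -> e v b1 -> e v c1 -> ~~ e v c2 -> ~~ e v c3 -> False.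
Proof.
move=> P mn ? ? ? ? ?; have noadj := nn_leg_noadj P mn; pyr_facts P.
pose W := [set v | [&& [&& ~~ e a v, e v b1 & e v c1], ~~ e v c2 & ~~ e v c3]].
have WP w : w \in W -> [/\ ~~ e a w, e w b1, e w c1, ~~ e w c2 & ~~ e w c3].
  by rewrite inE => /and3P[/and3P[? ? ?] ? ?].
have vW : v \in W by rewrite inE; apply/and3P; split=> //; apply/and3P.
apply: (clique_with_clique_nbhd es ei fr nosimp vW).
  move=> x y /WP[? ? ? ? ?] /WP[? ? ? ? ?] ?.
  by ref [:: a; b1; b2; b3; c1; c2; c3; x; y].
have Wnb u z : u \in W -> z \notin W -> e u z ->
    [\/ z = c1, z = b1, [/\ ~~ e a z, e z b1, e z c1, e z c2 & e z c3] |
        [/\ e a z, e z b1 & e z c1]].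
  move=> /WP[? ? ? ? ?] zW uz.
  case: (eqVneq z c1) => [|?]; first by constructor 1.
  case: (eqVneq z b1) => [|?]; first by constructor 2.
  case: (boolP (e a z)) => az.
    have ? : e z c1 by apply: (noadj u).
    by constructor 4; split=> //; ref [:: a; b1; b2; b3; c1; c2; c3; u; z].
  have ? : e z c1 by ref [:: a; b1; b2; b3; c1; c2; c3; u; z].
  have ? : e z b1 by ref [:: a; b1; b2; b3; c1; c2; c3; u; z].
  constructor 3; move: zW; rewrite inE !negb_and !negbK (negbTE az).
  case/or3P=> [/or3P[//|/negP|/negP]|?|?] //.
    by split=> //; ref [:: a; b1; b2; b3; c1; c2; c3; u; z].
  by split=> //; ref [:: a; b1; b2; b3; c1; c2; c3; u; z].
move=> w w' x y wW w'W xW yW wx w'y xy.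
have [? ? ? ? ?] := WP _ wW; have [? ? ? ? ?] := WP _ w'W.
have [?|?|[? ? ? ? ?]|[? ? ?]] := Wnb w x wW xW wx;
  have [?|?|[? ? ? ? ?]|[? ? ?]] := Wnb w' y w'W yW w'y; subst;
  try by [rewrite eqxx in xy | rewrite // es].
all: by ref [:: a; b1; b2; b3; c1; c2; c3; w; w'; x; y].
Qed.

(** The preceding lemmas, applied to the three rotations of the pyramid, exclude nonneighbours with
    exactly none, one or two neighbours in the triangle, apart from the triangle itself. Two
    nonneighbours complete to the triangle are adjacent by the forbidden subgraphs. *)
Lemma nn_apex_clique a b1 b2 b3 c1 c2 c3 : pyr a b1 b2 b3 c1 c2 c3 ->
  apex_minimal a -> clique e (nn e a).
Proof.
move=> P mn.
have P2 := pyr_swap P; have P3 := pyr_rot P.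
have full v : v \in nn e a -> [\/ v = c1, v = c2, v = c3 | [/\ e v c1, e v c2 & e v c3]].
  move=> vn; have [va nav] := nnP _ _ vn.
  case: (eqVneq v c1) => [|?]; first by constructor 1.
  case: (eqVneq v c2) => [|?]; first by constructor 2.
  case: (eqVneq v c3) => [|?]; first by constructor 3.
  constructor 4; have := nn_meets_base P vn.
  case: (boolP (e v c1)) => v1; case: (boolP (e v c2)) => v2;
    case: (boolP (e v c3)) => v3 //= _; exfalso.
  - by case/negP: v3; apply: (nn_two_base P).
  - by case/negP: v2; apply: (nn_two_base (pyr_rot P3)).
  - by apply: (nn_no_leg P mn nav (nn_one_base P nav v1 v2 v3) v1).
  - by case/negP: v1; apply: (nn_two_base P3).
  - by apply: (nn_no_leg P3 mn nav (nn_one_base P3 nav v2 v3 v1) v2).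
  - by apply: (nn_no_leg (pyr_rot P3) mn nav (nn_one_base (pyr_rot P3) nav v3 v1 v2) v3).
move=> x y xn yn xy.
have [xa nax] := nnP _ _ xn; have [ya nay] := nnP _ _ yn; pyr_facts P.
case: (full x xn) => [?|?|?|[? ? ?]]; case: (full y yn) => [?|?|?|[? ? ?]]; subst;
  try by [rewrite eqxx in xy | rewrite // es].
by ref [:: a; b1; b2; b3; c1; c2; c3; x; y].
Qed.

End Apex.

Lemma partition_of_pairwise (T : finType) (l : seq {set T}) (Q : {set T}) :
  pairwise (fun X Y : {set T} => [disjoint X & Y]) l ->
  (forall x, (x \in Q) = has (fun X : {set T} => x \in X) l) -> is_partition l Q.
Proof.
move=> /(pairwiseP set0) pw cov; split.
  move=> i j il jl; case: (ltngtP i j) => // ij _; first exact: pw.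
  by rewrite disjoint_sym; apply: pw.
apply/setP => x; rewrite cov; elim: l {pw cov} => [|X l IH]; first by rewrite big_nil inE.
by rewrite big_cons in_setU IH.
Qed.

Lemma pairwise_enum (T : finType) n (F : 'I_n -> {set T}) :
  (forall i j, i != j -> [disjoint F i & F j]) ->
  pairwise (fun X Y : {set T} => [disjoint X & Y]) [seq F i | i <- enum 'I_n].
Proof.
move=> dis; rewrite pairwise_map; have := enum_uniq 'I_n; rewrite uniq_pairwise.
by apply: sub_pairwise => i j; apply: dis.
Qed.

(** * The structure around an apex whose nonneighbours form a clique *)

Section Structure.
Variables (T : finType) (e : rel T) (es : symmetric e) (ei : irreflexive e).
Hypothesis fr : free_pats e base_pats.
Hypothesis nosimp : forall v, ~ simplicial e v.
Variable a : T.
Local Notation K := (nn e a).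
Hypothesis Kcl : clique e K.

Definition mid : {set T} := [set m | e a m && [exists k in K, e m k]].
(** The sets [K], [mid] and [core] partition the vertices, and [a] itself belongs to [core]. In the
    end [core] is A for a basket, and A together with X for a mansion. *)
Definition core : {set T} := [set x | (x \notin K) && (x \notin mid)].

Lemma midP m : reflect (e a m /\ exists2 k, k \in K & e m k) (m \in mid).
Proof.
rewrite inE; apply: (iffP andP) => -[am].
  by case/exists_inP=> k; split=> //; exists k.
by case=> k kK mk; split=> //; apply/exists_inP; exists k.
Qed.

Lemma notK k : k \in K -> ~~ e a k.
Proof. by rewrite inE => /andP[]. Qed.

Lemma neqK k : k \in K -> a != k.
Proof. by rewrite inE eq_sym => /andP[]. Qed.

Lemma core_adj x : x \in core -> x != a -> e a x.
Proof. by rewrite [x \in core]inE => /andP[]; rewrite inE negb_and !negbK => /orP[/eqP->|//]; rewrite eqxx. Qed.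

Lemma core_K x k : x \in core -> k \in K -> ~~ e x k.
Proof.
move=> xc kK; case: (eqVneq x a) => [->|xa]; first exact: notK.
have ax := core_adj xc xa; move: xc; rewrite [x \in core]inE => /andP[_]; apply: contra => xk.
by apply/midP; split=> //; exists k.
Qed.

Variable S : {set T}.
Hypothesis Smid : S \subset mid.
Hypothesis Sstable : forall s t, s \in S -> t \in S -> ~~ e s t.
Hypothesis Smax : forall m, m \in mid -> m \notin S -> exists2 s, s \in S & e m s.
Hypothesis S3 : 2 < #|S|.

(** With s ranging over [S], the sets [leg s] and [foot s] become the B_i and C_i, while [branch]
    supplies F and the universal vertices. *)
Definition leg s : {set T} := [set b in mid | ((b == s) || e b s) &&
  [forall t in S, (t != s) ==> ~~ e b t]].
Definition branch : {set T} := [set f in mid |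
  [exists s in S, exists t in S, [&& s != t, e f s & e f t]]].
Definition foot s : {set T} := [set k in K | [exists b in leg s, e b k]].

Lemma legP s b : reflect [/\ b \in mid, b = s \/ e b s &
  forall t, t \in S -> t != s -> ~~ e b t] (b \in leg s).
Proof.
rewrite [b \in leg s]inE; apply: (iffP and3P) => -[bm bs bt]; split=> //.
- by case/orP: bs => [/eqP|]; [left|right].
- by move=> t tS ts; move/forall_inP/(_ t tS)/implyP: bt; apply.
- by case: bs => [->|->]; rewrite ?eqxx ?orbT.
- by apply/forall_inP => t tS; apply/implyP; apply: bt.
Qed.

Lemma branchP f : reflect (f \in mid /\ exists s t, [/\ s \in S, t \in S, s != t,
  e f s & e f t]) (f \in branch).
Proof.
rewrite [f \in branch]inE; apply: (iffP andP) => -[fm].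
  case/exists_inP=> s sS /exists_inP[t tS /and3P[st fs ft]].
  by split=> //; exists s, t.
case=> s [t [sS tS st fs ft]]; split=> //; apply/exists_inP; exists s => //.
by apply/exists_inP; exists t; rewrite ?st ?fs.
Qed.

Lemma footP s k : reflect (k \in K /\ exists2 b, b \in leg s & e b k) (k \in foot s).
Proof.
rewrite [k \in foot s]inE; apply: (iffP andP) => -[kK].
  by case/exists_inP=> b; split=> //; exists b.
by case=> b bs bk; split=> //; apply/exists_inP; exists b.
Qed.

Lemma S_mid s : s \in S -> s \in mid. Proof. exact: (subsetP Smid). Qed.

Lemma leg_self s : s \in S -> s \in leg s.
Proof.
move=> sS; apply/legP; split; [exact: S_mid|by left|].
by move=> t tS _; apply: Sstable.
Qed.

Lemma mid_leg_branch m : m \in mid -> (exists2 s, s \in S & m \in leg s) \/ m \in branch.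
Proof.
move=> mm; case: (boolP (m \in S)) => mS.
  by left; exists m => //; apply: leg_self.
have [s sS ms] := Smax mm mS.
case: (boolP [exists t in S, (t != s) && e m t]) => [/exists_inP[t tS /andP[ts mt]]|no].
  by right; apply/branchP; split=> //; exists s, t; rewrite eq_sym.
left; exists s => //; apply/legP; split=> //; first by right.
move=> t tS ts; apply: contra no => mt.
by apply/exists_inP; exists t => //; rewrite ts.
Qed.

Lemma third s t : exists2 u, u \in S & (u != s) && (u != t).
Proof.
have : 0 < #|S :\ s :\ t|.
  move: S3; rewrite (cardsD1 s) (cardsD1 t (S :\ s)).
  by case: (s \in S); case: (t \in _) => //=; case: #|_|.
by case/card_gt0P=> u; rewrite !inE => /and3P[ut us uS]; exists u => //; rewrite us.
Qed.

Lemma leg_neq s t b b' : s \in S -> t \in S -> s != t -> b \in leg s -> b' \in leg t ->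
  b != b'.
Proof.
move=> sS tS st /legP[_ bs bt] /legP[_ b't b's]; apply/eqP => E; subst b'.
have ts : t != s by rewrite eq_sym.
case: b't => [E|]; last by apply/negP; apply: bt.
case: bs => [E'|]; last by apply/negP; apply: b's.
by case/eqP: st; rewrite -E -E'.
Qed.

Lemma common_foot m m' : m \in mid -> m' \in mid -> e m m' ->
  exists k, [/\ k \in K, e m k & e m' k].
Proof.
move=> /midP[? [k kK mk]] /midP[? [k' k'K m'k']] mm'.
case: (boolP (e m' k)) => m'k; first by exists k.
exists k'; split=> //.
have kk' : e k k' by apply: Kcl => //; apply: contraNneq m'k => ->.
by have [? ?] := (notK kK, notK k'K); ref [:: a; m; m'; k; k'].
Qed.

(** Adjacent vertices are covered by [common_foot]. For nonadjacent ones, b s b' and t k k', with t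
    another element of [S] and k, k' neighbours in K of t and of a third one, would form a 2P3;
    4-holes through [a] rule out all edges between the two paths. *)
Lemma leg_common s b b' : b \in leg s -> b' \in leg s -> s \in S ->
  exists k, [/\ k \in K, e b k & e b' k].
Proof.
move=> bl b'l sS; case: (eqVneq b b') => [<-|bb'].
  by case/legP: bl => /midP[_ [k kK bk]]; exists k.
case/legP: (bl) => bm [E|bs] _.
  subst b; case/legP: b'l => b'm [E|b's] _; first by rewrite E eqxx in bb'.
  by apply: common_foot => //; rewrite es.
case/legP: (b'l) => b'm [E|b's] _; first by subst b'; apply: common_foot.
apply: common_foot => //; apply/negPn/negP => nbb'.
have [t tS /andP[ts _]] := third s s; have [u uS /andP[us ut]] := third s t.
have [/midP[? _] /midP[? [k kK ?]] /midP[? [k' k'K ?]]] :=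
  And3 (S_mid sS) (S_mid tS) (S_mid uS).
have [? [? ?]] := (Sstable tS uS, (Sstable sS tS, Sstable sS uS)).
case/legP: bl => /midP[? _] _ bt; case/legP: b'l => /midP[? _] _ b't.
have [[? ?] [? ?]] := ((bt _ tS ts, bt _ uS us), (b't _ tS ts, b't _ uS us)).
have [? ?] := (notK kK, notK k'K).
have kk' : e k k' by apply: Kcl => //; apply/eqP => E; subst; have ? := neqK k'K; ref [:: a; t; u; k'].
by ref [:: a; s; b; b'; t; k; k'; u].
Qed.

Lemma leg_clique s : s \in S -> clique e (leg s).
Proof.
move=> sS b b' bl b'l bb'; have [k [kK ? ?]] := leg_common bl b'l sS.
case/legP: bl => /midP[? _] _ _; case/legP: b'l => /midP[? _] _ _.
by have [? ?] := (notK kK, neqK kK); ref [:: a; b; b'; k].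
Qed.

(** If b and b' were adjacent, a common neighbour k in K of b and s and a common neighbour k' in K
    of b' and t would give the 4-hole b k k' b'. *)
Lemma leg_anti s t b b' : s \in S -> t \in S -> s != t -> b \in leg s -> b' \in leg t ->
  ~~ e b b'.
Proof.
move=> sS tS st bl b'l; apply/negP => bb'.
have ts : t != s by rewrite eq_sym.
case/legP: (bl) => bm bs bn; case/legP: (b'l) => b'm b't b'n.
have b'ns := b'n _ sS st; have bnt := bn _ tS ts.
case: bs => [E|bs]; first by subst b; rewrite es bb' in b'ns.
case: b't => [E|b't]; first by subst b'; rewrite bb' in bnt.
have [k [kK ? ?]] := common_foot bm (S_mid sS) bs.
have [k' [k'K ? ?]] := common_foot b'm (S_mid tS) b't.
have [/midP[? _] /midP[? _]] := (S_mid sS, S_mid tS).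
case/midP: bm => ? _; case/midP: b'm => ? _.
have [? [? ?]] := (Sstable sS tS, (notK kK, notK k'K)).
have kk' : e k k' by apply: Kcl => //; apply/eqP => E; subst; have ? := neqK k'K; ref [:: a; s; t; k'].
by ref [:: a; s; t; b; b'; k; k'].
Qed.

Lemma legs_pyr s1 s2 s3 b1 b2 b3 c1 c2 c3 :
  s1 \in S -> s2 \in S -> s3 \in S -> s1 != s2 -> s1 != s3 -> s2 != s3 ->
  b1 \in leg s1 -> b2 \in leg s2 -> b3 \in leg s3 ->
  c1 \in K -> c2 \in K -> c3 \in K -> e b1 c1 -> e b2 c2 -> e b3 c3 ->
  pyr e a b1 b2 b3 c1 c2 c3.
Proof.
move=> S1 S2 S'3 s12 s13 s23 l1 l2 l3 K1 K2 K3 bc1 bc2 bc3.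
have n12 := leg_anti S1 S2 s12 l1 l2; have n13 := leg_anti S1 S'3 s13 l1 l3.
have n23 := leg_anti S2 S'3 s23 l2 l3.
have d12 := leg_neq S1 S2 s12 l1 l2; have d13 := leg_neq S1 S'3 s13 l1 l3.
have d23 := leg_neq S2 S'3 s23 l2 l3.
case/legP: l1 => /midP[? _] _ _; case/legP: l2 => /midP[? _] _ _.
case/legP: l3 => /midP[? _] _ _.
have [? [? ?]] := (notK K1, (notK K2, notK K3)).
have [? [? ?]] := (neqK K1, (neqK K2, neqK K3)).
have m12 : ~~ e b1 c2 by ref [:: a; b1; b2; c2].
have m13 : ~~ e b1 c3 by ref [:: a; b1; b3; c3].
have m21 : ~~ e b2 c1 by ref [:: a; b1; b2; c1].
have m23 : ~~ e b2 c3 by ref [:: a; b2; b3; c3].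
have m31 : ~~ e b3 c1 by ref [:: a; b1; b3; c1].
have m32 : ~~ e b3 c2 by ref [:: a; b2; b3; c2].
have k12 : e c1 c2 by apply: Kcl => //; apply: contraNneq m12 => <-.
have k13 : e c1 c3 by apply: Kcl => //; apply: contraNneq m13 => <-.
have k23 : e c2 c3 by apply: Kcl => //; apply: contraNneq m23 => <-.
by do !(apply/andP; split).
Qed.

Lemma leg_foot s b : b \in leg s -> exists2 k, k \in K & e b k.
Proof. by case/legP=> /midP[_]. Qed.

(* Every configuration argument below starts from a pyramid with apex [a]
   whose three legs are chosen in prescribed classes. *)
Lemma legs_pyr_ex s1 s2 s3 b1 b2 b3 :
  s1 \in S -> s2 \in S -> s3 \in S -> s1 != s2 -> s1 != s3 -> s2 != s3 ->
  b1 \in leg s1 -> b2 \in leg s2 -> b3 \in leg s3 ->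
  exists c1 c2 c3, [/\ c1 \in K, c2 \in K, c3 \in K & pyr e a b1 b2 b3 c1 c2 c3].
Proof.
move=> S1 S2 S'3 s12 s13 s23 l1 l2 l3.
have [[c1 K1 ?] [c2 K2 ?] [c3 K3 ?]] := And3 (leg_foot l1) (leg_foot l2) (leg_foot l3).
by exists c1, c2, c3; split=> //; apply: (legs_pyr S1 S2 S'3).
Qed.

(** ** Vertices attached to several legs *)

(** Let f see p and q, and let k, k' in K be neighbours of s and t. 4-holes through [a] keep p, q, f
    away from k and k', so p f q and s k k' would form a 2P3. *)
Lemma branch_misses_one f s t : f \in branch -> s \in S -> t \in S -> s != t ->
  ~~ e f s -> ~~ e f t -> False.
Proof.
move=> /branchP[/midP[af _] [p [q [pS qS pq fp fq]]]] sS tS st fs ft.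
have [/midP[? _] /midP[? _]] := (S_mid pS, S_mid qS).
have [/midP[? [k kK ?]] /midP[? [k' k'K ?]]] := (S_mid sS, S_mid tS).
have [? [? ?]] := (Sstable sS tS, (Sstable sS pS, Sstable sS qS)).
have [? [? ?]] := (Sstable pS qS, (Sstable tS pS, Sstable tS qS)).
have [? ?] := (notK kK, notK k'K).
have kk' : e k k' by apply: Kcl => //; apply/eqP => E; subst; have ? := neqK k'K; ref [:: a; s; t; k'].
by ref [:: a; p; q; s; t; k; k'; f].
Qed.

(** Together with [branch_foot], this makes the adjacency of f to a leg and its foot depend on s
    alone, as required of F and of universal vertices. *)
Lemma branch_leg f s b : f \in branch -> s \in S -> b \in leg s -> e f b = e f s.
Proof.
move=> fB sS bl.
have [fm [p [q [pS qS pq fp fq]]]] := branchP _ fB.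
case/legP: (bl) => bm [->//|bs] _; case/midP: (fm) => af _.
have sl := leg_self sS.
have [c [cK sc bc]] := leg_common sl bl sS.
have [/midP[? _] /midP[? _]] := (S_mid sS, bm).
case: (boolP (e f s)) => fs.
  have [t [tS ts ft]] : exists t, [/\ t \in S, t != s & e f t].
    by case: (eqVneq p s) => [E|ps]; [exists q|exists p]; split=> //; rewrite -E eq_sym.
  have [u uS /andP[us ut]] := third s t.
  rewrite eq_sym in ts; rewrite eq_sym in us; rewrite eq_sym in ut.
  have [c1 [c2 [c3 [_ K2 K3 P']]]] :=
    legs_pyr_ex sS tS uS ts us ut bl (leg_self tS) (leg_self uS).
  (* The vertex c, a common neighbour in K of b and s, replaces the arbitrary c1, so that the
     pyramid can be compared with the one whose leg is s. *)
  have P : pyr e a b t u c c2 c3.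
    pyr_facts P'; exact: (legs_pyr sS tS uS ts us ut bl (leg_self tS) (leg_self uS)).
  have [? ?] := (Sstable sS tS, Sstable sS uS).
  have [k [kK fk sk]] := common_foot fm (S_mid sS) fs; have [? ?] := (notK kK, neqK kK).
  pyr_facts P; apply/negPn/negP => ?; case: (boolP (e f c)) => fc.
    by ref [:: a; b; t; u; c; c2; c3; f; s].
  have ? : e k c by apply: Kcl => //; apply: contraNneq fc => <-.
  by ref [:: a; b; t; u; c; c2; c3; f; s; k].
have ps : p != s by apply: contraNneq fs => <-.
have qs : q != s by apply: contraNneq fs => <-.
rewrite eq_sym in ps; rewrite eq_sym in qs.
have [c1 [c2 [c3 [_ K2 K3 P']]]] :=
  legs_pyr_ex sS pS qS ps qs pq bl (leg_self pS) (leg_self qS).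
have P : pyr e a b p q c c2 c3.
  pyr_facts P'; exact: (legs_pyr sS pS qS ps qs pq bl (leg_self pS) (leg_self qS)).
have [? ?] := (Sstable sS pS, Sstable sS qS).
case/midP: fm => _ [k kK ?]; have [? ?] := (notK kK, neqK kK).
by pyr_facts P; ref [:: a; b; p; q; c; c2; c3; f; s; k].
Qed.

Lemma branch_foot f s k : f \in branch -> s \in S -> k \in foot s -> e f k = e f s.
Proof.
move=> fB sS /footP[kK [b bl bk]]; rewrite -(branch_leg fB sS bl).
have [fm [p [q [pS qS pq fp fq]]]] := branchP _ fB; case/midP: (fm) => af _.
have [t [tS ts ft]] : exists t, [/\ t \in S, t != s & e f t].
  by case: (eqVneq p s) => [E|ps]; [exists q|exists p]; split=> //; rewrite -E eq_sym.
have [u uS /andP[us ut]] := third s t.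
rewrite eq_sym in ts; rewrite eq_sym in us; rewrite eq_sym in ut.
have [c1 [c2 [c3 [_ K2 K3 P']]]] :=
  legs_pyr_ex sS tS uS ts us ut bl (leg_self tS) (leg_self uS).
have P : pyr e a b t u k c2 c3.
  pyr_facts P'; exact: (legs_pyr sS tS uS ts us ut bl (leg_self tS) (leg_self uS)).
pyr_facts P.
case: (boolP (e f b)) => fb; last by ref [:: a; b; t; u; k; c2; c3; f].
have bm : b \in mid by case/legP: bl.
have [k' [k'K fk' bk']] := common_foot fm bm fb; have [? ?] := (notK k'K, neqK k'K).
apply/negPn/negP => fk.
have ? : e k' k by apply: Kcl => //; apply: contraNneq fk => <-.
have ? : e k' c2 by apply: Kcl => //; apply: contraTneq bk' => ->.
have ? : e k' c3 by apply: Kcl => //; apply: contraTneq bk' => ->.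
by ref [:: a; b; t; u; k; c2; c3; f; k'].
Qed.

Lemma S_nonempty : exists s, s \in S.
Proof. by apply/card_gt0P; apply: leq_trans S3. Qed.

(** Suppose f misses l and f' misses another s. Both see a third leg and its foot c3, so they are
    adjacent, as otherwise a f c3 f' is a 4-hole; but then f c1 c2 f' is one, where c1 and c2 are
    the feet of s and l. The element [l] will provide [jstar]. *)
Lemma branch_missed_leg : exists2 l, l \in S &
  forall f s, f \in branch -> s \in S -> s != l -> e f s.
Proof.
case: (boolP [exists f in branch, exists l in S, ~~ e f l]); last first.
  move=> no; have [l lS] := S_nonempty; exists l => // f s fB sS _.
  apply: contraR no => nfs; apply/exists_inP; exists f => //.
  by apply/exists_inP; exists s.
case/exists_inP=> f fB /exists_inP[l lS fl]; exists l => // f' s f'B sS sl.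
apply/negPn/negP => f's; have [u uS /andP[us ul]] := third s l.
rewrite eq_sym in us; rewrite eq_sym in ul.
have fs : e f s by apply/negPn/negP => n; apply: (branch_misses_one fB sS lS sl n fl).
have fu : e f u by apply/negPn/negP => n; apply: (branch_misses_one fB lS uS ul fl n).
have ls : l != s by rewrite eq_sym.
have f'l : e f' l by apply/negPn/negP => n; apply: (branch_misses_one f'B lS sS ls n f's).
have f'u : e f' u by apply/negPn/negP => n; apply: (branch_misses_one f'B sS uS us f's n).
have [c1 [c2 [c3 [K1 K2 K3 P]]]] :=
  legs_pyr_ex sS lS uS sl us ul (leg_self sS) (leg_self lS) (leg_self uS).
pyr_facts P.
have ft g t k : g \in branch -> t \in S -> k \in K -> e t k -> e g k = e g t.
  move=> gB tS kK tk; apply: branch_foot => //; apply/footP; split=> //.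
  by exists t => //; apply: leg_self.
have [? [? ?]] : e f c1 /\ ~~ e f c2 /\ e f c3 by rewrite (ft f s c1) ?(ft f l c2) ?(ft f u c3).
have [? [? ?]] : ~~ e f' c1 /\ e f' c2 /\ e f' c3 by rewrite (ft f' s c1) ?(ft f' l c2) ?(ft f' u c3).
case/branchP: fB => /midP[? _] _; case/branchP: f'B => /midP[? _] _.
by ref [:: a; s; l; u; c1; c2; c3; f; f'].
Qed.

Lemma two_legs l : exists s t, [/\ s \in S, t \in S, s != t, s != l & t != l].
Proof.
have [s sS /andP[sl _]] := third l l; have [t tS /andP[tl ts]] := third l s.
by exists s, t; split=> //; rewrite eq_sym.
Qed.

Lemma branch_clique : clique e branch.
Proof.
have [l lS fl] := branch_missed_leg; have [s [t [sS tS st sl tl]]] := two_legs l.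
move=> f g fB gB fg.
have [? ?] := (fl f s fB sS sl, fl f t fB tS tl).
have [? ?] := (fl g s gB sS sl, fl g t gB tS tl).
by have ? := Sstable sS tS; ref [:: f; g; s; t].
Qed.

Lemma adj_of_two_legs x y s t b b' : x != y -> s \in S -> t \in S -> s != t ->
  b \in leg s -> b' \in leg t -> e x b -> e x b' -> e y b -> e y b' -> e x y.
Proof.
move=> xy sS tS st bl b'l ? ? ? ?.
have ? := leg_anti sS tS st bl b'l; have ? := leg_neq sS tS st bl b'l.
by ref [:: x; y; b; b'].
Qed.

Lemma core_not_mid x m : x \in core -> m \in mid -> x != m.
Proof. by move=> xc mm; apply: contraTneq xc => ->; rewrite [m \in core]inE mm andbF. Qed.

Lemma leg_mid s b : b \in leg s -> b \in mid.
Proof. by case/legP. Qed.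

Lemma mid_adj m : m \in mid -> e a m.
Proof. by case/midP. Qed.

(** The unattached vertices of [core] would be cut off from t inside the nonneighbours of s, which
    are connected. Choosing s different from l ensures that every vertex of [branch] sees s and
    cannot provide a link. *)
Lemma core_has_leg x : x \in core -> exists s, s \in S /\ exists2 b, b \in leg s & e x b.
Proof.
move=> xc; case: (eqVneq x a) => [->|xa].
  have [s sS] := S_nonempty; exists s; split=> //; exists s; first exact: leg_self.
  exact: mid_adj (S_mid sS).
case: (boolP [exists s in S, exists b in leg s, e x b]).
  by case/exists_inP=> s sS /exists_inP[b bl xb]; exists s; split=> //; exists b.
move=> no; exfalso.
have [l lS fl] := branch_missed_leg; have [s [t [sS tS st sl tl]]] := two_legs l.
pose W := [set w in core | (w != a) && ~~ [exists s in S, exists b in leg s, e w b]].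
have WP w : w \in W -> [/\ w \in core, w != a & forall s b, s \in S -> b \in leg s -> ~~ e w b].
  rewrite inE => /and3P[wc wa nw]; split=> // s' b s'S bl; apply: contra nw => wb.
  by apply/exists_inP; exists s' => //; apply/exists_inP; exists b.
have xW : x \in W by rewrite inE xc xa no.
have in_nn w : w \in core -> ~~ e w s -> w \in nn e s.
  by move=> wc ws; apply/nnP; split; rewrite 1?es //; apply: core_not_mid (S_mid sS).
apply: (nn_connected es ei fr nosimp xW (a := s) (u0 := t)).
- by apply: in_nn => //; case: (WP _ xW) => _ _ h; exact: h sS (leg_self sS).
- apply/negP => /WP[tc _ _]; have := core_not_mid tc (S_mid tS); by rewrite eqxx.
- by apply/nnP; rewrite eq_sym st Sstable.
move=> w u wW /nnP[_ _] uW /nnP[us nsu]; have [wc wa nw] := WP _ wW.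
apply/negP => wu.
have aw := core_adj wc wa; have ws := nw _ _ sS (leg_self sS).
case: (boolP (u \in K)) => uK; first by case/negP: (core_K wc uK).
case: (boolP (u \in mid)) => um.
  case: (mid_leg_branch um) => [[r rS ul]|uB]; first by case/negP: (nw _ _ rS ul).
  by case/negP: nsu; rewrite es; apply: fl.
have uc : u \in core by rewrite [u \in core]inE uK um.
have ua : u != a by apply: contraNneq nsu => ->; rewrite es mid_adj // S_mid.
have au := core_adj uc ua.
have [r [rS [b bl ub]]] : exists r, r \in S /\ exists2 b, b \in leg r & e u b.
  move: uW; rewrite [u \in W]inE uc ua negbK => /exists_inP[r rS /exists_inP[b bl ub]].
  by exists r; split=> //; exists b.
have wb := nw _ _ rS bl.
case: (eqVneq r s) => [E|rs].
  subst r; have [p pS /andP[ps _]] := third s s; have [q qS /andP[qs qp]] := third s p.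
  rewrite eq_sym in ps; rewrite eq_sym in qs; rewrite eq_sym in qp.
  have [c [cK bc sc]] := leg_common bl (leg_self sS) sS.
  have [c1 [c2 [c3 [_ K2 K3 P']]]] :=
    legs_pyr_ex sS pS qS ps qs qp bl (leg_self pS) (leg_self qS).
  have P : pyr e a b p q c c2 c3.
    pyr_facts P'; exact: (legs_pyr sS pS qS ps qs qp bl (leg_self pS) (leg_self qS)).
  have [? ?] := (nw _ _ pS (leg_self pS), nw _ _ qS (leg_self qS)).
  have [? [? ?]] := (core_K wc cK, (core_K wc K2, core_K wc K3)).
  have [? [? ?]] := (core_K uc cK, (core_K uc K2, core_K uc K3)).
  have [? [? ?]] := (Sstable sS pS, (Sstable sS qS, mid_adj (S_mid sS))).
  by pyr_facts P; ref [:: a; b; p; q; c; c2; c3; w; u; s].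
have [q qS /andP[qs qr]] := third s r.
rewrite eq_sym in rs; rewrite eq_sym in qs; rewrite eq_sym in qr.
have [c1 [c2 [c3 [K1 K2 K3 P]]]] :=
  legs_pyr_ex sS rS qS rs qs qr (leg_self sS) bl (leg_self qS).
have ? := nw _ _ qS (leg_self qS).
have [? [? ?]] := (core_K wc K1, (core_K wc K2, core_K wc K3)).
have [? [? ?]] := (core_K uc K1, (core_K uc K2, core_K uc K3)).
by pyr_facts P; ref [:: a; s; b; q; c1; c2; c3; w; u].
Qed.

(** As [S] has at least three elements, a vertex of [core] that is mixed on one leg is thereby a
    witness for [two_of_three]. *)
Lemma core_partial x s b b' t b2 : x \in core -> s \in S -> t \in S -> t != s ->
  b \in leg s -> b' \in leg s -> b2 \in leg t -> e x b -> ~~ e x b' -> e x b2.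
Proof.
move=> xc sS tS ts bl b'l b2l xb xb'.
have xa : x != a by apply: contraNneq xb' => ->; apply: mid_adj (leg_mid b'l).
have ax := core_adj xc xa; have ab := mid_adj (leg_mid bl).
have [q qS /andP[qs qt]] := third s t.
rewrite eq_sym in ts; rewrite eq_sym in qs; rewrite eq_sym in qt.
have [c [cK bc b'c]] := leg_common bl b'l sS.
have [c1 [c2 [c3 [_ K2 K3 P']]]] :=
  legs_pyr_ex sS tS qS ts qs qt b'l b2l (leg_self qS).
have P : pyr e a b' b2 q c c2 c3.
  pyr_facts P'; exact: (legs_pyr sS tS qS ts qs qt b'l b2l (leg_self qS)).
have [? [? ?]] := (core_K xc cK, (core_K xc K2, core_K xc K3)).
have ? := leg_anti sS tS ts bl b2l; have ? := leg_anti sS qS qs bl (leg_self qS).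
by pyr_facts P; ref [:: a; b'; b2; q; c; c2; c3; b; x].
Qed.

Lemma branch_lits f s t : f \in branch -> s \in S -> t \in leg s ->
  forall k, k \in K -> e t k -> e f k = e f t.
Proof.
move=> fB sS tl k kK tk; rewrite (branch_leg fB sS tl); apply: branch_foot => //.
by apply/footP; split=> //; exists t.
Qed.

(** ** A core vertex attached to exactly two of three legs *)

Definition two_of_three z s1 s2 s3 b1 b2 b3 :=
  [/\ z \in core, [/\ s1 \in S, s2 \in S & s3 \in S],
      [/\ s1 != s2, s1 != s3 & s2 != s3],
      [/\ b1 \in leg s1, b2 \in leg s2 & b3 \in leg s3] &
      [/\ e z b1, e z b2 & ~~ e z b3]].

Lemma two_of_three_sym z s1 s2 s3 b1 b2 b3 :
  two_of_three z s1 s2 s3 b1 b2 b3 -> two_of_three z s2 s1 s3 b2 b1 b3.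
Proof. by case=> zc [? ? ?] [? ? ?] [? ? ?] [? ? ?]; split=> //; split=> //; rewrite eq_sym. Qed.

Lemma two_of_three_leg z s1 s2 s3 b1 b2 b3 b : two_of_three z s1 s2 s3 b1 b2 b3 ->
  b \in leg s1 -> e z b.
Proof.
case=> zc [S1 S2 S'3] [s12 s13 s23] [l1 l2 l3] [zb1 zb2 zb3] bl.
by apply: contraNT zb3 => zb; apply: (core_partial zc S1 S'3 _ l1 bl); rewrite // eq_sym.
Qed.

Lemma two_of_three_core z s1 s2 s3 b1 b2 b3 : two_of_three z s1 s2 s3 b1 b2 b3 ->
  z != a /\ e a z.
Proof.
case=> zc _ _ [_ _ l3] [_ _ zb3].
have za : z != a by apply: contraNneq zb3 => ->; apply: mid_adj (leg_mid l3).
by split=> //; apply: core_adj.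
Qed.

(** Otherwise b1 z b2 and b3 c3 k would form a 2P3. Consequently the feet of the three legs exhaust
    K. *)
Lemma two_of_three_K z s1 s2 s3 b1 b2 b3 k : two_of_three z s1 s2 s3 b1 b2 b3 ->
  k \in K -> [\/ e b1 k, e b2 k | e b3 k].
Proof.
move=> Z kK; have [za az] := two_of_three_core Z.
case: Z => zc [S1 S2 S'3] [s12 s13 s23] [l1 l2 l3] [? ? ?].
have [c1 [c2 [c3 [K1 K2 K3 P]]]] := legs_pyr_ex S1 S2 S'3 s12 s13 s23 l1 l2 l3.
case: (boolP (e b1 k)) => ?; first by constructor 1.
case: (boolP (e b2 k)) => ?; first by constructor 2.
constructor 3; apply/negPn/negP => b3k.
have ? : e c3 k by pyr_facts P; apply: Kcl => //; apply: contraNneq b3k => <-.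
have [? [? ?]] := (core_K zc kK, (core_K zc K3, notK kK)).
by pyr_facts P; ref [:: a; b1; b2; b3; c1; c2; c3; z; k].
Qed.

(** A fourth element s would have a neighbour k in K, which is also a neighbour of some b_i by
    [two_of_three_K]; then a s k b_i is a 4-hole. *)
Lemma two_of_three_S z s1 s2 s3 b1 b2 b3 s : two_of_three z s1 s2 s3 b1 b2 b3 ->
  s \in S -> [\/ s = s1, s = s2 | s = s3].
Proof.
move=> Z sS; case: (Z) => zc [S1 S2 S'3] [s12 s13 s23] [l1 l2 l3] _.
case: (eqVneq s s1) => [|n1]; first by constructor 1.
case: (eqVneq s s2) => [|n2]; first by constructor 2.
case: (eqVneq s s3) => [|n3]; first by constructor 3.
exfalso; case/midP: (S_mid sS) => as_ [k kK sk].
have kn := notK kK; have kd := neqK kK.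
have no t b : t \in S -> s != t -> b \in leg t -> e b k -> False.
  move=> tS st bl bk; have ? := leg_anti sS tS st (leg_self sS) bl.
  have ? := leg_neq sS tS st (leg_self sS) bl.
  by have ? := mid_adj (leg_mid bl); ref [:: a; s; b; k].
by case: (two_of_three_K Z kK); [apply: (no s1)|apply: (no s2)|apply: (no s3)].
Qed.

(** In a villa B_i and C_i need only be nested; the vertex z forces the complete adjacency required
    in a basket. The legs s1 and s2 are interchangeable, while s3, where z misses b3, needs its own
    argument. *)
Lemma two_of_three_foot z s1 s2 s3 b1 b2 b3 s : two_of_three z s1 s2 s3 b1 b2 b3 ->
  s \in S -> complete e (leg s) (foot s).
Proof.
move=> Z sS b c bl /footP[cK [b' b'l b'c]]; have [za az] := two_of_three_core Z.
case: (Z) => zc [S1 S2 S'3] [s12 s13 s23] [l1 l2 l3] [zb1 zb2 zb3].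
apply/negPn/negP => nbc; have ab := mid_adj (leg_mid bl).
have [c0 [c0K bc0 b'c0]] := leg_common bl b'l sS.
have [? ?] := (core_K zc cK, core_K zc c0K); have ? := notK cK.
have bb' : e b b' by apply: (leg_clique sS) => //; apply: contraNneq nbc => ->.
have c0c : e c0 c by apply: Kcl => //; apply: contraNneq nbc => <-.
case: (two_of_three_S Z sS) => E; subst s.
- have [c1 [c2 [c3 [_ K2 K3 _]]]] := legs_pyr_ex S1 S2 S'3 s12 s13 s23 b'l l2 l3.
  have [c2' K2' ?] := leg_foot l2; have [c3' K3' ?] := leg_foot l3.
  have P : pyr e a b' b2 b3 c0 c2' c3' by apply: (legs_pyr S1 S2 S'3 s12 s13 s23).
  have [? ?] := (two_of_three_leg Z bl, two_of_three_leg Z b'l).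
  have [? ?] := (leg_anti S1 S2 s12 bl l2, leg_anti S1 S'3 s13 bl l3).
  have P' : pyr e a b' b2 b3 c c2' c3' by apply: (legs_pyr S1 S2 S'3 s12 s13 s23).
  have [? ?] := (core_K zc K2', core_K zc K3').
  by pyr_facts P; pyr_facts P'; ref [:: a; b'; b2; b3; c0; c2'; c3'; z; b; c].
- have [c1' K1' ?] := leg_foot l1; have [c3' K3' ?] := leg_foot l3.
  have P : pyr e a b1 b' b3 c1' c0 c3' by apply: (legs_pyr S1 S2 S'3 s12 s13 s23).
  have Z' := two_of_three_sym Z.
  have [? ?] := (two_of_three_leg Z' bl, two_of_three_leg Z' b'l).
  have s21 : s2 != s1 by rewrite eq_sym.
  have [? ?] := (leg_anti S2 S1 s21 bl l1, leg_anti S2 S'3 s23 bl l3).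
  have P' : pyr e a b1 b' b3 c1' c c3' by apply: (legs_pyr S1 S2 S'3 s12 s13 s23).
  have [? ?] := (core_K zc K1', core_K zc K3').
  by pyr_facts P; pyr_facts P'; ref [:: a; b1; b'; b3; c1'; c0; c3'; z; b; c].
have [s31 s32] : s3 != s1 /\ s3 != s2 by rewrite ![s3 == _]eq_sym.
have cn t d : t \in S -> s3 != t -> d \in leg t -> ~~ e d c.
  move=> tS st dl; have ? := leg_anti S'3 tS st b'l dl.
  have ? := leg_neq S'3 tS st b'l dl; have [? ?] := (notK cK, neqK cK).
  have [? ?] := (mid_adj (leg_mid dl), mid_adj (leg_mid b'l)).
  by ref [:: a; b'; d; c].
have zb : e z b.
  apply/negPn/negP => nzb; have Zb : two_of_three z s1 s2 s3 b1 b2 b by split.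
  case: (two_of_three_K Zb cK) => h; last by rewrite h in nbc.
    by move: (cn s1 b1 S1 s31 l1); rewrite h.
  by move: (cn s2 b2 S2 s32 l2); rewrite h.
have b3c : e b3 c.
  case: (two_of_three_K Z cK) => // h; first by move: (cn s1 b1 S1 s31 l1); rewrite h.
  by move: (cn s2 b2 S2 s32 l2); rewrite h.
have [c1' K1' ?] := leg_foot l1; have [c2' K2' ?] := leg_foot l2.
have P : pyr e a b1 b2 b3 c1' c2' c by apply: (legs_pyr S1 S2 S'3 s12 s13 s23).
have b3b : e b3 b by apply: (leg_clique S'3) => //; apply: contraNneq nbc => <-.
have [? ?] := (leg_anti S'3 S1 s31 bl l1, leg_anti S'3 S2 s32 bl l2).
have [k [kK b3k bk]] := leg_common l3 bl S'3.
have [? [? ?]] := (notK kK, (core_K zc kK, neqK kK)).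
have [? ?] := (core_K zc K1', core_K zc K2').
have P' : pyr e a b1 b2 b3 c1' c2' k by apply: (legs_pyr S1 S2 S'3 s12 s13 s23).
have kc : e k c by apply: Kcl => //; apply: contraNneq nbc => <-.
by pyr_facts P; pyr_facts P'; ref [:: a; b1; b2; b3; c1'; c2'; c; z; b; k].
Qed.

Lemma two_of_three_partial z s1 s2 s3 b1 b2 b3 x p q :
  two_of_three z s1 s2 s3 b1 b2 b3 -> x \in core -> p \in leg s1 -> q \in leg s1 ->
  e x p -> e x q.
Proof.
move=> Z xc pl ql xp; apply/negPn/negP => xq; have [za az] := two_of_three_core Z.
case: (Z) => zc [S1 S2 S'3] [s12 s13 s23] [l1 l2 l3] [zb1 zb2 zb3].
have [s21 s31] : s2 != s1 /\ s3 != s1 by rewrite ![_ == s1]eq_sym.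
have ? := core_partial xc S1 S2 s21 pl ql l2 xp xq.
have ? := core_partial xc S1 S'3 s31 pl ql l3 xp xq.
have ? := two_of_three_leg Z ql.
have xa : x != a by apply: contraNneq xq => ->; apply: mid_adj (leg_mid ql).
have ax := core_adj xc xa.
have [c1 [c2 [c3 [K1 K2 K3 P]]]] := legs_pyr_ex S1 S2 S'3 s12 s13 s23 ql l2 l3.
have [? [? ?]] := (core_K xc K1, (core_K xc K2, core_K xc K3)).
have [? [? ?]] := (core_K zc K1, (core_K zc K2, core_K zc K3)).
by pyr_facts P; ref [:: a; q; b2; b3; c1; c2; c3; z; x].
Qed.

Lemma two_of_three_miss z s1 s2 s3 b1 b2 b3 x p q :
  two_of_three z s1 s2 s3 b1 b2 b3 -> x \in core -> p \in leg s1 -> q \in leg s3 ->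
  ~~ e x p -> ~~ e x q.
Proof.
move=> Z xc pl ql xp; apply/negP => xq; have [za az] := two_of_three_core Z.
case: (Z) => zc [S1 S2 S'3] [s12 s13 s23] [l1 l2 l3] [zb1 zb2 zb3].
have xb3 : e x b3.
  by apply: contraR xp => xb3; apply: (core_partial xc S'3 S1 s13 ql l3 pl xq xb3).
have ? := two_of_three_leg Z pl.
have xa : x != a by apply: contraNneq xp => ->; apply: mid_adj (leg_mid pl).
have ax := core_adj xc xa.
have [c1 [c2 [c3 [K1 K2 K3 P]]]] := legs_pyr_ex S1 S2 S'3 s12 s13 s23 pl l2 l3.
have [? [? ?]] := (core_K xc K1, (core_K xc K2, core_K xc K3)).
have [? [? ?]] := (core_K zc K1, (core_K zc K2, core_K zc K3)).
by pyr_facts P; ref [:: a; p; b2; b3; c1; c2; c3; z; x].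
Qed.

Lemma core_two_branch u y s1 s2 s3 b1 b2 b3 : u \in core -> u != a ->
  s1 \in S -> s2 \in S -> s3 \in S -> s1 != s2 -> s1 != s3 -> s2 != s3 ->
  b1 \in leg s1 -> b2 \in leg s2 -> b3 \in leg s3 ->
  e u b1 -> e u b2 -> y \in branch -> e y s2 -> e u y.
Proof.
move=> uc ua S1 S2 S'3 s12 s13 s23 l1 l2 l3 ub1 ub2 yB ys2.
have uy : u != y by apply: core_not_mid uc _; case/branchP: yB.
have yb2 : e y b2 by rewrite (branch_leg yB S2 l2).
case: (boolP (e y b1)) => yb1; first exact: (adj_of_two_legs uy S1 S2 s12 l1 l2).
have ys1 : ~~ e y s1 by rewrite -(branch_leg yB S1 l1).
have [c1 [c2 [c3 [K1 K2 K3 P]]]] := legs_pyr_ex S1 S2 S'3 s12 s13 s23 l1 l2 l3.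
pyr_facts P.
have ? : e y b3.
  rewrite (branch_leg yB S'3 l3); apply/negPn/negP => n.
  exact: (branch_misses_one yB S1 S'3 s13 ys1 n).
have ? : ~~ e y c1 by rewrite (branch_lits yB S1 l1).
have ? : e y c3 by rewrite (branch_lits yB S'3 l3).
have ? : e y c2 by rewrite (branch_lits yB S2 l2).
have [? [? ?]] := (core_K uc K1, (core_K uc K2, core_K uc K3)).
have [? ?] := (core_adj uc ua, mid_adj (proj1 (branchP _ yB))).
by ref [:: a; b1; b2; b3; c1; c2; c3; u; y].
Qed.

(** The vertices of [core] that miss b1 miss the legs of s1 and s3 altogether, hence are complete to
    the leg of s2. They form a clique, and their outside neighbours, namely [a], other vertices of
    [core], the leg of s2 and vertices of [branch], are pairwise adjacent: a simplicial vertex would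
    result. *)
Lemma two_of_three_full z s1 s2 s3 b1 b2 b3 x b :
  two_of_three z s1 s2 s3 b1 b2 b3 -> x \in core -> b \in leg s1 -> e x b.
Proof.
move=> Z xc bl; apply/negPn/negP => nxb; have [za az] := two_of_three_core Z.
have Z' := two_of_three_sym Z.
case: (Z) => zc [S1 S2 S'3] [s12 s13 s23] [l1 l2 l3] [zb1 zb2 zb3].
pose X := [set x in core | ~~ e x b1].
have XP y p : y \in X -> [/\ y \in core, y != a, p \in leg s1 -> ~~ e y p & p \in leg s3 -> ~~ e y p].
  rewrite [y \in X]inE => /andP[yc yb]; split=> //.
  - by apply: contraNneq yb => ->; apply: mid_adj (leg_mid l1).
  - by move=> pl; apply: contra yb => yp; apply: (two_of_three_partial Z yc pl).
  - by move=> pl; apply: (two_of_three_miss Z yc l1).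
have Xfull y p : y \in X -> p \in leg s2 -> e y p.
  move=> yX pl; have [yc ya _ _] := XP y p yX.
  have [t [tS [q ql yq]]] := core_has_leg yc.
  case: (two_of_three_S Z tS) => E; subst t.
  + by have [_ _ h _] := XP y q yX; case/negP: (h ql).
  + exact: (two_of_three_partial Z' yc ql).
  + by have [_ _ _ h] := XP y q yX; case/negP: (h ql).
have Xnot y p : y \in core -> y \notin X -> p \in leg s1 -> e y p.
  move=> yc; rewrite [y \in X]inE yc negbK => yb1 pl.
  exact: (two_of_three_partial Z yc l1).
have xX : x \in X.
  rewrite [x \in X]inE xc /=; apply: contra nxb => xb1.
  exact: (two_of_three_partial Z xc l1).
have [c1 [c2 [c3 [K1 K2 K3 P]]]] := legs_pyr_ex S1 S2 S'3 s12 s13 s23 l1 l2 l3.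
pyr_facts P.
have ck y : y \in core -> [/\ ~~ e y c1, ~~ e y c2 & ~~ e y c3].
  by move=> yc; rewrite !core_K.
have [? ? ?] := ck z zc.
have Xf y : y \in X -> [/\ e a y, ~~ e y b1, e y b2, ~~ e y b3 & [/\ ~~ e y c1, ~~ e y c2 & ~~ e y c3]].
  move=> yX; have [yc ya h1 h3] := XP y b1 yX; have [_ _ _ h3'] := XP y b3 yX.
  split; [exact: core_adj|exact: h1|exact: Xfull|exact: h3'|exact: ck].
have bs2 f : f \in branch -> e f s2.
  move=> fB; apply/negPn/negP => nf.
  have fb2 : ~~ e f b2 by rewrite (branch_leg fB S2 l2).
  have fb1 : e f b1.
    rewrite (branch_leg fB S1 l1); apply/negPn/negP => n.
    exact: (branch_misses_one fB S1 S2 s12 n nf).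
  have fb3 : e f b3.
    rewrite (branch_leg fB S'3 l3); apply/negPn/negP => n.
    exact: (branch_misses_one fB S2 S'3 s23 nf n).
  have ? : e f c1 by rewrite (branch_lits fB S1 l1).
  have ? : e f c3 by rewrite (branch_lits fB S'3 l3).
  have ? : ~~ e f c2 by rewrite (branch_lits fB S2 l2).
  have [? ? ? ? [? ? ?]] := Xf x xX; have ? := mid_adj (proj1 (branchP _ fB)).
  by ref [:: a; b1; b2; b3; c1; c2; c3; z; x; f].
apply: (clique_with_clique_nbhd es ei fr nosimp xX).
  move=> y w yX wX yw; have [? ? ? ? [? ? ?]] := Xf y yX.
  have [? ? ? ? [? ? ?]] := Xf w wX.
  by ref [:: a; b1; b2; b3; c1; c2; c3; y; w].
have nb w y : w \in X -> y \notin X -> e w y ->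
    [\/ y = a, [/\ y \in core, y != a, e y b1 & forall p, p \in leg s2 -> e y p],
        y \in leg s2 | y \in branch].
  move=> wX yX wy; have [wc wa _ _] := XP w w wX.
  case: (eqVneq y a) => [|ya]; first by constructor 1.
  case: (boolP (y \in K)) => yK; first by case/negP: (core_K wc yK).
  case: (boolP (y \in mid)) => ym.
    case: (mid_leg_branch ym) => [[t tS yl]|]; last by constructor 4.
    case: (two_of_three_S Z tS) => E; subst t; last first.
    - by have [_ _ _ h] := XP w y wX; case/negP: (h yl).
    - by constructor 3.
    - by have [_ _ h _] := XP w y wX; case/negP: (h yl).
  have yc : y \in core by rewrite [y \in core]inE yK ym.
  have yb1 : e y b1 by apply: Xnot.
  constructor 2; split=> // p pl; apply/negPn/negP => nyp.
  have nyb2 : ~~ e y b2 by apply: contra nyp => yb2; apply: (two_of_three_partial Z' yc l2).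
  have nyb3 : ~~ e y b3 by apply: (two_of_three_miss Z' yc l2 l3).
  have [? ? ? ? [? ? ?]] := Xf w wX; have [? ? ?] := ck y yc.
  by have ? := core_adj yc ya; ref [:: a; b1; b2; b3; c1; c2; c3; w; y].
have cm u y : [/\ u \in core, u != a, e u b1 & forall p, p \in leg s2 -> e u p] ->
    [\/ y = a, [/\ y \in core, y != a, e y b1 & forall p, p \in leg s2 -> e y p],
        y \in leg s2 | y \in branch] -> u != y -> e u y.
  case=> uc ua ub1 ul [->|[yc ya yb1 yl]|yl|yB] uy.
  - by rewrite es core_adj.
  - by apply: (adj_of_two_legs uy S1 S2 s12 l1 l2) => //; [apply: ul|apply: yl].
  - exact: ul.
  - have ub2 := ul _ l2.
    exact: (core_two_branch uc ua S1 S2 S'3 s12 s13 s23 l1 l2 l3 ub1 ub2 yB (bs2 _ yB)).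
have am y : y \in leg s2 \/ y \in branch -> e a y.
  by case=> [/leg_mid/mid_adj|/branchP[/mid_adj]].
move=> w w' x1 x2 wX w'X x1X x2X wx1 w'x2 x12.
have n1 := nb w x1 wX x1X wx1; have n2 := nb w' x2 w'X x2X w'x2.
case: (n1) => [E1|h1|h1|h1]; last 3 first.
- exact: cm.
- case: (n2) => [->|h2|h2|h2].
  + by rewrite es; apply: am; left.
  + by rewrite es; apply: cm; rewrite // eq_sym.
  + exact: leg_clique S2 _ _ h1 h2 x12.
  + by rewrite es (branch_leg h2 S2 h1) bs2.
- case: (n2) => [->|h2|h2|h2].
  + by rewrite es; apply: am; right.
  + by rewrite es; apply: cm; rewrite // eq_sym.
  + by rewrite (branch_leg h1 S2 h2) bs2.
  + exact: branch_clique.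
subst x1; case: (n2) => [E|[h2 h3 _ _]|h2|h2].
- by rewrite E eqxx in x12.
- exact: core_adj.
- by apply: am; left.
- by apply: am; right.
Qed.

Lemma foot_sub s k : k \in foot s -> k \in K.
Proof. by case/footP. Qed.

Lemma foot_anti s t b c : s \in S -> t \in S -> s != t -> b \in leg s -> c \in foot t ->
  ~~ e b c.
Proof.
move=> sS tS st bl /footP[cK [b' b'l b'c]]; have ? := leg_anti sS tS st bl b'l.
have ? := leg_neq sS tS st bl b'l; have [? ?] := (notK cK, neqK cK).
have [? ?] := (mid_adj (leg_mid bl), mid_adj (leg_mid b'l)).
by ref [:: a; b; b'; c].
Qed.

Lemma foot_neq s t c d : s \in S -> t \in S -> s != t -> c \in foot s -> d \in foot t ->
  c != d.
Proof.
move=> sS tS st /footP[_ [b bl bc]] df; apply: contraTneq bc => ->.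
exact: (foot_anti sS tS st bl df).
Qed.

Lemma leg_not_branch s b : s \in S -> b \in leg s -> b \notin branch.
Proof.
move=> sS /legP[_ _ bt]; apply/branchP => -[_ [p [q [pS qS pq bp bq]]]].
case: (eqVneq p s) => [E|ps]; last by move: (bt p pS ps); rewrite bp.
by move: (bt q qS); rewrite bq -E eq_sym pq => /(_ isT).
Qed.

Lemma leg_nested s b b' : b \in leg s -> b' \in leg s -> s \in S ->
  (nbhd e b :&: foot s \subset nbhd e b' :&: foot s) ||
  (nbhd e b' :&: foot s \subset nbhd e b :&: foot s).
Proof.
move=> bl b'l sS; apply/orP; case: (boolP (nbhd e b :&: _ \subset _)); first by left.
case/subsetPn=> p; rewrite !in_setI [p \in nbhd e b]inE [p \in nbhd e b']inE.
case/andP=> bp pf; rewrite pf andbT => nb'p; right; apply/subsetP => q.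
rewrite !in_setI [q \in nbhd e b]inE [q \in nbhd e b']inE => /andP[b'q qf].
rewrite qf andbT; apply/negPn/negP => nbq.
have bb' : e b b' by apply: (leg_clique sS) => //; apply: contraNneq nb'p => <-.
have pq : e p q.
  by apply: Kcl; rewrite ?(foot_sub pf) ?(foot_sub qf) //; apply: contraNneq nbq => <-.
have [? ?] := (mid_adj (leg_mid bl), mid_adj (leg_mid b'l)).
have [? ?] := (notK (foot_sub pf), notK (foot_sub qf)).
by ref [:: a; b; b'; p; q].
Qed.

Lemma leg_villa_chain s : s \in S -> villa_chain e (leg s) (foot s).
Proof.
move=> sS; have [u [l [ul uE so top]]] := chain_order (leg_self sS)
  (fun b b' bl b'l => leg_nested bl b'l sS).
exists u, l; split=> //; split=> //; split=> //; split.
  apply/setIidPr; apply/subsetP => c cf; case/footP: (cf) => cK [b bl bc].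
  have /subsetP/(_ c) := top b bl; rewrite !in_setI cf !andbT; apply.
  by rewrite inE.
have : last u l \in leg s by rewrite -uE mem_last.
move=> ll; have [k kK lk] := leg_foot ll; apply/set0Pn; exists k.
by rewrite in_setI inE lk; apply/footP; split=> //; exists (last u l).
Qed.

(** * The parts of the final partition *)

Variable l : T.
Hypotheses (lS : l \in S)
  (lmiss : forall f s, f \in branch -> s \in S -> s != l -> e f s).

(** The set [upper] will consist of the universal vertices, [side] is F, [apart] is Y, and [full] is
    A in a villa or a mansion. *)
Definition upper : {set T} := [set u in branch | e u l].
Definition side : {set T} := [set f in branch | ~~ e f l].
Definition apart : {set T} := [set k in K | [forall s in S, k \notin foot s]].
Definition full : {set T} :=
  [set x in core | [forall s in S, forall b in leg s, e x b]].

Lemma fullP x : reflect (x \in core /\ forall s b, s \in S -> b \in leg s -> e x b)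
  (x \in full).
Proof.
rewrite [x \in full]inE; apply: (iffP andP) => -[xc h]; split=> //.
  by move=> s b sS bl; move/forall_inP/(_ s sS)/forall_inP/(_ b bl): h.
by apply/forall_inP => s sS; apply/forall_inP => b; apply: h.
Qed.

Lemma upper_S u s : u \in upper -> s \in S -> e u s.
Proof.
by rewrite inE => /andP[uB ul] sS; case: (eqVneq s l) => [->//|]; apply: lmiss.
Qed.

Lemma upper_branch u : u \in upper -> u \in branch.
Proof. by rewrite inE => /andP[]. Qed.

Lemma side_branch f : f \in side -> f \in branch.
Proof. by rewrite inE => /andP[]. Qed.

Lemma side_l f : f \in side -> ~~ e f l.
Proof. by rewrite inE => /andP[]. Qed.

Lemma a_full : a \in full.
Proof.
apply/fullP; split; last by move=> s b _ /leg_mid/mid_adj.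
have aK : a \notin K by rewrite inE eqxx.
by rewrite [a \in core]inE aK; apply/negP => /mid_adj; rewrite ei.
Qed.

Lemma full_adj x y : x \in full -> y != x ->
  (exists s t, [/\ s \in S, t \in S, s != t, e y s & e y t]) -> e x y.
Proof.
move=> /fullP[xc xl] yx [s [t [sS tS st ys yt]]]; rewrite eq_sym in yx.
have [sl tl] := (leg_self sS, leg_self tS).
exact: (adj_of_two_legs yx sS tS st sl tl (xl _ _ sS sl) (xl _ _ tS tl)).
Qed.

Lemma full_clique : clique e full.
Proof.
move=> x y xf yf xy; apply: full_adj => //; first by rewrite eq_sym.
case/fullP: yf => yc yl; have [s [t [sS tS st _ _]]] := two_legs a.
exists s, t; split=> //; first exact: yl sS (leg_self sS).
exact: yl tS (leg_self tS).
Qed.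

Lemma branch_full f x : f \in branch -> x \in full -> e f x.
Proof.
move=> fB xf; rewrite es; apply: full_adj => //; last by case/branchP: fB.
by rewrite eq_sym; apply: core_not_mid; [case/fullP: xf|case/branchP: fB].
Qed.

(** The order is that of a mansion partition. The lists for a basket and a villa are subsequences
    obtained by dropping parts that are empty in these cases, so disjointness and covering are
    proved once. *)
Definition parts t (s_ : 'I_t -> T) (A X : {set T}) : seq {set T} :=
  A :: side :: X :: apart :: [seq leg (s_ i) | i <- enum 'I_t] ++
                             [seq foot (s_ i) | i <- enum 'I_t].

Lemma parts_disjoint t (s_ : 'I_t -> T) (A X : {set T}) : injective s_ ->
  (forall i, s_ i \in S) -> A :|: X = core -> [disjoint A & X] ->
  pairwise (fun X Y : {set T} => [disjoint X & Y]) (parts s_ A X).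
Proof.
move=> s_inj s_S AX dAX.
have Ac x : x \in A -> x \in core by rewrite -AX in_setU => ->.
have Xc x : x \in X -> x \in core by rewrite -AX in_setU => ->; rewrite orbT.
have dis (Y Z : {set T}) : (forall x, x \in Y -> x \notin Z) -> [disjoint Y & Z].
  by move=> h; apply/pred0P => x /=; case: (boolP (x \in Y)) => // /h /negbTE.
have cm x : x \in core -> x \notin mid by rewrite [x \in core]inE => /andP[].
have cK x : x \in core -> x \notin K by rewrite [x \in core]inE => /andP[].
have mK x : x \in mid -> x \notin K by move=> /mid_adj ax; apply/negP => /notK; rewrite ax.
have sm x : x \in side -> x \in mid by case/side_branch/branchP.
have aK x : x \in apart -> x \in K by rewrite [x \in apart]inE => /andP[].
have ainf i x : x \in apart -> x \notin foot (s_ i).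
  by rewrite [x \in apart]inE => /andP[_ /forall_inP]; apply.
have all_leg (Y : {set T}) : (forall x, x \in Y -> forall i, x \notin leg (s_ i)) ->
    all (fun Z : {set T} => [disjoint Y & Z]) [seq leg (s_ i) | i <- enum 'I_t].
  by move=> h; apply/allP => Z /mapP[i _ ->]; apply: dis => x /h.
have all_foot (Y : {set T}) : (forall x, x \in Y -> forall i, x \notin foot (s_ i)) ->
    all (fun Z : {set T} => [disjoint Y & Z]) [seq foot (s_ i) | i <- enum 'I_t].
  by move=> h; apply/allP => Z /mapP[i _ ->]; apply: dis => x /h.
have c_leg x i : x \in core -> x \notin leg (s_ i).
  by move=> /cm; apply: contra => /leg_mid.
have c_foot x i : x \in core -> x \notin foot (s_ i).
  by move=> /cK; apply: contra => /foot_sub.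
rewrite /parts !pairwise_cons pairwise_cat.
apply/andP; split.
  rewrite /= all_cat dAX all_leg ?all_foot; last 2 first.
  - by move=> x /Ac xc i; apply: c_foot.
  - by move=> x /Ac xc i; apply: c_leg.
  rewrite !andbT; apply/andP; split; apply: dis => x /Ac xc.
    by apply: contra (cm x xc) => /sm.
  by apply: contra (cK x xc) => /aK.
apply/andP; split.
  rewrite /= all_cat all_leg ?all_foot.
  - rewrite !andbT; apply/andP; split; apply: dis => x xs.
      by apply: contraL (sm x xs) => /Xc/cm.
    by apply: contra (mK x (sm x xs)) => /aK.
  - by move=> x /sm/mK xK i; apply: contra xK => /foot_sub.
  - by move=> x /side_branch xB i; apply: contraL xB => /(leg_not_branch (s_S i)).
apply/andP; split.
  rewrite /= all_cat all_leg ?all_foot; last 2 first.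
  - by move=> x /Xc xc i; apply: c_foot.
  - by move=> x /Xc xc i; apply: c_leg.
  by rewrite !andbT; apply: dis => x /Xc/cK; apply: contra => /aK.
apply/andP; split.
  rewrite all_cat all_leg ?all_foot //; first by move=> x xa i; apply: ainf.
  by move=> x /aK xK i; apply: contraL xK => /leg_mid/mK.
have legfoot i j x : x \in leg (s_ i) -> x \notin foot (s_ j).
  by move=> /leg_mid/mK; apply: contra => /foot_sub.
have sij i j : i != j -> s_ i != s_ j by apply: contraNneq => /s_inj ->.
apply/and3P; split.
- apply/allrelP => Y Z /mapP[i _ ->] /mapP[j _ ->]; apply: dis => x; exact: legfoot.
- apply: pairwise_enum => i j ij; apply: dis => x xi; apply/negP => xj.
  by have := leg_neq (s_S i) (s_S j) (sij i j ij) xi xj; rewrite eqxx.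
- apply: pairwise_enum => i j ij; apply: dis => x xi; apply/negP => xj.
  by have := foot_neq (s_S i) (s_S j) (sij i j ij) xi xj; rewrite eqxx.
Qed.

Lemma parts_cover t (s_ : 'I_t -> T) (A X : {set T}) :
  (forall i, s_ i \in S) -> (forall s, s \in S -> exists i, s = s_ i) -> A :|: X = core ->
  forall x, (x \in ~: upper) = has (fun Y : {set T} => x \in Y) (parts s_ A X).
Proof.
move=> s_S s_onto AX x; rewrite in_setC /parts /= has_cat.
have up_mid y : y \in upper -> y \in mid by move/upper_branch; case/branchP.
have mK y : y \in mid -> y \notin K by move=> /mid_adj ay; apply/negP => /notK; rewrite ay.
apply/idP/idP => [xu|].
  case: (boolP (x \in K)) => xK.
    case: (boolP (x \in apart)) => xa; first by rewrite !orbT.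
    move: xa; rewrite [x \in apart]inE xK /= => /forall_inPn[s sS]; rewrite negbK.
    have [i ->] := s_onto s sS => xf.
    suff -> : has (fun Y : {set T} => x \in Y) [seq foot (s_ i) | i <- enum 'I_t].
      by rewrite !orbT.
    by apply/hasP; exists (foot (s_ i)) => //; apply: map_f; rewrite mem_enum.
  case: (boolP (x \in mid)) => xm.
    case: (mid_leg_branch xm) => [[s sS xl]|xB].
      have [i E] := s_onto s sS; subst s.
      suff -> : has (fun Y : {set T} => x \in Y) [seq leg (s_ i) | i <- enum 'I_t].
        by rewrite !orbT.
      by apply/hasP; exists (leg (s_ i)) => //; apply: map_f; rewrite mem_enum.
    by move: xu; rewrite [x \in upper]inE [x \in side]inE xB /= => ->; rewrite orbT.
  have : x \in core by rewrite [x \in core]inE xK xm.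
  by rewrite -AX in_setU => /orP[->|->]; rewrite ?orbT.
case/or4P=> [xA|xs|xX|].
- have : x \in core by rewrite -AX in_setU xA.
  by rewrite [x \in core]inE => /andP[_]; apply: contra => /up_mid.
- by move: (side_l xs); apply: contra; rewrite [x \in upper]inE => /andP[].
- have : x \in core by rewrite -AX in_setU xX orbT.
  by rewrite [x \in core]inE => /andP[_]; apply: contra => /up_mid.
case/or3P=> [xa|/hasP[_ /mapP[i _ ->] xl]|/hasP[_ /mapP[i _ ->] xf]].
- by move: xa; rewrite [x \in apart]inE => /andP[xK _]; apply: contraL xK => /up_mid/mK.
- by apply: contra (leg_not_branch (s_S i) xl) => /upper_branch.
- by apply: contraL (foot_sub xf) => /up_mid/mK.
Qed.

Lemma leg_neq0 s : s \in S -> leg s != set0.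
Proof. by move=> sS; apply/set0Pn; exists s; apply: leg_self. Qed.

Lemma foot_neq0 s : s \in S -> foot s != set0.
Proof.
move=> sS; have [k kK sk] := leg_foot (leg_self sS); apply/set0Pn; exists k.
by apply/footP; split=> //; exists s => //; apply: leg_self.
Qed.

Lemma foot_clique s : clique e (foot s).
Proof. by move=> x y /foot_sub xK /foot_sub yK; apply: Kcl. Qed.

Lemma foot_complete s t : s \in S -> t \in S -> s != t -> complete e (foot s) (foot t).
Proof.
move=> sS tS st x y xf yf; apply: Kcl; rewrite ?(foot_sub xf) ?(foot_sub yf) //.
exact: foot_neq sS tS st xf yf.
Qed.

Lemma branch_leg_foot f s : f \in branch -> s \in S -> e f s ->
  (forall x, x \in leg s -> e f x) /\ (forall x, x \in foot s -> e f x).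
Proof.
by move=> fB sS fs; split=> x xl; [rewrite (branch_leg fB sS xl)|rewrite (branch_foot fB sS xl)].
Qed.

Lemma side_anti : anticomplete e side (leg l :|: foot l).
Proof.
move=> f x fs; have [fB fl] := (side_branch fs, side_l fs).
by rewrite in_setU => /orP[xl|xl]; [rewrite (branch_leg fB lS xl)|rewrite (branch_foot fB lS xl)].
Qed.

Lemma side_clique : clique e side.
Proof. by move=> x y /side_branch xB /side_branch yB; apply: branch_clique. Qed.

Lemma upper_clique : clique e upper.
Proof. by move=> x y /upper_branch xB /upper_branch yB; apply: branch_clique. Qed.

Lemma upper_complete : (forall u x, u \in upper -> x \in core -> e u x) ->
  (forall u x, u \in upper -> x \in apart -> e u x) ->
  complete e upper (~: upper).
Proof.
move=> uc ua u x uu; rewrite in_setC => xu; have uB := upper_branch uu.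
have ls s : s \in S -> _ := fun sS => branch_leg_foot uB sS (upper_S uu sS).
case: (boolP (x \in K)) => xK.
  case: (boolP (x \in apart)) => xa; first exact: ua.
  move: xa; rewrite [x \in apart]inE xK /= => /forall_inPn[s sS]; rewrite negbK.
  exact: (proj2 (ls s sS)).
case: (boolP (x \in mid)) => xm.
  case: (mid_leg_branch xm) => [[s sS xl]|xB]; first exact: (proj1 (ls s sS)).
  by apply: branch_clique => //; apply: contraNneq xu => <-.
by apply: uc; rewrite // [x \in core]inE xK xm.
Qed.

Definition finished := exists Q, (basket5 e Q \/ villa e Q \/ mansion e Q) /\
  clique e (~: Q) /\ complete e (~: Q) Q.

Lemma two_of_three_basket z s1 s2 s3 b1 b2 b3 :
  two_of_three z s1 s2 s3 b1 b2 b3 -> finished.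
Proof.
move=> Z; have Z' := two_of_three_sym Z.
case: (Z) => zc [S1 S2 S'3] [s12 s13 s23] [l1 l2 l3] [zb1 zb2 zb3].
pose s_ (i : 'I_3) := nth s3 [:: s1; s2; s3] i.
have s_S i : s_ i \in S by rewrite /s_; case: i => -[|[|[|//]]].
have s_inj : injective s_.
  move=> i j; case: i => -[|[|[|//]]] ?; case: j => -[|[|[|//]]] ?;
    rewrite /s_ /= => E; apply: val_inj => //=; move: s12 s13 s23;
    by rewrite ?E ?eqxx // -?E ?eqxx.
have s_onto s : s \in S -> exists i, s = s_ i.
  move=> sS; case: (two_of_three_S Z sS) => ->;
    [by exists (@Ordinal 3 0 isT)|by exists (@Ordinal 3 1 isT)|by exists (@Ordinal 3 2 isT)].
have sij i j : i != j -> s_ i != s_ j by apply: contraNneq => /s_inj ->.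
have [j lj] := s_onto l lS.
have ca1 x b : x \in core -> b \in leg s1 -> e x b by apply: (two_of_three_full Z).
have ca2 x b : x \in core -> b \in leg s2 -> e x b by apply: (two_of_three_full Z').
have bc f x : f \in branch -> x \in core -> e f x.
  move=> fB xc; rewrite es; case: (eqVneq x a) => [->|xa].
    by case/branchP: fB => /mid_adj.
  have [xb1 xb2] := (ca1 _ _ xc l1, ca2 _ _ xc l2).
  case: (boolP (e f s2)) => f2.
    exact: (core_two_branch xc xa S1 S2 S'3 s12 s13 s23 l1 l2 l3 xb1 xb2 fB f2).
  have f1 : e f s1.
    by apply/negPn/negP => n; apply: (branch_misses_one fB S1 S2 s12 n f2).
  have s21 : s2 != s1 by rewrite eq_sym.
  exact: (core_two_branch xc xa S2 S1 S'3 s21 s23 s13 l2 l1 l3 xb2 xb1 fB f1).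
have ap0 : apart = set0.
  apply/setP => k; rewrite [RHS]inE; apply/negP; rewrite [k \in apart]inE.
  case/andP=> kK /forall_inP nf; case: (two_of_three_K Z kK) => bk.
  - by case/negP: (nf s1 S1); apply/footP; split=> //; exists b1.
  - by case/negP: (nf s2 S2); apply/footP; split=> //; exists b2.
  - by case/negP: (nf s3 S'3); apply/footP; split=> //; exists b3.
have part : is_partition ([:: core; side] ++ [seq leg (s_ i) | i <- enum 'I_3] ++
    [seq foot (s_ i) | i <- enum 'I_3]) (~: upper).
  have AX : core :|: set0 = core by rewrite setU0.
  have dAX : [disjoint core & set0] by rewrite disjoint_sym disjoints_subset sub0set.
  apply: partition_of_pairwise.
    apply: subseq_pairwise (parts_disjoint s_inj s_S AX dAX).
    exact: (cat_subseq (prefix_subseq [:: core; side] [:: set0; apart]) (subseq_refl _)).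
  by move=> x; rewrite (parts_cover s_S s_onto AX) /parts ap0 /= in_set0.
exists (~: upper); rewrite setCK; split; last first.
  split; first exact: upper_clique.
  apply: upper_complete => u x uu; first by apply: bc; apply: upper_branch.
  by rewrite ap0 in_set0.
(* The index 2 is that of s3, the one leg on which vertices of [core] may be mixed, and serves as
   [istar]; the index of l serves as [jstar]. *)
left; exists core, side, (fun i => leg (s_ i)), (fun i => foot (s_ i)), (@Ordinal 3 2 isT), j.
have ij2 (i : 'I_3) : i != @Ordinal 3 2 isT -> s_ i = s1 \/ s_ i = s2.
  by case: i => -[|[|[|//]]] ? //; [left|right].
have core_cl : clique e core.
  by move=> x y xc yc xy; apply: (adj_of_two_legs xy S1 S2 s12 l1 l2); auto.
split=> //; split; first by apply/set0Pn; exists z.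
split; first by move=> i; rewrite leg_neq0 ?foot_neq0.
split=> //; split; first exact: side_clique.
split; first by move=> i; split; [apply: leg_clique|apply: foot_clique].
split.
  move=> i i' /sij ii'; split; last exact: foot_complete.
  by move=> x y; apply: leg_anti.
split; first by move=> i /ij2[->|->] x y xc yl; [apply: ca1|apply: ca2].
split.
  pose f x := nbhd e x :&: leg s3.
  have nest x y : x \in core -> y \in core -> (f x \subset f y) || (f y \subset f x).
    move=> xc yc; apply/orP; case: (boolP (f x \subset f y)); first by left.
    case/subsetPn=> p; rewrite !in_setI [p \in nbhd e x]inE [p \in nbhd e y]inE.
    case/andP=> xp pl; rewrite pl andbT => nyp; right; apply/subsetP => q.
    rewrite !in_setI [q \in nbhd e x]inE [q \in nbhd e y]inE => /andP[yq ql].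
    rewrite ql andbT; apply/negPn/negP => nxq.
    have xy : e x y by apply: core_cl => //; apply: contraNneq nyp => <-.
    have pq : e p q by apply: (leg_clique S'3) => //; apply: contraNneq nxq => <-.
    have [xb1 yb1] := (ca1 _ _ xc l1, ca1 _ _ yc l1).
    have [? ?] := (leg_anti S1 S'3 s13 l1 pl, leg_anti S1 S'3 s13 l1 ql).
    by ref [:: x; y; p; q; b1].
  have [u [lst [ul uE so top]]] := chain_order zc nest.
  exists u, lst; split=> //; split=> //; split=> //.
  (* The apex is complete to all legs, so the head of the chain is complete to the leg of s3 as
     well. *)
  have ac : a \in core by case/fullP: a_full.
  apply/setIidPr; apply/subsetP => b bl; have /subsetP/(_ b) := top a ac.
  by rewrite !in_setI [b \in nbhd e a]inE bl (mid_adj (leg_mid bl)) => /(_ isT)/andP[].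
split; first by move=> i x y xc /foot_sub; apply: core_K.
split; first by move=> i; apply: (two_of_three_foot Z).
split; first by move=> i i' /sij ii' x y xl yf; apply: foot_anti ii' xl yf.
split; last by rewrite /= -lj; apply: side_anti.
move=> f x fs; rewrite in_setD -lj 2!in_setU !negb_or => /andP[/andP[/andP[xl xf] xs]].
have fB := side_branch fs; rewrite (parts_cover s_S s_onto (setU0 core)).
rewrite /parts ap0 /= in_set0 (negbTE xs) /= has_cat.
case/or3P=> [xc|/hasP[_ /mapP[i _ ->] xi]|/hasP[_ /mapP[i _ ->] xi]]; first exact: bc.
  have sl : s_ i != l by apply: contraNneq xl => <-.
  exact: (proj1 (branch_leg_foot fB (s_S i) (lmiss fB (s_S i) sl))).
have sl : s_ i != l by apply: contraNneq xf => <-.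
exact: (proj2 (branch_leg_foot fB (s_S i) (lmiss fB (s_S i) sl))).
Qed.

(** ** No core vertex is attached to exactly two of three legs *)

Hypothesis no_two : forall z s1 s2 s3 b1 b2 b3, ~ two_of_three z s1 s2 s3 b1 b2 b3.

(** A vertex attached to two legs is complete to any third one, and then, with a third leg in the
    role of one of the two, to the first two as well. *)
Lemma core_cases x : x \in core -> x \in full \/
  exists2 s, s \in S & (forall b, b \in leg s -> e x b) /\
    forall t b, t \in S -> t != s -> b \in leg t -> ~~ e x b.
Proof.
move=> xc; have [s [sS [b bl xb]]] := core_has_leg xc.
have three p q r b1 b2 b3 : p \in S -> q \in S -> r \in S -> p != q -> p != r -> q != r ->
    b1 \in leg p -> b2 \in leg q -> b3 \in leg r -> e x b1 -> e x b2 -> e x b3.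
  move=> pS qS rS pq pr qr l1 l2 l3 x1 x2; apply/negPn/negP => x3.
  by apply: (@no_two x p q r b1 b2 b3); split.
case: (boolP [exists t in S, (t != s) && [exists b' in leg t, e x b']]) => [ex|no].
  left; case/exists_inP: ex => t tS /andP[ts /exists_inP[b' b'l xb']].
  apply/fullP; split=> // r c rS cl.
  have st : s != t by rewrite eq_sym.
  have [u uS /andP[us ut]] := third s t.
  have [su tu] : s != u /\ t != u by rewrite eq_sym us eq_sym ut.
  have xu : e x u by apply: (three s t u b b' u) => //; apply: leg_self.
  case: (eqVneq r s) => [E|rs].
    by subst r; apply: (three t u s b' u c) => //; apply: leg_self.
  case: (eqVneq r t) => [E|rt].
    by subst r; apply: (three s u t b u c) => //; rewrite 1?eq_sym //; apply: leg_self.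
  by apply: (three s t r b b' c); rewrite // eq_sym.
right; exists s => //; have anti t c : t \in S -> t != s -> c \in leg t -> ~~ e x c.
  move=> tS ts cl; apply: contra no => xc'; apply/exists_inP; exists t => //.
  by rewrite ts; apply/exists_inP; exists c.
split=> // c cl; apply/negPn/negP => nxc; have [t tS /andP[ts _]] := third s s.
by case/negP: (anti t t tS ts (leg_self tS)); apply: (core_partial xc sS tS ts bl cl (leg_self tS)).
Qed.

(* Otherwise the vertices attached to [leg s] only would have a clique as
   their neighbourhood. *)
Lemma single_leg_missed x s : x \in core -> s \in S ->
  (forall t b, t \in S -> t != s -> b \in leg t -> ~~ e x b) ->
  exists2 f, f \in branch & ~~ e f s.
Proof.
move=> xc sS xanti; case: (boolP [exists f in branch, ~~ e f s]) => [/exists_inP //|no].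
exfalso.
have fs f : f \in branch -> e f s.
  by move=> fB; apply: contraR no => n; apply/exists_inP; exists f.
pose W := [set w in core | [forall t in S, (t != s) ==> [forall b in leg t, ~~ e w b]]].
have WP w : w \in W -> w \in core /\ forall t b, t \in S -> t != s -> b \in leg t -> ~~ e w b.
  rewrite [w \in W]inE => /andP[wc /forall_inP h]; split=> // t b tS ts bl.
  by move/implyP/(_ ts)/forall_inP/(_ b bl): (h t tS).
have [p pS /andP[ps _]] := third s s; have [q qS /andP[qs qp]] := third s p.
have [sp [sq pq]] : s != p /\ s != q /\ p != q by rewrite eq_sym ps eq_sym qs eq_sym qp.
have not_full w : w \in W -> w \notin full.
  move=> wW; have [_ anti] := WP w wW; apply/negP => /fullP[_ h].
  by move: (anti p p pS ps (leg_self pS)); rewrite (h p p pS (leg_self pS)).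
have Wleg w b : w \in W -> b \in leg s -> e w b.
  move=> wW bl; have [wc anti] := WP w wW; case: (core_cases wc) => [wf|[t tS [tl _]]].
    by case/negP: (not_full w wW).
  case: (eqVneq t s) => [E|ts]; first by subst t; apply: tl.
  by move: (anti t t tS ts (leg_self tS)); rewrite (tl t (leg_self tS)).
have xW : x \in W.
  rewrite [x \in W]inE xc; apply/forall_inP => t tS; apply/implyP => ts.
  by apply/forall_inP => b; apply: xanti.
have Wa w : w \in W -> e a w.
  move=> wW; have [wc anti] := WP w wW; apply: core_adj => //.
  by apply: contraNneq (not_full w wW) => ->; apply: a_full.
have [c1 [c2 [c3 [K1 K2 K3 P]]]] :=
  legs_pyr_ex sS pS qS sp sq pq (leg_self sS) (leg_self pS) (leg_self qS).
pyr_facts P.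
have lits w : w \in W -> [/\ e a w, e w s, ~~ e w p, ~~ e w q &
    [/\ ~~ e w c1, ~~ e w c2 & ~~ e w c3]].
  move=> wW; have [wc anti] := WP w wW; split; [exact: Wa|exact: Wleg wW (leg_self sS)
    |exact: anti pS ps (leg_self pS)|exact: anti qS qs (leg_self qS)|].
  by rewrite !core_K.
apply: (clique_with_clique_nbhd es ei fr nosimp xW).
  move=> w y /lits[? ? ? ? [? ? ?]] /lits[? ? ? ? [? ? ?]] ?.
  by ref [:: a; s; p; q; c1; c2; c3; w; y].
have nb w y : w \in W -> y \notin W -> e w y -> [\/ y \in full, y \in leg s | y \in branch].
  move=> wW yW wy; have [wc anti] := WP w wW.
  case: (boolP (y \in K)) => yK; first by case/negP: (core_K wc yK).
  case: (boolP (y \in mid)) => ym.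
    case: (mid_leg_branch ym) => [[t tS yl]|]; last by constructor 3.
    case: (eqVneq t s) => [E|ts]; first by subst t; constructor 2.
    by case/negP: (anti t y tS ts yl).
  have yc : y \in core by rewrite [y \in core]inE yK ym.
  case: (core_cases yc) => [|[t tS [yt yanti]]]; first by constructor 1.
  case: (eqVneq t s) => [E|ts].
    subst t; case/negP: yW; rewrite [y \in W]inE yc; apply/forall_inP => t tS'.
    by apply/implyP => ts; apply/forall_inP => b; apply: yanti.
  exfalso; have [r rS /andP[rs rt]] := third s t.
  have [st [sr tr]] : s != t /\ s != r /\ t != r by rewrite eq_sym ts eq_sym rs eq_sym rt.
  have [d1 [d2 [d3 [D1 D2 D3 Q]]]] :=
    legs_pyr_ex sS tS rS st sr tr (leg_self sS) (leg_self tS) (leg_self rS).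
  have [? ?] := (Wa w wW, Wleg w s wW (leg_self sS)).
  have [? ?] := (anti t t tS ts (leg_self tS), anti r r rS rs (leg_self rS)).
  have [? [? ?]] := (yt t (leg_self tS), (yanti s s sS st (leg_self sS), yanti r r rS rt (leg_self rS))).
  have ya : y != a.
    apply: contraNneq (yanti s s sS st (leg_self sS)) => ->; exact: mid_adj (S_mid sS).
  have ? := core_adj yc ya.
  have [? [? ?]] := (core_K yc D1, (core_K yc D2, core_K yc D3)).
  have [? [? ?]] := (core_K wc D1, (core_K wc D2, core_K wc D3)).
  by pyr_facts Q; ref [:: a; s; t; r; d1; d2; d3; w; y].
have cl y z : [\/ y \in full, y \in leg s | y \in branch] ->
    [\/ z \in full, z \in leg s | z \in branch] -> y != z -> e y z.
  move=> [yf|yl|yB] [zf|zl|zB] yz.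
  - exact: full_clique.
  - by case/fullP: yf => _ h; apply: h sS zl.
  - by rewrite es branch_full.
  - by rewrite es; case/fullP: zf => _ h; apply: h sS yl.
  - exact: (leg_clique sS).
  - by rewrite es (branch_leg zB sS yl) fs.
  - exact: branch_full.
  - by rewrite (branch_leg yB sS zl) fs.
  - exact: branch_clique.
move=> w w' y z wW w'W yW zW wy w'z; apply: cl; first exact: nb wW yW wy.
exact: nb w'W zW w'z.
Qed.

Definition rest : {set T} := core :\: full.

(** The only leg such a vertex sees is missed by some f in [branch] according to
    [single_leg_missed]. Hence this leg is that of l, and f witnesses that [side] is nonempty. In
    particular X can be nonempty only in a mansion. *)
Lemma restP x : x \in rest -> [/\ x \in core, forall b, b \in leg l -> e x b,
  forall t b, t \in S -> t != l -> b \in leg t -> ~~ e x b & side != set0].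
Proof.
rewrite in_setD => /andP[nxf xc]; case: (core_cases xc) => [xf|[s sS [xs xanti]]].
  by rewrite xf in nxf.
have [f fB fs] := single_leg_missed xc sS xanti.
have sl : s = l by apply/eqP; apply: contraR fs => /(lmiss fB sS).
subst s; split=> //; apply/set0Pn; exists f; by rewrite [f \in side]inE fB fs.
Qed.

Let t := #|S|.
Let s_ (i : 'I_t) : T := enum_val i.

Lemma s_in i : s_ i \in S. Proof. exact: enum_valP. Qed.

Lemma s_onto s : s \in S -> exists i, s = s_ i.
Proof. by move=> sS; exists (enum_rank_in sS s); rewrite /s_ enum_rankK_in. Qed.

Lemma s_neq i j : i != j -> s_ i != s_ j.
Proof. by apply: contraNneq => /enum_val_inj ->. Qed.

Lemma full_villa_part :
  villa_part e full (fun i => leg (s_ i)) (fun i => foot (s_ i)).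
Proof.
split; first by apply/set0Pn; exists a; apply: a_full.
split; first by move=> i; rewrite leg_neq0 ?foot_neq0 ?s_in.
split; first exact: full_clique.
split; first by move=> i; split; [apply: leg_clique; apply: s_in|apply: foot_clique].
split.
  move=> i; split=> x y /fullP[xc h] yl; first exact: h (s_in i) yl.
  exact: core_K xc (foot_sub yl).
split; last by move=> i; apply: leg_villa_chain; apply: s_in.
move=> i j /s_neq ij; split; last split.
- by move=> x y; apply: leg_anti (s_in i) (s_in j) ij.
- exact: foot_complete (s_in i) (s_in j) ij.
- by move=> x y; apply: foot_anti (s_in i) (s_in j) ij.
Qed.

Lemma core_parts : full :|: rest = core /\ [disjoint full & rest].
Proof.
split; last by rewrite /rest disjoints_subset; apply/subsetP => x xf; rewrite in_setC in_setD xf.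
apply/setP => x; rewrite in_setU in_setD; case: (boolP (x \in full)) => //= xf.
by case/fullP: xf => ->.
Qed.

(** For x in [rest] take f in [side]. If f missed x, then x l c1 and s f r would form a 2P3; if f
    sees x but u does not, u f x l is a 4-hole. *)
Lemma upper_core u x : u \in upper -> x \in core -> e u x.
Proof.
move=> uu xc; have uB := upper_branch uu.
case: (boolP (x \in full)) => xf; first exact: branch_full.
have xr : x \in rest by rewrite in_setD xf.
have [_ xl _ /set0Pn[f fs]] := restP xr; have [fB fl] := (side_branch fs, side_l fs).
have ul := upper_S uu lS; have xll := xl l (leg_self lS).
have uf : u != f by apply: contraNneq fl => <-.
have ? := branch_clique uB fB uf.
have [s [r [sS rS sr sl rl]]] := two_legs l.
have ls : l != s by rewrite eq_sym. have lr : l != r by rewrite eq_sym.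
have [c1 [c2 [c3 [K1 K2 K3 P]]]] :=
  legs_pyr_ex lS sS rS ls lr sr (leg_self lS) (leg_self sS) (leg_self rS).
have ax : e a x.
  by apply: core_adj => //; apply: contraNneq xf => ->; apply: a_full.
have [? ?] := (mid_adj (proj1 (branchP _ uB)), mid_adj (proj1 (branchP _ fB))).
have [? [? ?]] := (upper_S uu sS, (upper_S uu rS, (lmiss fB sS sl, lmiss fB rS rl))).
have [_ _ xa _] := restP xr.
have [? ?] := (xa s s sS sl (leg_self sS), xa r r rS rl (leg_self rS)).
have [? [? ?]] := (core_K xc K1, (core_K xc K2, core_K xc K3)).
have [? ?] := (lmiss fB sS sl, lmiss fB rS rl).
have ? : ~~ e f c1 by pyr_facts P; rewrite (branch_lits fB lS (leg_self lS)).
have ? : e f c2 by pyr_facts P; rewrite (branch_lits fB sS (leg_self sS)).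
have ? : e f c3 by pyr_facts P; rewrite (branch_lits fB rS (leg_self rS)).
by pyr_facts P; ref [:: a; l; s; r; c1; c2; c3; u; f; x].
Qed.

Lemma apartP k : k \in apart -> k \in K /\ forall s b, s \in S -> b \in leg s -> ~~ e b k.
Proof.
rewrite [k \in apart]inE => /andP[kK /forall_inP h]; split=> // s b sS bl.
by apply: contra (h s sS) => bk; apply/footP; split=> //; exists b.
Qed.

Lemma apart_foot k s c : s \in S -> k \in apart -> c \in foot s -> e k c.
Proof.
move=> sS ka cf; have [kK _] := apartP ka; apply: Kcl => //; first exact: foot_sub cf.
apply: contraTneq ka => ->; rewrite [c \in apart]inE negb_and.
by apply/orP; right; apply/forall_inPn; exists s => //; rewrite negbK.
Qed.

(** Otherwise s f r and l c1 k would form a 2P3. *)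
Lemma side_apart f k : f \in side -> k \in apart -> e f k.
Proof.
move=> fs ka; have [fB fl] := (side_branch fs, side_l fs).
have [s [r [sS rS sr sl rl]]] := two_legs l.
have ls : l != s by rewrite eq_sym. have lr : l != r by rewrite eq_sym.
have [c1 [c2 [c3 [K1 K2 K3 P]]]] :=
  legs_pyr_ex lS sS rS ls lr sr (leg_self lS) (leg_self sS) (leg_self rS).
have [kK kn] := apartP ka.
have [? [? ?]] := (kn l l lS (leg_self lS), (kn s s sS (leg_self sS), kn r r rS (leg_self rS))).
have ft u c : u \in S -> c \in K -> e u c -> c \in foot u.
  by move=> uS cK uc; apply/footP; split=> //; exists u => //; apply: leg_self.
have ? := mid_adj (proj1 (branchP _ fB)).
have [? ?] := (lmiss fB sS sl, lmiss fB rS rl).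
have ? := notK kK; pyr_facts P.
have ? : e k c1 by apply: (apart_foot lS ka); apply: ft.
have ? : e k c2 by apply: (apart_foot sS ka); apply: ft.
have ? : e k c3 by apply: (apart_foot rS ka); apply: ft.
have ? : ~~ e f c1 by rewrite (branch_lits fB lS (leg_self lS)).
have ? : e f c2 by rewrite (branch_lits fB sS (leg_self sS)).
by ref [:: a; l; s; r; c1; c2; c3; f; k].
Qed.

(** If [side] is empty, every vertex of [branch] sees all legs and feet. The clique [apart] then has
    only feet and vertices of [branch] as outside neighbours, which form a clique, so it would
    contain a simplicial vertex. *)
Lemma apart_side : apart != set0 -> side != set0.
Proof.
move=> /set0Pn[k ka]; apply/negP => /eqP side0.
have br s f : s \in S -> f \in branch -> e f s.
  move=> sS fB; apply: (@upper_S f s) => //; rewrite [f \in upper]inE fB.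
  by apply/negPn/negP => fl; have := in_set0 f; rewrite -side0 [f \in side]inE fB fl.
have aK x : x \in apart -> x \in K by case/apartP.
apply: (clique_with_clique_nbhd es ei fr nosimp ka).
  by move=> x y /aK xK /aK yK; apply: Kcl.
have nb w y : w \in apart -> y \notin apart -> e w y ->
    (y \in K /\ exists2 s, s \in S & y \in foot s) \/ y \in branch.
  move=> wa yn wy; have [wK wn] := apartP wa.
  case: (boolP (y \in K)) => yK.
    left; split=> //; move: yn; rewrite [y \in apart]inE yK /= => /forall_inPn[s sS].
    by rewrite negbK; exists s.
  case: (boolP (y \in mid)) => ym.
    case: (mid_leg_branch ym) => [[s sS yl]|]; last by right.
    by move: (wn s y sS yl); rewrite es wy.
  have yc : y \in core by rewrite [y \in core]inE yK ym.
  by move: (core_K yc wK); rewrite es wy.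
have cl y z : (y \in K /\ exists2 s, s \in S & y \in foot s) -> z \in branch -> e y z.
  by move=> [yK [s sS yf]] zB; rewrite es (branch_foot zB sS yf) br.
move=> w w' y z wa w'a yn zn wy w'z yz.
case: (nb w y wa yn wy) => yy; case: (nb w' z w'a zn w'z) => zz.
- by case: yy => yK _; case: zz => zK _; apply: Kcl.
- exact: cl.
- by rewrite es; apply: cl.
- exact: branch_clique.
Qed.

Lemma upper_apart u k : u \in upper -> k \in apart -> e u k.
Proof.
move=> uu ka; have uB := upper_branch uu.
have /set0Pn[f fs] : side != set0 by apply: apart_side; apply/set0Pn; exists k.
have [fB fl] := (side_branch fs, side_l fs).
have [c cK lc] := leg_foot (leg_self lS).
have cf : c \in foot l by apply/footP; split=> //; exists l => //; apply: leg_self.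
have kc := apart_foot lS ka cf; have fk := side_apart fs ka.
have uf : u != f by apply: contraNneq fl => <-; apply: upper_S.
have uuf := branch_clique uB fB uf.
have uc : e u c by rewrite (branch_foot uB lS cf) upper_S.
have fc : ~~ e f c by rewrite (branch_foot fB lS cf).
have [kK _] := apartP ka; have uk : u != k.
  by apply: contraTneq kK => <-; apply/negP => /notK; rewrite mid_adj //; case/branchP: uB.
have ? : f != c by apply: contraNneq fl => ->; rewrite es.
by ref [:: u; f; k; c].
Qed.

Lemma villa_finished : side = set0 -> finished.
Proof.
move=> side0.
have ap0 : apart = set0 by apply/eqP/negPn/negP => /apart_side; rewrite side0 eqxx.
have rest0 : rest = set0.
  by apply/eqP/negPn/negP => /set0Pn[x /restP[_ _ _]]; rewrite side0 eqxx.
have [AX dAX] := core_parts.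
exists (~: upper); rewrite setCK; split; last first.
  split; first exact: upper_clique.
  apply: upper_complete => u x uu; first exact: upper_core.
  exact: upper_apart.
right; left; exists t; split=> //.
exists full, (fun i => leg (s_ i)), (fun i => foot (s_ i)).
split; last exact: full_villa_part.
apply: partition_of_pairwise.
  apply: subseq_pairwise (parts_disjoint (@enum_val_inj _ _) s_in AX dAX).
  exact: (cat_subseq (prefix_subseq [:: full] [:: side; rest; apart]) (subseq_refl _)).
move=> x; rewrite (parts_cover s_in s_onto AX) /parts side0 rest0 ap0 /=.
by rewrite !in_set0.
Qed.

Lemma mansion_finished : side != set0 -> finished.
Proof.
move=> side0; have [AX dAX] := core_parts; have [j lj] := s_onto lS.
exists (~: upper); rewrite setCK; split; last first.
  split; first exact: upper_clique.
  apply: upper_complete => u x uu; first exact: upper_core.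
  exact: upper_apart.
right; right; exists t; split=> //.
exists full, side, rest, apart, (fun i => leg (s_ i)), (fun i => foot (s_ i)), j.
have sl i : i != j -> s_ i != l by rewrite lj; apply: s_neq.
have [f0 f0s] := set0Pn _ side0; have [f0B f0l] := (side_branch f0s, side_l f0s).
have [s [r [sS rS sr ssl rl]]] := two_legs l.
have ls : l != s by rewrite eq_sym. have lr : l != r by rewrite eq_sym.
have rest_side f x : f \in side -> x \in rest -> e f x.
  move=> fs xr; have [xc xl xa _] := restP xr; have fB := side_branch fs.
  have [c1 [c2 [c3 [K1 K2 K3 P]]]] :=
    legs_pyr_ex lS sS rS ls lr sr (leg_self lS) (leg_self sS) (leg_self rS).
  have ? := xl l (leg_self lS); have fl := side_l fs.
  have [? ?] := (xa s s sS ssl (leg_self sS), xa r r rS rl (leg_self rS)).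
  have ax : e a x.
    by apply: core_adj => //; apply: contraNneq (xa s s sS ssl (leg_self sS)) => ->; apply: mid_adj (S_mid sS).
  have ? := mid_adj (proj1 (branchP _ fB)).
  have [? [? ?]] := (core_K xc K1, (core_K xc K2, core_K xc K3)).
  have [? ?] := (lmiss fB sS ssl, lmiss fB rS rl).
  pyr_facts P.
  have ? : ~~ e f c1 by rewrite (branch_lits fB lS (leg_self lS)).
  have ? : e f c2 by rewrite (branch_lits fB sS (leg_self sS)).
  have ? : e f c3 by rewrite (branch_lits fB rS (leg_self rS)).
  by ref [:: a; l; s; r; c1; c2; c3; f; x].
have rest_l x y : x \in rest -> y != x -> y \in core -> e f0 y -> e y l -> e x y.
  move=> xr yx yc f0y yl; have [xc xl _ _] := restP xr.
  have [? ?] := (xl l (leg_self lS), rest_side f0 x f0s xr).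
  have ? : f0 != l by apply: contraTneq (lmiss f0B sS ssl) => ->; apply: Sstable.
  by ref [:: x; y; f0; l].
have rc x : x \in rest -> x \in core by case/restP.
split; first exact: partition_of_pairwise (parts_disjoint (@enum_val_inj _ _) s_in AX dAX)
  (parts_cover s_in s_onto AX).
split; first exact: full_villa_part.
split=> //; split; first exact: side_clique.
split.
  move=> x y xr yr xy; rewrite eq_sym in xy; have [_ h _ _] := restP yr.
  exact: rest_l xr xy (rc _ yr) (rest_side _ _ f0s yr) (h _ (leg_self lS)).
split; first by move=> x y /apartP[xK _] /apartP[yK _]; apply: Kcl.
split; first by move=> f x /side_branch fB; apply: branch_full.
split.
  move=> i /sl il; split=> f x fs xl; have fB := side_branch fs;
    have fi := lmiss fB (s_in i) il; case: (branch_leg_foot fB (s_in i) fi) => h1 h2;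
    [exact: h1|exact: h2].
split; first by rewrite -lj; apply: side_anti.
split.
  (* A missing edge b c would give the 2P3 formed by b b' c and s f0 r. *)
  rewrite -lj => b c bl /footP[cK [b' b'l b'c]]; apply/negPn/negP => nbc.
  have bb' : e b b' by apply: (leg_clique lS) => //; apply: contraNneq nbc => ->.
  have [? [? ?]] := (lmiss f0B sS ssl, (lmiss f0B rS rl, Sstable sS rS)).
  have [? ?] := (leg_anti lS sS ls bl (leg_self sS), leg_anti lS rS lr bl (leg_self rS)).
  have [? ?] := (leg_anti lS sS ls b'l (leg_self sS), leg_anti lS rS lr b'l (leg_self rS)).
  have cf : c \in foot l by apply/footP; split=> //; exists b'.
  have [? ?] : ~~ e f0 b /\ ~~ e f0 b'.
    by split; apply: (side_anti f0s); rewrite in_setU ?bl ?b'l.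
  have ? : ~~ e f0 c by apply: (side_anti f0s); rewrite in_setU cf orbT.
  have [sS' rS'] := (leg_self sS, leg_self rS).
  have ? := foot_anti sS lS ssl sS' cf; have ? := foot_anti rS lS rl rS' cf.
  have [? ?] := (mid_adj (leg_mid bl), notK cK).
  by ref [:: a; s; f0; r; b; b'; c].
split.
  rewrite -lj => x y xr; rewrite in_setU => /orP[yf|]; last by case/restP: xr => _ h _ _; apply: h.
  apply: rest_l => //; last first.
  - by case/fullP: yf => _ h; apply: h lS (leg_self lS).
  - exact: branch_full.
  - by case/fullP: yf.
  - by apply: contraTneq xr => <-; rewrite in_setD yf.
split.
  by move=> i /sl il x y /restP[_ _ h _] yl; apply: h (s_in i) il yl.
split; first by move=> i x y /rc xc /foot_sub; apply: core_K.
split.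
  move=> f x fs; rewrite in_setU => /orP[xr|xa]; first exact: rest_side.
  exact: side_apart.
split; first by move=> x y /rc xc /apartP[yK _]; apply: core_K.
split; last by move=> x y /apartP[xK _] /fullP[yc _]; rewrite es; apply: core_K.
move=> i; split=> x y xa; first exact: apart_foot (s_in i) xa.
by move=> yl; rewrite es; case/apartP: xa => _ h; apply: h (s_in i) yl.
Qed.

End Structure.

(** * Condition (a) implies condition (c) *)

Section Pyramid.
Variables (T : finType) (e : rel T) (es : symmetric e) (ei : irreflexive e).
Hypothesis fr : free_pats e base_pats.
Hypothesis nosimp : forall v, ~ simplicial e v.

Lemma max_stable (M S0 : {set T}) : S0 \subset M ->
  (forall s t, s \in S0 -> t \in S0 -> ~~ e s t) ->
  exists S : {set T}, [/\ #|S0| <= #|S|, S \subset M,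
    forall s t, s \in S -> t \in S -> ~~ e s t &
    forall m, m \in M -> m \notin S -> exists2 s, s \in S & e m s].
Proof.
pose st (S : {set T}) := [forall s in S, forall t in S, ~~ e s t].
have stP (S : {set T}) : reflect (forall s t, s \in S -> t \in S -> ~~ e s t) (st S).
  apply: (iffP forall_inP) => [h s t sS tS|h s sS].
    by move/forall_inP/(_ t tS): (h s sS).
  by apply/forall_inP => t; apply: h.
move=> S0M /stP st0; pose P (S : {set T}) := (S \subset M) && st S.
have P0 : P S0 by rewrite /P S0M.
case: (arg_maxnP (fun S : {set T} => #|S|) P0) => S /andP[SM /stP stS] mx.
exists S; split=> //; first exact: mx.
move=> m mM mS; apply/exists_inP; apply: contraT => no.
have : P (m |: S).
  rewrite /P subUset sub1set mM SM /=; apply/stP => s t.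
  have nm u : u \in S -> ~~ e m u.
    by move=> uS; apply: contra no => mu; apply/exists_inP; exists u.
  rewrite !in_setU1 => /orP[/eqP->|sS] /orP[/eqP->|tS]; last exact: stS.
  - by rewrite ei.
  - exact: nm.
  - by rewrite es nm.
by move/mx; rewrite cardsU1 mS add1n /geq /= ltnn.
Qed.

Lemma pyramid_structure a0 p1 p2 p3 q1 q2 q3 : pyr e a0 p1 p2 p3 q1 q2 q3 ->
  finished e.
Proof.
move=> P0.
pose has_pyr a := [exists b1, exists b2, exists b3, exists c1, exists c2, exists c3,
  pyr e a b1 b2 b3 c1 c2 c3].
have hasP' a b1 b2 b3 c1 c2 c3 : pyr e a b1 b2 b3 c1 c2 c3 -> has_pyr a.
  move=> P; apply/existsP; exists b1; apply/existsP; exists b2; apply/existsP; exists b3.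
  by apply/existsP; exists c1; apply/existsP; exists c2; apply/existsP; exists c3.
case: (arg_minnP (fun a => #|nn e a|) (hasP' _ _ _ _ _ _ _ P0)) => a pa mn.
have {}mn : apex_minimal e a by move=> a' b1 b2 b3 c1 c2 c3 /hasP'/mn.
move: pa => /existsP[b1 /existsP[b2 /existsP[b3 /existsP[c1 /existsP[c2 /existsP[c3 P]]]]]].
have Kcl := nn_apex_clique es ei fr nosimp P mn.
pyr_facts P.
have mid_of b b' c : e a b' -> ~~ e b' c -> e a b -> e b c -> ~~ e a c -> b \in mid e a.
  move=> ab' nb'c ab bc ac; apply/midP; split=> //; exists c => //; apply/nnP; split=> //.
  by apply: contraNneq nb'c => ->; rewrite es.
have S0M : [set b1; b2; b3] \subset mid e a.
  rewrite !subUset !sub1set.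
  by apply/andP; split; [apply/andP; split|];
    [apply: (mid_of b1 b2 c1)|apply: (mid_of b2 b1 c2)|apply: (mid_of b3 b1 c3)].
have st0 s t : s \in [set b1; b2; b3] -> t \in [set b1; b2; b3] -> ~~ e s t.
  by rewrite !inE => /orP[/orP[]|] /eqP-> /orP[/orP[]|] /eqP->; rewrite ?ei // es.
have [S [S0 Smid Sst Smax]] := max_stable S0M st0.
have S3 : 2 < #|S|.
  apply: leq_trans S0; rewrite cardsU cards2 cards1.
  have n12 : b1 != b2 by apply: contraTneq (_ : e b1 c1) => // ->.
  have n13 : b1 != b3 by apply: contraTneq (_ : e b1 c1) => // ->.
  have n23 : b2 != b3 by apply: contraTneq (_ : e b2 c2) => // ->.
  rewrite n12 (_ : _ :&: _ = set0) ?cards0 //.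
  by apply/setP => x; rewrite !inE; case: (eqVneq x b3) => [->|]; rewrite ?andbF //
    eq_sym (negbTE n13) eq_sym (negbTE n23).
have [l lS lmiss] := branch_missed_leg es ei fr Kcl Smid Sst S3.
case: (boolP [exists z in core e a, exists s1 in S, exists s2 in S, exists s3 in S,
    exists x1 in leg e a S s1, exists x2 in leg e a S s2, exists x3 in leg e a S s3,
    [&& [&& s1 != s2, s1 != s3 & s2 != s3], e z x1, e z x2 & ~~ e z x3]]).
  case/exists_inP=> z zc /exists_inP[s1 S1 /exists_inP[s2 S2 /exists_inP[s3 S'3]]].
  case/exists_inP=> x1 l1 /exists_inP[x2 l2 /exists_inP[x3 l3]].
  move=> /and4P[/and3P[? ? ?] ? ? ?].
  have Z : two_of_three e a S z s1 s2 s3 x1 x2 x3 by split.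
  exact: (two_of_three_basket es ei fr nosimp Kcl Smid Sst Smax S3 lS lmiss Z).
move=> no.
have nt z s1 s2 s3 x1 x2 x3 : ~ two_of_three e a S z s1 s2 s3 x1 x2 x3.
  case=> zc [S1 S2 S'3] [n12 n13 n23] [l1 l2 l3] [z1 z2 z3]; case/negP: no.
  apply/exists_inP; exists z => //; apply/exists_inP; exists s1 => //.
  apply/exists_inP; exists s2 => //; apply/exists_inP; exists s3 => //.
  apply/exists_inP; exists x1 => //; apply/exists_inP; exists x2 => //.
  by apply/exists_inP; exists x3 => //; apply/and4P; split=> //; apply/and3P.
case: (eqVneq (side e a S l) set0) => [s0|s0].
  exact: (villa_finished es ei fr nosimp Kcl Smid Sst Smax S3 lS lmiss nt s0).
exact: (mansion_finished es ei fr nosimp Kcl Smid Sst Smax S3 lS lmiss nt s0).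
Qed.

End Pyramid.

Lemma cond_a_c (T : finType) (e : rel T) : symmetric e -> irreflexive e ->
  0 < #|T| -> cond_a e -> cond_c e.
Proof.
move=> es ei /card_gt0P[v0 _] [h1 [h2 [h3 [h4 [h5 ns]]]]].
have fr := base_free_pats es ei h1 h2 h3 h4 h5.
case: (boolP [exists a, exists b1, exists b2, exists b3, exists c1, exists c2, exists c3,
  pyr e a b1 b2 b3 c1 c2 c3]).
  case/existsP=> a /existsP[b1 /existsP[b2 /existsP[b3]]].
  case/existsP=> c1 /existsP[c2 /existsP[c3 P]].
  have [Q [sp h]] := pyramid_structure es ei fr ns P; exists Q; split=> //.
  by case: sp => [|[|]]; rewrite /special; tauto.
move=> no.
have npyr : ~ induced_sub e pyramid.
  case=> f [fi fe]; case/negP: no.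
  pose o k (h : k < 7) := f (Ordinal h).
  have E i j (hi : i < 7) (hj : j < 7) : e (o i hi) (o j hj) = edge_in pyramid_edges (Ordinal hi) (Ordinal hj) by rewrite fe.
  apply/existsP; exists (o 0 isT); apply/existsP; exists (o 1 isT).
  apply/existsP; exists (o 2 isT); apply/existsP; exists (o 3 isT).
  apply/existsP; exists (o 4 isT); apply/existsP; exists (o 5 isT).
  by apply/existsP; exists (o 6 isT); rewrite /pyr !E.
have frp : free_pats e (base_pats ++ pyramid_pats).
  by apply: cat_free_pats => //; apply: pyramid_free_pats.
have [Q [cr h]] := pyramid_free_crown v0 es ei frp ns.
by exists Q; split=> //; rewrite /special; tauto.
Qed.

(** * Copies of small graphs in blow-ups *)

(* A blow-up is described by classes labelled by a kind and an index.  The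
   value [c k k' b] is the adjacency between distinct vertices of kinds [k] and
   [k'], where [b] tells whether the two indices agree; [None] means that the
   adjacency is not prescribed.  Vertices with the same label are required to
   have comparable neighbourhoods. *)
Section TemplateSearch.
Variables (kinds : seq nat) (single : nat -> bool)
  (c : nat -> nat -> bool -> option bool) (n : nat) (h : nat -> nat -> bool).

Definition comparable i j :=
  lall (fun p => lall (fun q =>
    if (p != j) && (q != i) && h i p && h j q then h i q || h j p else true)
    (iota 0 n)) (iota 0 n).

Definition label_fits (lam : seq (nat * nat)) (l : nat * nat) :=
  let i := size lam in
  lall (fun j => let l' := nth (0, 0) lam j in
    if (if c l.1 l'.1 (l.2 == l'.2) is Some b then b == h i j else true) then
      if (l.1 == l'.1) && (l.2 == l'.2) then comparable i j else true
    else false) (iota 0 i).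

(** Only the equality pattern of the indices matters, so the vertex about to be labelled needs no
    index beyond the number of earlier vertices plus one. A kind with a single class always takes
    index 0. *)
Fixpoint labelling (m : nat) (lam : seq (nat * nat)) : bool :=
  if m is m'.+1 then
    lhas (fun k => lhas (fun d =>
      if label_fits lam (k, d) then labelling m' (rcons lam (k, d)) else false)
      (if single k then [:: 0] else iota 1 (size lam).+1)) kinds
  else true.

End TemplateSearch.

Section Template.
Variables (T : finType) (e : rel T) (es : symmetric e) (ei : irreflexive e).
Variables (kinds : seq nat) (single : nat -> bool)
  (c : nat -> nat -> bool -> option bool) (cls : nat -> nat -> {set T}).
Hypothesis c_single : forall k k' b b', k \in kinds -> k' \in kinds ->
  single k || single k' -> c k k' b = c k k' b'.
Hypothesis c_adj : forall k k' i i' x y b, k \in kinds -> k' \in kinds -> k <= k' ->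
  x \in cls k i -> y \in cls k' i' -> x != y -> c k k' (i == i') = Some b -> e x y = b.
Hypothesis c_sym : forall k k' b, k \in kinds -> k' \in kinds -> c k k' b = c k' k b.
Hypothesis c_nested : forall k i p ip q iq x y u w, k \in kinds -> p \in kinds -> q \in kinds ->
  c k p (i == ip) = None -> c k q (i == iq) = None ->
  x \in cls k i -> y \in cls k i -> u \in cls p ip -> w \in cls q iq ->
  e x u -> e y w -> e x w || e y u.

(** The copy inherits a labelling from the classes containing its vertices. Although the number of
    classes of the blow-up is unbounded, renaming the indices brings this labelling into the finite
    range of the search. *)
Lemma no_labelling_no_copy n (h : nat -> nat -> bool) (g : nat -> T) :
  (forall i j, i < n -> j < n -> i != j -> g i != g j) ->
  (forall i j, i < n -> j < n -> e (g i) (g j) = h i j) ->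
  (forall i, i < n -> exists k d, [/\ k \in kinds, g i \in cls k d & single k -> d = 0]) ->
  labelling kinds single c n h n [::].
Proof.
move=> g_inj g_adj g_cov.
have [lab labP] : exists lab : 'I_n -> nat * nat, forall i : 'I_n,
    [/\ (lab i).1 \in kinds, g i \in cls (lab i).1 (lab i).2 &
        single (lab i).1 -> (lab i).2 = 0].
  apply: (@fin_all_exists _ (fun=> (nat * nat)%type) (fun (i : 'I_n) l =>
    [/\ l.1 \in kinds, g i \in cls l.1 l.2 & single l.1 -> l.2 = 0])) => i.
  by have [k [d kd]] := g_cov i (ltn_ord i); exists (k, d).
pose ids := [seq (lab i).2 | i <- enum 'I_n].
(* An index is renamed to one plus the position of the first vertex carrying it; [flag] records that
   the values of [c] do not notice. *)
pose can (i : 'I_n) : nat * nat := ((lab i).1,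
  if single (lab i).1 then 0 else (index (lab i).2 ids).+1).
have c_adj' k k' i i' x y b : k \in kinds -> k' \in kinds -> x \in cls k i ->
    y \in cls k' i' -> x != y -> c k k' (i == i') = Some b -> e x y = b.
  move=> kk kk' xk yk' xy cb; case: (leqP k k') => le; first exact: c_adj cb.
  rewrite es; apply: (c_adj kk' kk (ltnW le) yk' xk); first by rewrite eq_sym.
  by rewrite c_sym // eq_sym.
have flag (i j : 'I_n) : c (can i).1 (can j).1 ((can i).2 == (can j).2) =
    c (lab i).1 (lab j).1 ((lab i).2 == (lab j).2).
  rewrite /can /=; case: (boolP (single (lab i).1 || single (lab j).1)) => sg.
    by apply: c_single sg; [case: (labP i)|case: (labP j)].
  move: sg; rewrite negb_or => /andP[/negbTE-> /negbTE->]; congr c.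
  have inid (i' : 'I_n) : (lab i').2 \in ids by apply: map_f; rewrite mem_enum.
  rewrite eqSS; apply/eqP/eqP => [E|-> //].
  by rewrite -(nth_index 0 (inid i)) E nth_index.
pose L := [seq can i | i <- enum 'I_n].
have szL : size L = n by rewrite size_map size_enum_ord.
have nthL (i : 'I_n) : nth (0, 0) L i = can i.
  by rewrite (nth_map i) ?size_enum_ord // nth_ord_enum.
suff main m : m <= n -> labelling kinds single c n h m (take (n - m) L).
  by have := main n (leqnn n); rewrite subnn take0.
elim: m => [//|m IH] mn.
have lt : n - m.+1 < n by rewrite ltn_subrL (leq_trans _ mn).
pose i := Ordinal lt.
have szt : size (take (n - m.+1) L) = n - m.+1 by rewrite size_takel // szL ltnW.
rewrite /= lhasE; apply/hasP; exists (can i).1; first by case: (labP i).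
rewrite lhasE; apply/hasP; exists (can i).2.
  rewrite szt -[(can i).2]/(if single (lab i).1 then 0 else (index (lab i).2 ids).+1).
  rewrite -[(can i).1]/((lab i).1); case: (single _) => //.
  rewrite -[1 :: _]/(iota 1 (n - m.+1).+1) mem_iota add1n !ltnS /=.
  rewrite leqNgt; apply/negP => lt'.
  have := @before_find _ 0 (pred1 (lab i).2) ids (val i).
  rewrite -/(index _ _) => /(_ lt') /=.
  by rewrite (nth_map i) ?size_enum_ord // (nth_ord_enum i i) eqxx.
rewrite -surjective_pairing.
have -> : rcons (take (n - m.+1) L) (can i) = take (n - m) L.
  rewrite -nthL /= -take_nth ?szL //; congr take.
  by rewrite -subSn.
rewrite (IH (ltnW mn)) (_ : label_fits _ _ _ _ _ = true) //.
rewrite /label_fits lallE; apply/allP => j; rewrite szt mem_iota add0n => /= ji.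
have jn : j < n by apply: ltn_trans ji lt.
rewrite nth_take // (nthL (Ordinal jn)); set j' := Ordinal jn.
have ij : i != j' by rewrite -val_eqE /= neq_ltn ji orbT.
have gij : g i != g j by apply: g_inj => //; rewrite neq_ltn ji orbT.
have [[ki gi di] [kj gj dj]] := (labP i, labP j').
have -> : (if c (can i).1 (can j').1 ((can i).2 == (can j').2) is Some b then b == h i j
           else true) = true.
  rewrite flag; case E : (c _ _ _) => [b|] //=.
  by rewrite -(c_adj' _ _ _ _ _ _ _ ki kj gi gj gij E) (g_adj _ _ lt jn) eqxx.
case: ifP => // /andP[/eqP k_eq /eqP d_eq].
have {k_eq d_eq} labE : lab i = lab j'.
  move: k_eq d_eq; rewrite /can /= => k_eq d_eq.
  apply/eqP; rewrite -pair_eqE /= /pair_eq k_eq eqxx /=.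
  move: d_eq; rewrite k_eq; case: ifP => [sg _|_ [E]]; first by rewrite di ?k_eq ?dj.
  have inid (i' : 'I_n) : (lab i').2 \in ids by apply: map_f; rewrite mem_enum.
  by rewrite -(nth_index 0 (inid i)) E nth_index.
rewrite -labE in gj; rewrite /comparable lallE; apply/allP => p; rewrite mem_iota => /= pn.
rewrite lallE; apply/allP => q; rewrite mem_iota => /= qn.
case: ifP => // /andP[/andP[/andP[pj qi'] hip] hjq]; rewrite add0n in pn qn.
pose p' := Ordinal pn; pose q' := Ordinal qn.
have [[kp gp _] [kq gq _]] := (labP p', labP q').
have irr i' : i' < n -> h i' i' = false by move=> i'n; rewrite -g_adj ?ei.
have ip : val i != p by apply: contraTneq hip => <-; rewrite irr.
have jq : j != q by apply: contraTneq hjq => <-; rewrite irr.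
rewrite -!g_adj // in hip hjq *.
(* If the adjacency of i to p is prescribed, then j, having the same label, is adjacent to p too;
   the same holds with q. Nestedness is needed only when neither is prescribed. *)
case Ep : (c (lab i).1 (lab p').1 ((lab i).2 == (lab p').2)) => [b|].
  have E1 := c_adj' _ _ _ _ _ _ _ ki kp gi gp (g_inj _ _ lt pn ip) Ep.
  rewrite eq_sym in pj.
  have E2 := c_adj' _ _ _ _ _ _ _ ki kp gj gp (g_inj _ _ jn pn pj) Ep.
  by rewrite E2 -E1 hip orbT.
case Eq : (c (lab i).1 (lab q').1 ((lab i).2 == (lab q').2)) => [b|].
  rewrite eq_sym in qi'.
  have E1 := c_adj' _ _ _ _ _ _ _ ki kq gj gq (g_inj _ _ jn qn jq) Eq.
  have E2 := c_adj' _ _ _ _ _ _ _ ki kq gi gq (g_inj _ _ lt qn qi') Eq.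
  by rewrite E2 -E1 hjq.
exact: (c_nested ki kp kq Ep Eq gi gj gp gq hip hjq).
Qed.

End Template.

Definition pattern := (nat * (nat -> nat -> bool))%type.
Definition nat_cycle k : pattern := (k, fun i j => (j == i.+1 %% k) || (i == j.+1 %% k)).
Definition nat_edges k (l : seq (nat * nat)) : pattern :=
  (k, fun i j => ((i, j) \in l) || ((j, i) \in l)).
Definition the_patterns : seq pattern :=
  [:: nat_edges 6 [:: (0,1); (1,2); (3,4); (4,5)]; nat_cycle 4; nat_cycle 6;
      nat_cycle 7; nat_edges 9 [:: (0,1); (0,2); (0,4); (0,5); (1,3); (1,4); (1,5);
                (2,6); (3,6); (4,7); (5,8); (6,7); (6,8); (7,8)]].
Definition avoids kinds single c :=
  all (fun p : pattern => ~~ labelling kinds single c p.1 p.2 p.1 [::]) the_patterns.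

Section FreeOfTemplate.
Variables (T : finType) (e : rel T) (es : symmetric e) (ei : irreflexive e).
Variables (Q : {set T}) (UQ : clique e (~: Q)) (UcQ : complete e (~: Q) Q).

(** A vertex outside [Q] is universal, whereas in the pattern every vertex has a nonneighbour. Hence
    added universal vertices cannot take part in a copy. *)
Lemma copy_inside n (h : rel 'I_n) (f : 'I_n -> T) : injective f ->
  (forall i j, e (f i) (f j) = h i j) ->
  [forall i, exists j, (j != i) && ~~ h i j] -> forall i, f i \in Q.
Proof.
move=> fi fe /forallP nu i; have /existsP[j /andP[ji]] := nu i.
rewrite -fe; apply: contraR => fiQ.
case: (boolP (f j \in Q)) => fjQ; first by apply: UcQ; rewrite ?in_setC.
by apply: UQ; rewrite ?in_setC //; apply: contra_neq ji => /fi.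
Qed.

Variables (kinds : seq nat) (single : nat -> bool)
  (c : nat -> nat -> bool -> option bool) (cls : nat -> nat -> {set T}).
Hypothesis c_single : forall k k' b b', k \in kinds -> k' \in kinds ->
  single k || single k' -> c k k' b = c k k' b'.
Hypothesis c_adj : forall k k' i i' x y b, k \in kinds -> k' \in kinds -> k <= k' ->
  x \in cls k i -> y \in cls k' i' -> x != y -> c k k' (i == i') = Some b -> e x y = b.
Hypothesis c_sym : forall k k' b, k \in kinds -> k' \in kinds -> c k k' b = c k' k b.
Hypothesis c_nested : forall k i p ip q iq x y u w, k \in kinds -> p \in kinds -> q \in kinds ->
  c k p (i == ip) = None -> c k q (i == iq) = None ->
  x \in cls k i -> y \in cls k i -> u \in cls p ip -> w \in cls q iq ->
  e x u -> e y w -> e x w || e y u.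
Hypothesis cover : forall x, x \in Q -> exists k d,
  [/\ k \in kinds, x \in cls k d & single k -> d = 0].
Hypothesis av : avoids kinds single c.

Lemma pattern_free n (hN : nat -> nat -> bool) (h : rel 'I_n) :
  (forall i j, h i j = hN (val i) (val j)) ->
  [forall i, exists j, (j != i) && ~~ h i j] ->
  ~~ labelling kinds single c n hN n [::] -> ~ induced_sub e h.
Proof.
move=> hE nu /negP nl [f [fi fe]]; apply: nl.
have fQ := copy_inside fi fe nu.
case: n h hE nu f fi fe fQ => [//|n] h hE nu f fi fe fQ.
apply: (no_labelling_no_copy es ei c_single c_adj c_sym c_nested (g := fun i => f (inord i))).
- move=> i j ii jj; apply: contra_neq => /fi /(congr1 val).
  by rewrite /= !inordK.
- by move=> i j ii jj; rewrite fe hE /= !inordK.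
- by move=> i ii; apply: cover.
Qed.

Lemma template_free :
  [/\ ~ induced_sub e twoP3, ~ induced_sub e (@cycle_graph 4),
      ~ induced_sub e (@cycle_graph 6), ~ induced_sub e (@cycle_graph 7) &
      ~ induced_sub e T0].
Proof.
case/and5P: av => a1 a2 a3 a4 /andP[a5 _].
split.
- by apply: (pattern_free _ _ a1) => //; apply/forallP; case=> -[|[|[|[|[|[|//]]]]]] ?;
    apply/existsP; first [by exists (@Ordinal 6 2 isT)|by exists (@Ordinal 6 3 isT)].
- by apply: (pattern_free _ _ a2) => //; apply/forallP; case=> -[|[|[|[|//]]]] ?;
    apply/existsP; first [by exists (@Ordinal 4 2 isT)|by exists (@Ordinal 4 3 isT)
     |by exists (@Ordinal 4 0 isT)|by exists (@Ordinal 4 1 isT)].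
- by apply: (pattern_free _ _ a3) => //; apply/forallP; case=> -[|[|[|[|[|[|//]]]]]] ?;
    apply/existsP; first [by exists (@Ordinal 6 2 isT)|by exists (@Ordinal 6 5 isT)].
- by apply: (pattern_free _ _ a4) => //; apply/forallP; case=> -[|[|[|[|[|[|[|//]]]]]]] ?;
    apply/existsP; first [by exists (@Ordinal 7 2 isT)|by exists (@Ordinal 7 5 isT)].
- by apply: (pattern_free _ _ a5) => //; apply/forallP;
    case=> -[|[|[|[|[|[|[|[|[|//]]]]]]]]] ?;
    apply/existsP; first [by exists (@Ordinal 9 6 isT)|by exists (@Ordinal 9 0 isT)|by exists (@Ordinal 9 7 isT)].
Qed.

End FreeOfTemplate.

(** Kinds 0, 1, 2 are A, B_i, C_i. The unprescribed adjacency is that between B_i and C_i with the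
    same index; the use of [minn] and [maxn] makes the table symmetric. *)
Definition villa_c k k' (b : bool) : option bool :=
  match minn k k', maxn k k' with
  | 0, 0 => Some true | 0, 1 => Some true | 0, 2 => Some false
  | 1, 1 => Some b | 1, 2 => if b then None else Some false
  | 2, 2 => Some true | _, _ => None
  end.
(* Kinds: 0 is A, 1 and 2 are the B_i and C_i for i <> j*, 3 is F, 4 is X,
   5 is Y, 6 and 7 are B_j* and C_j*. *)
Definition mansion_c k k' (b : bool) : option bool :=
  match minn k k', maxn k k' with
  | 0, (0|1|3|4|6) => Some true | 0, _ => Some false
  | 1, 1 => Some b | 1, 2 => if b then None else Some false
  | 1, 3 => Some true | 1, _ => Some false
  | 2, (2|3|5|7) => Some true | 2, _ => Some false
  | 3, (3|4|5) => Some true | 3, _ => Some false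
  | 4, (4|6) => Some true | 4, _ => Some false
  | 5, (5|7) => Some true | 5, _ => Some false
  | 6, _ => Some true | 7, 7 => Some true | _, _ => None
  end.
(* Kinds: 0 is A, 1 is F, 2 + i is B_i and 5 + i is C_i. *)
Definition basket_c (i0 j0 k k' : nat) (b : bool) : option bool :=
  let m := minn k k' in let M := maxn k k' in
  if m == 0 then
    if M < 2 then Some true else
    if M < 5 then (if M - 2 == i0 then None else Some true) else Some false
  else if m == 1 then
    if M < 2 then Some true else
    if M < 5 then Some (M - 2 != j0) else Some (M - 5 != j0)
  else if M < 5 then Some (m == M)
  else if m < 5 then Some (m + 3 == M) else Some true.
(** The test [far i] singles out the consecutive pairs (i, i + 1) with i equal to i0 + 1 or i0 + 3
    modulo 5, which are the two pairs required to be complete in a crown. *)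
Definition crown_c (i0 k k' : nat) (b : bool) : option bool :=
  let far i := (i + 5 - i0) %% 5 \in [:: 1; 3] in
  match (k' + 5 - k) %% 5 with
  | 0 => Some true
  | 1 => if far k then Some true else None
  | 4 => if far k' then Some true else None
  | _ => Some false
  end.

Lemma villa_avoids : avoids [:: 0; 1; 2] (fun k => k == 0) villa_c.
Proof. by vm_compute. Qed.
Lemma mansion_avoids : avoids (iota 0 8) (fun k => (k != 1) && (k != 2)) mansion_c.
Proof. by vm_compute. Qed.
Lemma basket_avoids i0 j0 : i0 < 3 -> j0 < 3 -> avoids (iota 0 8) xpredT (basket_c i0 j0).
Proof.
by case: i0 => [|[|[|//]]] _; case: j0 => [|[|[|//]]] _; vm_compute.
Qed.
Lemma crown_avoids i0 : i0 < 5 -> avoids (iota 0 5) xpredT (crown_c i0).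
Proof. by case: i0 => [|[|[|[|[|//]]]]] _; vm_compute. Qed.

(** * The four structures are template blow-ups *)

Section Chains.
Variables (I : eqType) (r : rel I) (rr : reflexive r) (rt : transitive r).

Lemma chain_head b l x : sorted r (b :: l) -> x \in b :: l -> r b x.
Proof.
move=> /= p; rewrite inE => /orP[/eqP-> //|xl].
by have /allP := order_path_min rt p; apply.
Qed.

Lemma chain_last b l x : sorted r (b :: l) -> x \in b :: l -> r x (last b l).
Proof.
elim: l b => [|c l IH] b; first by rewrite inE => _ /eqP->.
move=> p; rewrite inE => /orP[/eqP->|]; first exact: chain_head p (mem_last _ _).
by apply: IH; case/andP: p.
Qed.

Lemma chain_total s x y : sorted r s -> x \in s -> y \in s -> r x y || r y x.
Proof.
elim: s => [//|c s IH] p; rewrite !inE => /orP[/eqP->|xs].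
  by move=> ys; rewrite (chain_head p).
case/orP=> [/eqP->|ys]; first by rewrite (@chain_head c s x) ?orbT // inE xs orbT.
exact: IH (path_sorted p) xs ys.
Qed.

End Chains.

Section Blowups.
Variables (T : finType) (e : rel T) (es : symmetric e) (ei : irreflexive e).

Lemma chain_rel_refl B : reflexive (chain_rel e B).
Proof. by move=> x; rewrite /chain_rel. Qed.
Lemma chain_rel_trans B : transitive (chain_rel e B).
Proof. by move=> y x z h1 h2; apply: subset_trans h2 h1. Qed.

Lemma chain_relP B x y u : chain_rel e B x y -> u \in B -> e y u -> e x u.
Proof.
by move=> /subsetP/(_ u) h uB yu; move: h; rewrite !inE yu uB !andbT => ->.
Qed.

Lemma ordered_chain_nested A B x y u w : ordered_chain e A B ->
  x \in A -> y \in A -> u \in B -> w \in B -> e x u -> e y w -> e x w || e y u.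
Proof.
move=> [a [l [_ [AE [srt _]]]]]; rewrite -!AE => xA yA uB wB xu yw.
have := chain_total (@chain_rel_refl B) (@chain_rel_trans B) srt xA yA.
by case/orP => h; rewrite ?(chain_relP h wB yw) ?(chain_relP h uB xu) ?orbT.
Qed.

Lemma ordered_chain_top A B : ordered_chain e A B ->
  exists2 a, a \in A & forall b, b \in B -> e a b.
Proof.
move=> [a [l [_ [AE [_ aB]]]]]; exists a; first by rewrite -AE mem_head.
by move=> b; rewrite -{1}aB !inE => /andP[].
Qed.

Lemma villa_chain_ordered B C : villa_chain e B C -> ordered_chain e B C.
Proof. by move=> [b [l [h1 [h2 [h3 [h4 _]]]]]]; exists b, l. Qed.

Lemma villa_chain_nbr B C b : villa_chain e B C -> b \in B ->
  exists2 c, c \in C & e b c.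
Proof.
move=> [b0 [l [_ [BE [srt [_ /set0Pn[c]]]]]]]; rewrite !inE => /andP[bc cC].
rewrite -BE => bB; exists c => //.
exact: chain_relP (chain_last (@chain_rel_refl C) (@chain_rel_trans C) srt bB) cC bc.
Qed.

Lemma in_bigcup_seq (l : seq {set T}) x :
  (x \in \bigcup_(X <- l) X) = has (fun X : {set T} => x \in X) l.
Proof. by elim: l => [|X l IH]; rewrite (big_nil, big_cons) inE //= IH. Qed.

Lemma part_mem l (Q X : {set T}) x : is_partition l Q -> X \in l -> x \in X -> x \in Q.
Proof. by case=> _ <- Xl xX; rewrite in_bigcup_seq; apply/hasP; exists X. Qed.

Lemma part_cover t (B C : 'I_t -> {set T}) l (Q : {set T}) x :
  is_partition (l ++ [seq B i | i <- enum 'I_t] ++ [seq C i | i <- enum 'I_t]) Q ->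
  x \in Q -> [\/ exists2 X, X \in l & x \in X, exists i, x \in B i | exists i, x \in C i].
Proof.
case=> _ <-; rewrite in_bigcup_seq !has_cat => /or3P[/hasP[X]|/hasP[X]|/hasP[X]].
- by constructor 1; exists X.
- by case/mapP=> i _ -> ?; constructor 2; exists i.
- by case/mapP=> i _ -> ?; constructor 3; exists i.
Qed.

Lemma part_neq l (Q : {set T}) i j x y : is_partition l Q -> i < size l -> j < size l ->
  i != j -> x \in nth set0 l i -> y \in nth set0 l j -> x != y.
Proof.
by case=> h _ il jl ij xi; apply: contraTneq => <-; rewrite (disjointFr (h _ _ il jl ij)).
Qed.

Lemma nth_families t (B C : 'I_t -> {set T}) (i : 'I_t) :
  let l := [seq B i | i <- enum 'I_t] ++ [seq C i | i <- enum 'I_t] in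
  [/\ size l = t + t, nth set0 l i = B i & nth set0 l (t + i) = C i].
Proof.
have szt (D : 'I_t -> {set T}) : size [seq D i | i <- enum 'I_t] = t.
  by rewrite size_map size_enum_ord.
rewrite /= size_cat !szt !nth_cat !szt ltn_ord ltnNge leq_addr /= addKn.
by split=> //; rewrite (nth_map i) ?size_enum_ord // nth_ord_enum.
Qed.

Lemma part_families_neq t (B C : 'I_t -> {set T}) l (Q : {set T}) :
  is_partition (l ++ [seq B i | i <- enum 'I_t] ++ [seq C i | i <- enum 'I_t]) Q ->
  [/\ forall X i x y, X \in l -> x \in X -> (y \in B i) || (y \in C i) -> x != y,
      forall i j x y, i != j -> x \in B i -> y \in B j -> x != y &
      forall i j x y, x \in B i -> y \in C j -> x != y].
Proof.
set M := [seq B i | i <- _] ++ _ => pQ; set m := size l.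
have nB (i : 'I_t) : nth set0 (l ++ M) (m + i) = B i.
  by rewrite nth_cat ltnNge leq_addr addKn; case: (nth_families B C i).
have nC (i : 'I_t) : nth set0 (l ++ M) (m + (t + i)) = C i.
  by rewrite nth_cat ltnNge leq_addr addKn; case: (nth_families B C i).
have sz : size (l ++ M) = m + (t + t) by rewrite !size_cat !size_map -!enumT !size_enum_ord.
have lt (i : 'I_t) : i < t + t by rewrite ltn_addr.
split.
- move=> X i x y Xl xX yi; rewrite -index_mem in Xl.
  have nX : x \in nth set0 (l ++ M) (index X l).
    by rewrite nth_cat Xl nth_index // -index_mem.
  case/orP: yi => yi.
    apply: (part_neq pQ (i := index X l) (j := m + i) _ _ _ nX); rewrite ?nB // ?sz.
    + by rewrite ltn_addr.
    + by rewrite ltn_add2l.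
    + by rewrite neq_ltn ltn_addr.
  apply: (part_neq pQ (i := index X l) (j := m + (t + i)) _ _ _ nX); rewrite ?nC // ?sz.
  + by rewrite ltn_addr.
  + by rewrite !ltn_add2l.
  + by rewrite neq_ltn ltn_addr.
- move=> i j x y ij xi yj.
  by apply: (part_neq pQ (i := m + i) (j := m + j)); rewrite ?nB // ?sz ?ltn_add2l // eqn_add2l.
- move=> i j x y xi yj.
  apply: (part_neq pQ (i := m + i) (j := m + (t + j))); rewrite ?nB ?nC // ?sz ?ltn_add2l //.
  by rewrite eqn_add2l neq_ltn ltn_addr.
Qed.

(** What the converse needs beyond forbidden subgraphs: the nonadjacent neighbours x and y prevent v
    from being simplicial, and the nonneighbour w prevents it from being universal in [Q], which
    leads to anticonnectedness. *)
Definition rough (Q : {set T}) := Q != set0 /\ forall v, v \in Q -> exists x y w,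
  [/\ x \in Q, y \in Q & w \in Q] /\
  [&& e v x, e v y, ~~ e x y, x != y, ~~ e v w & v != w].

Lemma other_index t (i : 'I_t) : 1 < t -> exists j : 'I_t, j != i.
Proof.
move=> t1; case: (posnP (val i)) => [i0|ip].
  by exists (Ordinal t1); rewrite -val_eqE /= i0.
by exists (Ordinal (ltnW t1)); rewrite -val_eqE /= eq_sym -lt0n.
Qed.

(** The set [Q] only has to contain the villa, so the same lemma serves the villa inside a
    mansion. *)
Lemma villa_part_rough (Q : {set T}) t (A : {set T}) (B C : 'I_t -> {set T}) v :
  2 < t -> villa_part e A B C ->
  (forall a, a \in A -> a \in Q) -> (forall i b, b \in B i -> b \in Q) ->
  (forall i c, c \in C i -> c \in Q) ->
  (forall i x y, x \in A -> (y \in B i) || (y \in C i) -> x != y) ->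
  (forall i j x y, i != j -> x \in B i -> y \in B j -> x != y) ->
  (forall i j x y, x \in B i -> y \in C j -> x != y) ->
  [\/ v \in A, exists i, v \in B i | exists i, v \in C i] ->
  exists x y w, [/\ x \in Q, y \in Q & w \in Q] /\
  [&& e v x, e v y, ~~ e x y, x != y, ~~ e v w & v != w].
Proof.
move=> t3 [A0 [BC0 [Acl [BCcl [ABC [BC ch]]]]]] AQ BQ CQ nl nBB nBC.
have /set0Pn[a0 a0A] := A0.
have [b0 b0P] : exists b, forall i, b i \in B i.
  by apply: (@fin_all_exists _ _ (fun i b => b \in B i)) => i; apply/set0Pn; case: (BC0 i).
have [c0 c0P] : exists c, forall i, c i \in C i.
  by apply: (@fin_all_exists _ _ (fun i c => c \in C i)) => i; apply/set0Pn; case: (BC0 i).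
have AB i a b : a \in A -> b \in B i -> e a b by apply: (ABC i).1.
have AC i a c : a \in A -> c \in C i -> e a c = false.
  by move=> aA cC; apply/negbTE/(ABC i).2.
have BB i j b b' : j != i -> b \in B i -> b' \in B j -> e b b' = false.
  by rewrite eq_sym => ij bB b'B; apply/negbTE/(BC _ _ ij).1.
have CC i j c c' : j != i -> c \in C i -> c' \in C j -> e c c'.
  by rewrite eq_sym => ij; apply: (BC _ _ ij).2.1.
have BCn i j b c : j != i -> b \in B i -> c \in C j -> e b c = false.
  by rewrite eq_sym => ij bB cC; apply/negbTE/(BC _ _ ij).2.2.
have nBB' i j b b' : j != i -> b \in B i -> b' \in B j -> b != b'.
  by rewrite eq_sym; apply: nBB.
case=> [vA|[i vB]|[i vC]].
-   have [i _] : exists i : 'I_t, true by exists (Ordinal (ltnW (ltnW t3))).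
  have [j ji] := other_index i (ltnW t3).
  exists (b0 i), (b0 j), (c0 i); split; first by split; eauto.
  rewrite (AB i) // (AB j) // (BB i j) // (AC i) //=.
  by rewrite (nBB' i j) // (nl i) ?c0P ?orbT.
- have [c cC vc] := villa_chain_nbr (ch i) vB; have [j ji] := other_index i (ltnW t3).
  exists a0, c, (b0 j); split; first by split; eauto.
  rewrite es (AB i) // vc (AC i) // (BB i j) //=.
  by rewrite (nl i) ?cC ?orbT // (nBB' i j).
- have [b bB bC] := ordered_chain_top (villa_chain_ordered (ch i)).
  have [j ji] := other_index i (ltnW t3).
  exists b, (c0 j), (b0 j); split; first by split; eauto.
  rewrite es bC // (CC i j) // (BCn i j) // (nBC i j) // es (BCn j i) // 1?[i == j]eq_sym //=.
  by rewrite eq_sym (nBC j i).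
Qed.

(** * Villas *)

Section Villa.
Variables (Q : {set T}) (t : nat) (A : {set T}) (B C : 'I_t -> {set T}).
Hypotheses (t3 : 2 < t) (vp : villa_part e A B C)
  (pQ : is_partition (A :: [seq B i | i <- enum 'I_t] ++ [seq C i | i <- enum 'I_t]) Q).

(** Templates have classes indexed by natural numbers; an index that is out of range denotes the
    empty class. *)
Definition villa_cls k i : {set T} :=
  if k == 0 then A else oapp (fun j : 'I_t => if k == 1 then B j else C j) set0 (insub i).

Lemma villa_clsP k i x : k \in [:: 0; 1; 2] -> x \in villa_cls k i ->
  [\/ k = 0 /\ x \in A, exists j : 'I_t, [/\ k = 1, i = j & x \in B j]
    | exists j : 'I_t, [/\ k = 2, i = j & x \in C j]].
Proof.
rewrite /villa_cls !inE => /or3P[] /eqP-> /=; first by constructor 1.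
all: case: insubP => [j _ <-|] /=; rewrite ?inE // => xj.
  by constructor 2; exists j.
by constructor 3; exists j.
Qed.

Lemma villa_free : clique e (~: Q) -> complete e (~: Q) Q ->
  [/\ ~ induced_sub e twoP3, ~ induced_sub e (@cycle_graph 4),
      ~ induced_sub e (@cycle_graph 6), ~ induced_sub e (@cycle_graph 7) &
      ~ induced_sub e T0].
Proof.
case: vp => _ [_ [Acl [BCcl [ABC [BC ch]]]]] UQ UcQ.
apply: (template_free es ei UQ UcQ (cls := villa_cls) _ _ _ _ _ villa_avoids).
- by case=> [|[|[|k]]] [|[|[|k']]] b b' //; rewrite !inE.
- move=> k k' i i' x y b kk kk' le xk yk.
  case/(villa_clsP kk): xk le => [[-> xA]|[j [-> -> xB]]|[j [-> -> xC]]];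
    case/(villa_clsP kk'): yk => [[-> yA]|[j' [-> -> yB]]|[j' [-> -> yC]]] //= _ xy.
  + by case=> <-; apply: Acl.
  + by case=> <-; apply: (ABC j').1.
  + by case=> <-; apply/negbTE/(ABC j').2.
  + case=> <-; rewrite val_eqE; case: eqVneq => [E|ne]; last by apply/negbTE/(BC _ _ ne).1.
    by rewrite -E in yB; apply: (BCcl j).1.
  + rewrite /villa_c /= val_eqE.
    by case: eqVneq => // ne [<-]; apply/negbTE/(BC _ _ ne).2.2.
  + case=> <-; case: (eqVneq j j') => [E|ne]; last by apply: (BC _ _ ne).2.1.
    by rewrite -E in yC; apply: (BCcl j).2.
- by move=> k k' b _ _; rewrite /villa_c minnC maxnC.
- move=> k i p ip q iq x y u w kk kp kq.
  move=> + + xk yk uk wk; move: yk.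
  case/(villa_clsP kk): xk => [[-> xA]|[j [-> -> xB]]|[j [-> -> xC]]];
    case/(villa_clsP kp): uk => [[-> uA]|[j1 [-> -> uB]]|[j1 [-> -> uC]]] //= yk;
    rewrite /villa_c //=; case: eqP => // /val_inj/esym E _; subst j1;
    case/(villa_clsP kq): wk => [[-> wA]|[j2 [-> -> wB]]|[j2 [-> -> wC]]] //=;
    case: eqP => // /val_inj/esym E _; subst j2;
    move: yk; rewrite /villa_cls /= valK /= => yk.
    exact: (ordered_chain_nested (villa_chain_ordered (ch j)) xB yk uC wC).
  move=> xu yw; rewrite es orbC es.
  by apply: (ordered_chain_nested (villa_chain_ordered (ch j)) uB wB xC yk); rewrite es.
- move=> x /(part_cover (l := [:: A]) pQ) [[X]|[i xB]|[i xC]].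
  + by rewrite inE => /eqP-> xA; exists 0, 0.
  + by exists 1, (val i); rewrite /villa_cls /= valK.
  + by exists 2, (val i); rewrite /villa_cls /= valK.
Qed.

Lemma villa_rough : rough Q.
Proof.
have [nl nBB nBC] := part_families_neq (l := [:: A]) pQ.
have AQ a : a \in A -> a \in Q by apply: part_mem pQ _; rewrite mem_head.
have BQ i b : b \in B i -> b \in Q.
  by apply: part_mem pQ _; rewrite inE mem_cat map_f ?orbT // mem_enum.
have CQ i c : c \in C i -> c \in Q.
  by apply: part_mem pQ _; rewrite inE mem_cat map_f ?orbT // mem_enum.
split=> [|v /(part_cover (l := [:: A]) pQ) vE].
  by case: vp => /set0Pn[a0 /AQ a0Q] _; apply/set0Pn; exists a0.
apply: (villa_part_rough t3 vp AQ BQ CQ) => [i x y|||]; [exact: nl (mem_head _ _)|by []..|].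
by case: vE => [[X]|h|h]; [rewrite inE => /eqP->; constructor 1|constructor 2|constructor 3].
Qed.

End Villa.

(** * Mansions *)

Section Mansion.
Variables (Q : {set T}) (t : nat) (A F X Y : {set T}) (B C : 'I_t -> {set T}) (j : 'I_t).
Hypotheses (t3 : 2 < t) (vp : villa_part e A B C)
  (pQ : is_partition
    (A :: F :: X :: Y :: [seq B i | i <- enum 'I_t] ++ [seq C i | i <- enum 'I_t]) Q)
  (F0 : F != set0) (Fcl : clique e F) (Xcl : clique e X) (Ycl : clique e Y)
  (FA : complete e F A)
  (FBC : forall i, i != j -> complete e F (B i) /\ complete e F (C i))
  (FnBC : anticomplete e F (B j :|: C j)) (BjCj : complete e (B j) (C j))
  (XAB : complete e X (A :|: B j)) (XnB : forall i, i != j -> anticomplete e X (B i))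
  (XnC : forall i, anticomplete e X (C i)) (FXY : complete e F (X :|: Y))
  (XnY : anticomplete e X Y) (YC : forall i, complete e Y (C i) /\ anticomplete e Y (B i))
  (YnA : anticomplete e Y A).

(** The index [j] is emptied in kinds 1 and 2 and has kinds of its own, because F and X treat B_j
    and C_j differently from the other classes while a template may compare indices but not single
    one out. *)
Definition mansion_cls k i : {set T} :=
  match k with
  | 0 => A | 3 => F | 4 => X | 5 => Y | 6 => B j | 7 => C j
  | _ => oapp (fun i' : 'I_t => if i' == j then set0 else if k == 1 then B i' else C i') set0
           (insub i)
  end.

Variant mansion_spec x : nat -> nat -> Prop :=
  | MansionA i of x \in A : mansion_spec x 0 i
  | MansionB (i : 'I_t) of i != j & x \in B i : mansion_spec x 1 i
  | MansionC (i : 'I_t) of i != j & x \in C i : mansion_spec x 2 i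
  | MansionF i of x \in F : mansion_spec x 3 i
  | MansionX i of x \in X : mansion_spec x 4 i
  | MansionY i of x \in Y : mansion_spec x 5 i
  | MansionBj i of x \in B j : mansion_spec x 6 i
  | MansionCj i of x \in C j : mansion_spec x 7 i.

Lemma mansion_clsP k i x : k \in iota 0 8 -> x \in mansion_cls k i -> mansion_spec x k i.
Proof.
rewrite mem_iota add0n => /andP[_]; case: k => [|[|[|[|[|[|[|[|//]]]]]]]] _ /=; try by constructor.
all: case: insubP => [i' _ <-|] /=; last by rewrite inE.
all: by case: eqVneq => [_|ne]; rewrite ?inE //; constructor.
Qed.

Lemma mansion_adj k k' i i' x y b : k \in iota 0 8 -> k' \in iota 0 8 -> k <= k' ->
  x \in mansion_cls k i -> y \in mansion_cls k' i' -> x != y ->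
  mansion_c k k' (i == i') = Some b -> e x y = b.
Proof.
case: vp => _ [_ [Acl [BCcl [ABC [BC ch]]]]] kk kk' le xk yk.
have FBj c : c \in B j -> c \in B j :|: C j by rewrite inE => ->.
have FCj c : c \in C j -> c \in B j :|: C j by rewrite inE orbC => ->.
have XA a : a \in A -> a \in A :|: B j by rewrite inE => ->.
have XB a : a \in B j -> a \in A :|: B j by rewrite inE orbC => ->.
have FX z : z \in X -> z \in X :|: Y by rewrite inE => ->.
have FY z : z \in Y -> z \in X :|: Y by rewrite inE orbC => ->.
have F1 i0 u v : u \in A -> v \in B i0 -> e u v by apply: (ABC i0).1.
have F2 i0 u v : i0 != j -> u \in F -> v \in B i0 -> e u v by move=> /FBC[h _]; apply: h.
have F3 i0 u v : i0 != j -> u \in F -> v \in C i0 -> e u v by move=> /FBC[_ h]; apply: h.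
have F4 i0 i1 u v : i0 != i1 -> u \in C i0 -> v \in C i1 -> e u v.
  by move=> /BC[_ [h _]]; apply: h.
have F5 i0 u v : u \in Y -> v \in C i0 -> e u v by apply: (YC i0).1.
have F6 u v : u \in F -> v \in A -> e u v by apply: FA.
have F7 u v : u \in F -> v \in X -> e u v by move=> uF /FX; apply: FXY.
have F8 u v : u \in F -> v \in Y -> e u v by move=> uF /FY; apply: FXY.
have F9 u v : u \in X -> v \in A -> e u v by move=> uX /XA; apply: XAB.
have F10 u v : u \in X -> v \in B j -> e u v by move=> uX /XB; apply: XAB.
have F11 u v : u \in B j -> v \in C j -> e u v by apply: BjCj.
have N1 i0 u v : u \in A -> v \in C i0 -> ~~ e u v by apply: (ABC i0).2.
have N2 i0 u v : u \in Y -> v \in B i0 -> ~~ e u v by apply: (YC i0).2.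
have N3 i0 i1 u v : i0 != i1 -> u \in B i0 -> v \in B i1 -> ~~ e u v.
  by move=> /BC[h _]; apply: h.
have N4 i0 i1 u v : i0 != i1 -> u \in B i0 -> v \in C i1 -> ~~ e u v.
  by move=> /BC[_ [_ h]]; apply: h.
have N11 i0 u v : i0 != j -> u \in B j -> v \in C i0 -> ~~ e u v.
  by rewrite eq_sym; apply: N4.
have N5 i0 u v : i0 != j -> u \in X -> v \in B i0 -> ~~ e u v by move=> /XnB; apply.
have N6 i0 u v : u \in X -> v \in C i0 -> ~~ e u v by apply: XnC.
have N7 u v : u \in X -> v \in Y -> ~~ e u v by apply: XnY.
have N8 u v : u \in Y -> v \in A -> ~~ e u v by apply: YnA.
have N9 u v : u \in F -> v \in B j -> ~~ e u v by move=> uF /FBj; apply: FnBC.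
have N10 u v : u \in F -> v \in C j -> ~~ e u v by move=> uF /FCj; apply: FnBC.
have [K1 K2] : (forall i0 u v, u \in B i0 -> v \in B i0 -> u != v -> e u v) /\
    (forall i0 u v, u \in C i0 -> v \in C i0 -> u != v -> e u v).
  by split=> i0 u v; [apply: (BCcl i0).1|apply: (BCcl i0).2].
move: Acl Fcl Xcl Ycl; rewrite /clique => K3 K4 K5 K6.
case: (mansion_clsP kk xk) le; case: (mansion_clsP kk' yk) => //=; rewrite /mansion_c /=.
(* The facts above settle every pair of kinds except B with B, B with C and C with C, where the
   answer depends on whether the indices agree. *)
all: try solve [move=> *; match goal with H : Some _ = Some _ |- _ => case: H => <- end;
  match goal with
  | |- _ = false => apply/negbTE; solve [eauto 3 | rewrite es; eauto 3]
  | |- ?a = true => change (is_true a); solve [eauto 3 | rewrite es; eauto 3]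
  end].
- move=> i0 i0j y0 i1 i1j x1 _ xy [E0]; move: E0; rewrite val_eqE => <-; case: eqVneq => [E|ne].
    by rewrite -E in y0; apply: K1 x1 y0 xy.
  by apply/negbTE; eauto 3.
- move=> i0 i0j y0 i1 i1j x1 _ xy; case: ifP => // /negbT; rewrite val_eqE => ne [<-].
  by apply/negbTE; eauto 3.
- move=> i0 i0j y0 i1 i1j x1 _ xy [<-]; case: (eqVneq i1 i0) => [E|ne]; last exact: F4 ne x1 y0.
  by rewrite -E in y0; apply: K2 x1 y0 xy.
Qed.

Lemma mansion_free : clique e (~: Q) -> complete e (~: Q) Q ->
  [/\ ~ induced_sub e twoP3, ~ induced_sub e (@cycle_graph 4),
      ~ induced_sub e (@cycle_graph 6), ~ induced_sub e (@cycle_graph 7) &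
      ~ induced_sub e T0].
Proof.
case: vp => _ [_ [Acl [BCcl [ABC [BC ch]]]]] UQ UcQ.
apply: (template_free es ei UQ UcQ (cls := mansion_cls) _ _ _ _ _ mansion_avoids).
- move=> k k' b b'; rewrite !mem_iota !add0n => /andP[_] + /andP[_].
  by case: k => [|[|[|[|[|[|[|[|//]]]]]]]] _; case: k' => [|[|[|[|[|[|[|[|//]]]]]]]] _.
- exact: mansion_adj.
- by move=> k k' b _ _; rewrite /mansion_c minnC maxnC.
- move=> k i p ip q iq x y u w kk kp kq.
  have none k' p' (b : bool) : k' \in iota 0 8 -> p' \in iota 0 8 ->
      mansion_c k' p' b = None -> b /\ ((k' == 1) && (p' == 2) || (k' == 2) && (p' == 1)).
    rewrite !mem_iota !add0n => /andP[_] + /andP[_].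
    by case: k' => [|[|[|[|[|[|[|[|//]]]]]]]] _; case: p' => [|[|[|[|[|[|[|[|//]]]]]]]] _; case: b.
  move=> /(none _ _ _ kk kp)[/eqP<- kpE] /(none _ _ _ kk kq)[/eqP<- kqE] {none}.
  case/orP: kpE kqE => /andP[/eqP-> /eqP->] /=; rewrite ?orbF => /eqP->;
    rewrite /mansion_cls; case: insubP => [i' _ _|] /=; rewrite ?inE //;
    case: ifP => _; rewrite ?inE // => xk yk uk wk.
    exact: (ordered_chain_nested (villa_chain_ordered (ch i')) xk yk uk wk).
  move=> xu yw; rewrite es orbC es.
  by apply: (ordered_chain_nested (villa_chain_ordered (ch i')) uk wk xk yk); rewrite es.
- move=> x /(part_cover (l := [:: A; F; X; Y]) pQ) [[Z]|[i xB]|[i xC]].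
  + rewrite !inE => /or4P[] /eqP-> xA;
      [exists 0|exists 3|exists 4|exists 5]; by exists 0.
  + case: (eqVneq i j) xB => [->|ij] xB; first by exists 6, 0.
    by exists 1, (val i); rewrite /mansion_cls /= valK /= (negbTE ij).
  + case: (eqVneq i j) xC => [->|ij] xC; first by exists 7, 0.
    by exists 2, (val i); rewrite /mansion_cls /= valK /= (negbTE ij).
Qed.

Lemma mansion_rough : rough Q.
Proof.
case: vp => A0 [BC0 [Acl [BCcl [ABC [BC ch]]]]].
have [nl nBB nBC] := part_families_neq (l := [:: A; F; X; Y]) pQ.
have /set0Pn[a0 a0A] := A0; have /set0Pn[f0 f0F] := F0.
have sub Z z : Z \in [:: A; F; X; Y] -> z \in Z -> z \in Q.
  by move=> h; apply: (part_mem pQ); rewrite -[_ :: _]/([:: A; F; X; Y] ++ _) mem_cat h.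
have BQ i b : b \in B i -> b \in Q.
  by apply: part_mem pQ _; rewrite !inE mem_cat map_f ?orbT // mem_enum.
have CQ i c : c \in C i -> c \in Q.
  by apply: part_mem pQ _; rewrite !inE mem_cat map_f ?orbT // mem_enum.
have AQ a : a \in A -> a \in Q by apply: (sub A); rewrite mem_head.
have FQ f : f \in F -> f \in Q by apply: (sub F); rewrite !inE eqxx orbT.
have [[/set0Pn[bj bjP] /set0Pn[cj cjP]] [i ij]] := (BC0 j, other_index j (ltnW t3)).
have [/set0Pn[bi biP] /set0Pn[ci ciP]] := BC0 i.
split=> [|v /(part_cover (l := [:: A; F; X; Y]) pQ) vE].
  by apply/set0Pn; exists a0; apply: AQ.
have core : [\/ v \in A, exists i, v \in B i | exists i, v \in C i] ->
    exists x y w, [/\ x \in Q, y \in Q & w \in Q] /\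
    [&& e v x, e v y, ~~ e x y, x != y, ~~ e v w & v != w].
  by apply: (villa_part_rough t3 vp AQ BQ CQ) => // i' x y; apply: nl (mem_head _ _).
case: vE => [[Z]|h|h]; last 2 first.
- by apply: core; constructor 2.
- by apply: core; constructor 3.
rewrite !inE => /or4P[] /eqP-> {Z} vZ; first by apply: core; constructor 1.
- exists a0, ci, bj; split; first by split; eauto.
  rewrite FA // (FBC ij).2 // (ABC i).2 // (nl A i) ?mem_head ?ciP ?orbT //=.
  by rewrite FnBC ?inE ?bjP // (nl F j) ?bjP // !inE eqxx orbT.
- exists f0, bj, cj; split; first by split; eauto.
  rewrite es FXY ?inE ?vZ // XAB ?inE ?bjP ?orbT // FnBC ?inE ?bjP //.
  rewrite (nl F j) ?bjP ?inE ?eqxx ?orbT //= (XnC vZ cjP).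
  by rewrite (nl X j) ?cjP ?inE ?eqxx ?orbT.
- exists f0, cj, a0; split; first by split; eauto.
  rewrite es FXY ?inE ?vZ ?orbT // (YC j).1 // FnBC ?inE ?cjP ?orbT //.
  rewrite (nl F j) ?cjP ?inE ?eqxx ?orbT //= YnA //=.
  exact: (part_neq pQ (i := 3) (j := 0)).
Qed.

End Mansion.

End Blowups.

Lemma other_indices (i : 'I_3) : exists j k : 'I_3, [/\ j != i, k != i & j != k].
Proof.
case: i => -[|[|[|//]]] lti; first by exists (@Ordinal 3 1 isT), (@Ordinal 3 2 isT).
  by exists (@Ordinal 3 0 isT), (@Ordinal 3 2 isT).
by exists (@Ordinal 3 0 isT), (@Ordinal 3 1 isT).
Qed.

Lemma basket_c_None i0 j0 k p b : i0 < 3 -> k < 8 -> p < 8 -> basket_c i0 j0 k p b = None ->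
  (k == 0) && (p == 2 + i0) || (k == 2 + i0) && (p == 0).
Proof.
case: i0 => [|[|[|//]]] _; case: k => [|[|[|[|[|[|[|[|//]]]]]]]] _;
  by case: p => [|[|[|[|[|[|[|[|//]]]]]]]] _.
Qed.

Lemma crown_c_None i0 k k' b : k < 5 -> k' < 5 -> crown_c i0 k k' b = None -> k != k'.
Proof.
move=> _ _; apply: contraPneq => <-.
by rewrite /crown_c addnC addnK.
Qed.
Lemma crown_c_sym i0 k k' b : k < 5 -> k' < 5 -> crown_c i0 k k' b = crown_c i0 k' k b.
Proof. by case: k => [|[|[|[|[|//]]]]] _; case: k' => [|[|[|[|[|//]]]]] _. Qed.
Lemma crown_c_false i0 k k' b : i0 < 5 -> k < 5 -> k' < 5 -> crown_c i0 k k' b = Some false ->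
  ~~ [|| k' == k, k' == k.+1 %% 5 | k'.+1 %% 5 == k].
Proof.
case: i0 => [|[|[|[|[|//]]]]] _; case: k => [|[|[|[|[|//]]]]] _;
  by case: k' => [|[|[|[|[|//]]]]] _.
Qed.
Lemma crown_c_true i0 k k' b : i0 < 5 -> k < 5 -> k' < 5 -> crown_c i0 k k' b = Some true ->
  [|| k == k', ((k + 1) %% 5 == i0) && ((k' + 2) %% 5 == i0),
      ((k' + 1) %% 5 == i0) && ((k + 2) %% 5 == i0),
      ((i0 + 1) %% 5 == k) && ((i0 + 2) %% 5 == k') |
      ((i0 + 1) %% 5 == k') && ((i0 + 2) %% 5 == k)].
Proof.
case: i0 => [|[|[|[|[|//]]]]] _; case: k => [|[|[|[|[|//]]]]] _;
  by case: k' => [|[|[|[|[|//]]]]] _.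
Qed.

Lemma ring5_neighbours (i : 'I_5) : exists j k l : 'I_5,
  [/\ ring_adj j i, ring_adj k i, j != i & k != i] /\
  [/\ ~~ ring_adj j k, ~~ ring_adj i l, j != k & i != l].
Proof.
case: i => -[|[|[|[|[|//]]]]] lti.
- by exists (@Ordinal 5 4 isT), (@Ordinal 5 1 isT), (@Ordinal 5 2 isT).
- by exists (@Ordinal 5 0 isT), (@Ordinal 5 2 isT), (@Ordinal 5 3 isT).
- by exists (@Ordinal 5 1 isT), (@Ordinal 5 3 isT), (@Ordinal 5 4 isT).
- by exists (@Ordinal 5 2 isT), (@Ordinal 5 4 isT), (@Ordinal 5 0 isT).
- by exists (@Ordinal 5 3 isT), (@Ordinal 5 0 isT), (@Ordinal 5 1 isT).
Qed.

Section BasketTable.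
Variables (i0 j0 i i' : nat) (b : bool).
Hypotheses (li : i < 3) (li' : i' < 3).
(** With symbolic indices the table does not reduce; its entries are evaluated here by running
    through the three values of each index. *)
Lemma basket_c0B : basket_c i0 j0 0 (2 + i) b = if i == i0 then None else Some true.
Proof. by case: i li => [|[|[|//]]] _. Qed.
Lemma basket_c0C : basket_c i0 j0 0 (5 + i) b = Some false.
Proof. by case: i li => [|[|[|//]]] _. Qed.
Lemma basket_c1B : basket_c i0 j0 1 (2 + i) b = Some (i != j0).
Proof. by case: i li => [|[|[|//]]] _. Qed.
Lemma basket_c1C : basket_c i0 j0 1 (5 + i) b = Some (i != j0).
Proof. by case: i li => [|[|[|//]]] _. Qed.
Lemma basket_cBB : basket_c i0 j0 (2 + i) (2 + i') b = Some (i == i').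
Proof. by case: i li => [|[|[|//]]] _; case: i' li' => [|[|[|//]]] _. Qed.
Lemma basket_cBC : basket_c i0 j0 (2 + i) (5 + i') b = Some (i == i').
Proof. by case: i li => [|[|[|//]]] _; case: i' li' => [|[|[|//]]] _. Qed.
Lemma basket_cCC : basket_c i0 j0 (5 + i) (5 + i') b = Some true.
Proof. by case: i li => [|[|[|//]]] _; case: i' li' => [|[|[|//]]] _. Qed.
End BasketTable.

Section BasketCrown.
Variables (T : finType) (e : rel T) (es : symmetric e) (ei : irreflexive e).

(** * 5-baskets *)

Section Basket.
Variables (Q A F : {set T}) (B C : 'I_3 -> {set T}) (i0 j0 : 'I_3).
Hypotheses
  (pQ : is_partition ([:: A; F] ++ [seq B i | i <- enum 'I_3] ++ [seq C i | i <- enum 'I_3]) Q)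
  (A0 : A != set0) (BC0 : forall i, B i != set0 /\ C i != set0)
  (Acl : clique e A) (Fcl : clique e F) (BCcl : forall i, clique e (B i) /\ clique e (C i))
  (BC : forall i j, i != j -> anticomplete e (B i) (B j) /\ complete e (C i) (C j))
  (AB : forall i, i != i0 -> complete e A (B i)) (ch : ordered_chain e A (B i0))
  (AnC : forall i, anticomplete e A (C i)) (BiCi : forall i, complete e (B i) (C i))
  (BiCj : forall i j, i != j -> anticomplete e (B i) (C j))
  (FQ : complete e F (Q :\: (B j0 :|: C j0 :|: F))) (FnBC : anticomplete e F (B j0 :|: C j0)).

Definition basket_cls k (d : nat) : {set T} :=
  if k == 0 then A else if k == 1 then F else
  if k < 5 then B (inord (k - 2)) else C (inord (k - 5)).

Variant basket_spec x : nat -> Prop :=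
  | BasketA of x \in A : basket_spec x 0
  | BasketF of x \in F : basket_spec x 1
  | BasketB (i : 'I_3) of x \in B i : basket_spec x (2 + i)
  | BasketC (i : 'I_3) of x \in C i : basket_spec x (5 + i).

Lemma basket_clsP k i x : k \in iota 0 8 -> x \in basket_cls k i -> basket_spec x k.
Proof.
rewrite mem_iota add0n => /andP[_]; case: k => [|[|k]] k8.
- by constructor.
- by constructor.
rewrite /basket_cls /=; case: ltnP => k5 h.
  rewrite -[k.+2]/(2 + k) -[k](@inordK 2); last by rewrite -(ltn_add2l 2).
  by constructor; move: h; rewrite subn2.
have -> : k.+2 = 5 + (k.+2 - 5) by rewrite subnKC.
rewrite -[k.+2 - 5](@inordK 2); last by rewrite ltn_subLR.
by constructor.
Qed.

Let neqs := part_families_neq (l := [:: A; F]) pQ.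

Lemma basket_AQ a : a \in A -> a \in Q.
Proof. by apply: (part_mem pQ); rewrite mem_head. Qed.
Lemma basket_BQ i b : b \in B i -> b \in Q.
Proof. by apply: part_mem pQ _; rewrite !inE mem_cat map_f ?orbT // mem_enum. Qed.
Lemma basket_CQ i c : c \in C i -> c \in Q.
Proof. by apply: part_mem pQ _; rewrite !inE mem_cat map_f ?orbT // mem_enum. Qed.

Lemma basket_F f : f \in F ->
  [/\ forall a, a \in A -> e f a, forall i b, b \in B i -> e f b = (i != j0)
    & forall i c, c \in C i -> e f c = (i != j0)].
Proof.
have [nl nBB nBC] := neqs => fF; split.
- move=> a aA; apply: FQ => //; rewrite in_setD basket_AQ // andbT !in_setU.
  apply/norP; split; first apply/norP; first split.
  + by apply: contraTN (eqxx a) => h; apply: (nl A j0); rewrite ?mem_head ?h.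
  + by apply: contraTN (eqxx a) => h; apply: (nl A j0); rewrite ?mem_head ?h ?orbT.
  + by apply: contraTN (eqxx a) => h; apply: (part_neq pQ (i := 0) (j := 1)).
- move=> i b bB; case: (eqVneq i j0) => [E|ij] /=.
    by apply/negbTE/FnBC => //; rewrite inE -E bB.
  apply: FQ => //; rewrite in_setD (basket_BQ bB) andbT !in_setU.
  apply/norP; split; first apply/norP; first split.
  + by apply: contraTN (eqxx b) => h; apply: (nBB i j0).
  + by apply: contraTN (eqxx b) => h; apply: (nBC i j0).
  + by apply: contraTN (eqxx b) => h; apply: (nl F i); rewrite ?inE ?eqxx ?orbT ?bB.
- move=> i c cC; case: (eqVneq i j0) => [E|ij] /=.
    by apply/negbTE/FnBC => //; rewrite inE -E cC orbT.
  apply: FQ => //; rewrite in_setD (basket_CQ cC) andbT !in_setU.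
  apply/norP; split; first apply/norP; first split.
  + by apply: contraTN (eqxx c) => h; apply: (nBC j0 i).
  + have [/set0Pn[b bB] _] := BC0 i.
    by apply: contraTN (BiCi bB cC) => h; apply: BiCj ij _ _ bB h.
  + by apply: contraTN (eqxx c) => h; apply: (nl F i); rewrite ?inE ?eqxx ?cC ?orbT.
Qed.

Lemma basket_adj k k' i i' x y b : k \in iota 0 8 -> k' \in iota 0 8 -> k <= k' ->
  x \in basket_cls k i -> y \in basket_cls k' i' -> x != y ->
  basket_c i0 j0 k k' (i == i') = Some b -> e x y = b.
Proof.
move=> kk kk' le xk yk xy.
case: (basket_clsP kk xk) le => [xA|xF|i1 x1|i1 x1];
  case: (basket_clsP kk' yk) => [yA|yF|i2 y2|i2 y2] le //.
- by case=> <-; apply: Acl.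
- by case=> <-; rewrite es; have [-> //] := basket_F yF.
- rewrite basket_c0B //; case: eqP => // /eqP; rewrite val_eqE => ne [<-].
  exact: AB ne x y xA y2.
- by rewrite basket_c0C // => -[<-]; exact/negbTE/(AnC xA y2).
- by case=> <-; apply: Fcl.
- by rewrite basket_c1B // val_eqE => -[<-]; have [_ h _] := basket_F xF; apply: h.
- by rewrite basket_c1C // val_eqE => -[<-]; have [_ _ h] := basket_F xF; apply: h.
- rewrite basket_cBB // val_eqE => -[<-]; case: eqVneq => [E|ne].
    by rewrite -E in y2; apply: (BCcl i1).1.
  by apply/negbTE/(BC ne).1.
- rewrite basket_cBC // val_eqE => -[<-]; case: eqVneq => [E|ne].
    by rewrite -E in y2; exact: BiCi x1 y2.
  by apply/negbTE/(BiCj ne).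
- by case: i2 y2 le => -[|[|[|//]]].
- rewrite basket_cCC // => -[<-]; case: (eqVneq i1 i2) => [E|ne].
    by rewrite -E in y2; apply: (BCcl i1).2.
  by apply: (BC ne).2.
Qed.

Lemma basket_free : clique e (~: Q) -> complete e (~: Q) Q ->
  [/\ ~ induced_sub e twoP3, ~ induced_sub e (@cycle_graph 4),
      ~ induced_sub e (@cycle_graph 6), ~ induced_sub e (@cycle_graph 7) &
      ~ induced_sub e T0].
Proof.
move=> UQ UcQ; apply: (template_free es ei UQ UcQ (cls := basket_cls) _ basket_adj _ _ _
  (basket_avoids (ltn_ord i0) (ltn_ord j0))).
- by move=> k k' b b' _ _ _.
- by move=> k k' b _ _; rewrite /basket_c minnC maxnC.
- move=> k i p ip q iq x y u w kk kp kq.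
  have lt8 m : m \in iota 0 8 -> m < 8 by rewrite mem_iota => /andP[].
  move=> /(basket_c_None (ltn_ord i0) (lt8 _ kk) (lt8 _ kp)) kpE.
  move=> /(basket_c_None (ltn_ord i0) (lt8 _ kk) (lt8 _ kq)) kqE xk yk uk wk.
  have cB d : basket_cls (2 + i0) d = B i0.
    by rewrite /basket_cls /= -[5]/(2 + 3) ltn_add2l ltn_ord addKn inord_val.
  case/orP: kpE kqE xk yk uk wk => /andP[/eqP-> /eqP->] /=; rewrite ?orbF ?eqxx => /eqP->;
    rewrite -?[i0.+2]/(2 + i0) !cB.
    exact: ordered_chain_nested ch.
  move=> xk yk uk wk xu yw; rewrite es orbC es.
  by apply: (ordered_chain_nested ch uk wk xk yk); rewrite es.
- move=> x /(part_cover (l := [:: A; F]) pQ) [[Z]|[i xB]|[i xC]].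
  + by rewrite !inE => /orP[] /eqP-> xZ; [exists 0|exists 1]; exists 0.
  + exists (2 + i), 0; split=> //; first by case: i {xB} => -[|[|[|//]]].
    by rewrite /basket_cls /= -[5]/(2 + 3) ltn_add2l ltn_ord addKn inord_val.
  + exists (5 + i), 0; split=> //; first by case: i {xC} => -[|[|[|//]]].
    by rewrite /basket_cls /= addKn inord_val.
Qed.

Lemma basket_rough : rough e Q.
Proof.
have [nl nBB nBC] := neqs; have [/set0Pn[a0 a0A] [a1 a1A a1B]] := (A0, ordered_chain_top ch).
have [b0 b0P] : exists b, forall i, b i \in B i.
  by apply: (@fin_all_exists _ _ (fun i b => b \in B i)) => i; apply/set0Pn; case: (BC0 i).
have [c0 c0P] : exists c, forall i, c i \in C i.
  by apply: (@fin_all_exists _ _ (fun i c => c \in C i)) => i; apply/set0Pn; case: (BC0 i).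
have AC i a c : a \in A -> c \in C i -> e a c = false.
  by move=> aA cC; apply/negbTE/(AnC aA cC).
have BB i j b b' : j != i -> b \in B i -> b' \in B j -> e b b' = false.
  by rewrite eq_sym => ij bB b'B; apply/negbTE/(BC ij).1.
have nBB' i j b b' : j != i -> b \in B i -> b' \in B j -> b != b'.
  by rewrite eq_sym; apply: nBB.
have BCn i j b c : j != i -> b \in B i -> c \in C j -> e b c = false.
  by rewrite eq_sym => ij bB cC; apply/negbTE/(BiCj ij).
have nlA i a c : a \in A -> c \in C i -> a != c.
  by move=> aA cC; apply: (nl A i); rewrite ?mem_head ?cC ?orbT.
have AQ := basket_AQ; have BQ := basket_BQ; have CQ := basket_CQ.
split=> [|v /(part_cover (l := [:: A; F]) pQ)]; first by apply/set0Pn; exists a0; apply: AQ.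
case=> [[Z]|[i vB]|[i vC]].
- rewrite !inE => /orP[] /eqP-> {Z} vZ.
    have [i [j [i_0 j_0 ij]]] := other_indices i0.
    exists (b0 i), (b0 j), (c0 i0); split; first by split; eauto.
    have ji : j != i by rewrite eq_sym.
    rewrite (AB i_0) // (AB j_0) // (BB i j) // (AC i0) //= (nBB i j) //=.
    exact: (nlA i0).
  have [i ij] := other_index j0 (isT : 1 < 3).
  have [FA FB FC] := basket_F vZ.
  exists a0, (c0 i), (b0 j0); split; first by split; eauto.
  rewrite FA // (FC i) // ij (AC i) // (FB j0) // eqxx (nlA i) //=.
  by rewrite (nl F j0) ?b0P // !inE eqxx orbT.
- have [j ji] := other_index i (isT : 1 < 3).
  exists a1, (c0 i), (b0 j); split; first by split; eauto.
  (* An arbitrary vertex of A may miss v when [i] is [i0]; the top [a1] of the chain does not. *)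
  have -> : e v a1.
    by rewrite es; case: (eqVneq i i0) vB => [->|ne vB]; [apply: a1B|apply: (AB ne)].
  by rewrite (BiCi vB) // (AC i) // (BB i j) // (nlA i) // (nBB' i j).
- have [j ji] := other_index i (isT : 1 < 3).
  exists (b0 i), (c0 j), (b0 j); split; first by split; eauto.
  have ij : i != j by rewrite eq_sym.
  rewrite es (BiCi (b0P i)) // (BC ij).2 // (BCn i j) // (nBC i j) // es (BCn j i) //=.
  by rewrite eq_sym (nBC j i).
Qed.

End Basket.

(** * 5-crowns *)

Section Crown.
Variables (Q : {set T}) (X : 'I_5 -> {set T}) (i0 : 'I_5).
Hypotheses (rp : ring_partition e Q X)
  (low : forall j j' : 'I_5, (val j + 1) %% 5 == val i0 ->
        (val j' + 2) %% 5 == val i0 -> complete e (X j) (X j'))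
  (high : forall j j' : 'I_5, (val i0 + 1) %% 5 == val j ->
        (val i0 + 2) %% 5 == val j' -> complete e (X j) (X j')).

Lemma crown_neq i j x y : i != j -> x \in X i -> y \in X j -> x != y.
Proof.
case: rp => pQ _ ij xi yj.
have nX (k : 'I_5) : nth set0 [seq X i | i <- enum 'I_5] k = X k.
  by rewrite (nth_map k) ?size_enum_ord // nth_ord_enum.
by apply: (part_neq pQ (i := i) (j := j)); rewrite ?nX // size_map size_enum_ord.
Qed.

Lemma crown_mem i x : x \in X i -> x \in Q.
Proof. by case: rp => pQ _; apply: (part_mem pQ); rewrite map_f // mem_enum. Qed.

Lemma crown_cover x : x \in Q -> exists i, x \in X i.
Proof.
by case: rp => -[_ <-] _; rewrite in_bigcup_seq => /hasP[Z /mapP[i _ ->] xi]; exists i.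
Qed.

Lemma cnbhd_subset_refl : reflexive (fun x y => cnbhd e Q y \subset cnbhd e Q x).
Proof. by move=> x. Qed.
Lemma cnbhd_subset_trans : transitive (fun x y => cnbhd e Q y \subset cnbhd e Q x).
Proof. by move=> y x z h1 h2; apply: subset_trans h2 h1. Qed.

Lemma crown_far i j x y : ~~ ring_adj i j -> x \in X i -> y \in X j -> e x y = false.
Proof.
case: rp => _ [_ /(_ i)[u [l [_ [XE [srt [_ uE]]]]]]] nij xi yj; apply/negbTE.
apply: contra nij => xy; rewrite -XE in xi.
have /subsetP/(_ y) := chain_head cnbhd_subset_refl cnbhd_subset_trans srt xi.
rewrite inE (crown_mem yj) xy orbT uE => /(_ isT) /bigcupP[k ik yk].
by have [<- //|kj] := eqVneq k j; move: (crown_neq kj yk yj); rewrite eqxx.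
Qed.

Lemma crown_top i : exists2 u, u \in X i &
  forall j y, ring_adj i j -> i != j -> y \in X j -> e u y.
Proof.
case: rp => _ [_ /(_ i)[u [l [_ [XE [srt [_ uE]]]]]]].
have ui : u \in X i by rewrite -XE mem_head.
exists u => // j y aij ij yj.
have : y \in cnbhd e Q u by rewrite uE; apply/bigcupP; exists j.
by rewrite inE (negbTE (crown_neq _ yj ui)) 1?eq_sym // => /andP[].
Qed.

Lemma crown_clique i : clique e (X i).
Proof.
case: rp => _ [_ /(_ i)[u [l [_ [XE [srt [lE _]]]]]]] x y xi yi xy.
rewrite -XE in xi.
have /subsetP/(_ y) := chain_last cnbhd_subset_refl cnbhd_subset_trans srt xi.
move/subsetP: lE => /(_ y yi) yl /(_ yl).
by rewrite inE eq_sym (negbTE xy) => /andP[].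
Qed.

Lemma crown_nested i j k x y u w : i != j -> i != k -> x \in X i -> y \in X i ->
  u \in X j -> w \in X k -> e x u -> e y w -> e x w || e y u.
Proof.
case: rp => _ [_ /(_ i)[h [l [_ [XE [srt _]]]]]] ij ik xi yi uj wk xu yw.
have uy := crown_neq ij yi uj; have wx := crown_neq ik xi wk.
rewrite -XE in xi; rewrite -XE in yi.
case/orP: (chain_total cnbhd_subset_refl cnbhd_subset_trans srt xi yi) => /subsetP.
  move/(_ w); rewrite !inE (crown_mem wk) yw orbT eq_sym (negbTE wx) /=.
  by move=> /(_ isT) ->.
move/(_ u); rewrite !inE (crown_mem uj) xu orbT eq_sym (negbTE uy) /=.
by move=> /(_ isT) ->; rewrite orbT.
Qed.

Definition crown_cls k (d : nat) : {set T} := X (inord k).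

Lemma crown_adj k k' i i' x y b : k \in iota 0 5 -> k' \in iota 0 5 -> k <= k' ->
  x \in crown_cls k i -> y \in crown_cls k' i' -> x != y ->
  crown_c i0 k k' (i == i') = Some b -> e x y = b.
Proof.
have lt5 m : m \in iota 0 5 -> m < 5 by rewrite mem_iota => /andP[].
move=> /lt5 kk /lt5 kk' _ xk yk xy.
case: b => cb; last first.
  apply: crown_far xk yk; rewrite /ring_adj /= !inordK //.
  exact: (crown_c_false (ltn_ord i0) kk kk' cb).
case/or4P: (crown_c_true (ltn_ord i0) kk kk' cb) => [/eqP E|/andP[h1 h2]|/andP[h1 h2]|].
- by rewrite -E in yk; apply: crown_clique xk yk xy.
- by apply: (low _ _ xk yk); rewrite /= inordK.
- by rewrite es; apply: (low _ _ yk xk); rewrite /= inordK.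
case/orP=> /andP[h1 h2].
- by apply: (high _ _ xk yk); rewrite /= inordK.
- by rewrite es; apply: (high _ _ yk xk); rewrite /= inordK.
Qed.

Lemma crown_free : clique e (~: Q) -> complete e (~: Q) Q ->
  [/\ ~ induced_sub e twoP3, ~ induced_sub e (@cycle_graph 4),
      ~ induced_sub e (@cycle_graph 6), ~ induced_sub e (@cycle_graph 7) &
      ~ induced_sub e T0].
Proof.
have lt5 m : m \in iota 0 5 -> m < 5 by rewrite mem_iota => /andP[].
move=> UQ UcQ; apply: (template_free es ei UQ UcQ (cls := crown_cls) _ crown_adj _ _ _
  (crown_avoids (ltn_ord i0))) => //.
- by move=> k k' b /lt5 kk /lt5 kk'; apply: crown_c_sym.
- move=> k i p ip q iq x y u w /lt5 kk /lt5 kp /lt5 kq.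
  move=> /(crown_c_None kk kp) np /(crown_c_None kk kq) nq.
  by apply: crown_nested; rewrite -val_eqE /= !inordK.
- move=> x /crown_cover[i xi]; exists (val i), 0; rewrite /crown_cls inord_val.
  by split; rewrite // mem_iota ltn_ord.
Qed.

Lemma crown_rough : rough e Q.
Proof.
have ex i : exists x, x \in X i by apply/set0Pn; case: rp => _ [].
split=> [|v /crown_cover[i vi]].
  by have [x xi] := ex i0; apply/set0Pn; exists x; apply: crown_mem xi.
have [j [k [l [[aij akl ij ik] [ajk ail jk il]]]]] := ring5_neighbours i.
have [[[x xj hx] [y yk hy]] [w wl]] := (crown_top j, crown_top k, ex l).
exists x, y, w; split; first by split; apply: crown_mem; eauto.
rewrite es (hx i) // es (hy i) // (crown_far ajk xj yk) (crown_neq jk xj yk).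
by rewrite (crown_far ail vi wl) (crown_neq il vi wl).
Qed.

End Crown.
End BasketCrown.

(** * Universal vertices and anticomponents *)

Section Converse.
Variables (T : finType) (e : rel T) (es : symmetric e) (ei : irreflexive e).

Lemma special_free (Q : {set T}) : special e Q -> clique e (~: Q) -> complete e (~: Q) Q ->
  [/\ ~ induced_sub e twoP3, ~ induced_sub e (@cycle_graph 4),
      ~ induced_sub e (@cycle_graph 6), ~ induced_sub e (@cycle_graph 7) &
      ~ induced_sub e T0].
Proof.
move=> sp UQ UcQ; case: sp => [|[|[|]]].
- case=> A [F [B [C [i0 [j0 [pQ [_ [BC0 [Acl [Fcl [BCcl [BC [AB [ch [AnC [BiCi [BiCj [FQ FnBC]]]]]]]]]]]]]]]]]].
  exact: (basket_free es ei pQ BC0 Acl Fcl BCcl BC AB ch AnC BiCi BiCj FQ FnBC).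
- by case=> t [t3 [A [B [C [pQ vp]]]]]; apply: (villa_free es ei vp pQ).
- case=> t [t3 [A [F [X [Y [B [C [j [pQ [vp [_ [Fcl [Xcl [Ycl [FA [FBC [FnBC [BjCj [XAB [XnB [XnC [FXY [XnY [YC YnA]]]]]]]]]]]]]]]]]]]]]]]].
  exact: (mansion_free es ei vp pQ Fcl Xcl Ycl FA FBC FnBC BjCj XAB XnB XnC FXY XnY YC YnA).
- by case=> X [i0 [rp [low high]]]; apply: (crown_free es ei rp low high).
Qed.

Lemma special_rough (Q : {set T}) : special e Q -> rough e Q.
Proof.
case=> [|[|[|]]].
- case=> A [F [B [C [i0 [j0 [pQ [A0 [BC0 [Acl [Fcl [BCcl [BC [AB [ch [AnC [BiCi [BiCj [FQ FnBC]]]]]]]]]]]]]]]]]].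
  exact: (basket_rough es pQ A0 BC0 BC AB ch AnC BiCi BiCj FQ FnBC).
- by case=> t [t3 [A [B [C [pQ vp]]]]]; apply: (villa_rough es t3 vp pQ).
- case=> t [t3 [A [F [X [Y [B [C [j [pQ [vp [F0 [Fcl [Xcl [Ycl [FA [FBC [FnBC [BjCj [XAB [XnB [XnC [FXY [XnY [YC YnA]]]]]]]]]]]]]]]]]]]]]]]].
  exact: (mansion_rough es t3 vp pQ F0 FA FBC FnBC XAB XnC FXY YC YnA).
- by case=> X [i0 [rp _]]; apply: (crown_rough es i0 rp).
Qed.

Lemma cond_c_a : cond_c e -> cond_a e.
Proof.
case=> Q [sp [UQ UcQ]]; have [h1 h2 h3 h4 h5] := special_free sp UQ UcQ.
split=> //; do 4 split=> //; move=> v sv.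
have [/set0Pn[q qQ] Qr] := special_rough sp.
(* A vertex outside [Q] sees all of [Q], so it inherits two nonadjacent neighbours from any vertex
   of [Q]. *)
have [u uQ uv] : exists2 u, u \in Q & forall x, x \in Q -> e u x -> e v x.
  by case: (boolP (v \in Q)) => vQ; [exists v|exists q => // x xQ _; apply: UcQ; rewrite ?inE].
have [x [y [w [[xQ yQ _] /and5P[ux uy /negP nxy xy _]]]]] := Qr u uQ.
by apply: nxy; apply: sv xy; rewrite inE uv.
Qed.

Lemma co_rel_sym (S : {set T}) : symmetric (co_rel e S).
Proof. by move=> x y; rewrite /co_rel es eq_sym andbCA. Qed.

Lemma anticonnected_nonneighbour (S : {set T}) x y : anticonnected e S -> x \in S -> y \in S ->
  x != y -> exists2 z, x != z & ~~ e x z.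
Proof.
move=> ac xS yS xy; case/connectP: (ac x y xS yS) => -[|z p] /=; first by move=> _ E; rewrite E eqxx in xy.
by case/andP=> /and4P[_ _ xz nxz] _ _; exists z.
Qed.

(** If x and y lay in different components of the complement, nonneighbours x' of x and y' of y in
    [Q] would lie in the respective components, and x y x' y' would be a 4-hole. *)
Lemma rough_anticonnected (Q : {set T}) : ~ induced_sub e (@cycle_graph 4) ->
  rough e Q -> anticonnected e Q.
Proof.
move=> c4 [_ Qr] x y xQ yQ; apply: contraPT c4 => nxy; apply.
have [_ [_ [x' [[_ _ x'Q] /and5P[_ _ _ _ /andP[nxx' xx']]]]]] := Qr x xQ.
have [_ [_ [y' [[_ _ y'Q] /and5P[_ _ _ _ /andP[nyy' yy']]]]]] := Qr y yQ.
have cx : connect (co_rel e Q) x x' by apply: connect1; rewrite /co_rel xQ x'Q xx'.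
have ny' : ~~ connect (co_rel e Q) x y'.
  apply: contra nxy => h; apply: connect_trans h (connect1 _).
  by rewrite co_rel_sym /co_rel yQ y'Q yy'.
have adj a b : a \in Q -> b \in Q -> connect (co_rel e Q) x a ->
    ~~ connect (co_rel e Q) x b -> (e a b = true) * (e b a = true).
  move=> aQ bQ xa nxb; rewrite [e b a]es; suff -> : e a b by [].
  apply: contraR nxb => nab; have [<- //|ab] := eqVneq a b.
  by apply: connect_trans xa (connect1 _); rewrite /co_rel aQ bQ ab.
have x0 := connect0 (co_rel e Q) x.
have [[h1 h1'] [h2 h2']] := (adj _ _ xQ yQ x0 nxy, adj _ _ xQ y'Q x0 ny').
have [[h3 h3'] [h4 h4']] := (adj _ _ x'Q yQ cx nxy, adj _ _ x'Q y'Q cx ny').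
have nx' := negbTE nxx'; have ny'' := negbTE nyy'.
exists (fun i => nth x [:: x; y; x'; y'] (val i)); split.
  move=> i j /eqP; rewrite nth_uniq ?ltn_ord // => [/eqP/val_inj //|].
  rewrite /= !inE !negb_or xx' yy' /= !andbT.
  by rewrite !(edge_neq ei) ?h1 ?h2 ?h3 ?h3' ?h4.
move=> -[[|[|[|[|//]]]] li] -[[|[|[|[|//]]]] lj];
  rewrite /cycle_graph /= ?ei ?h1 ?h1' ?h2 ?h2' ?h3 ?h3' ?h4 ?h4' ?nx' ?ny'' //.
all: by rewrite es ?nx' ?ny''.
Qed.

(** Vertices outside [Q] are universal and so are isolated in the complement. Every anticonnected
    set with at least two vertices therefore lies in [Q], which gives both maximality and
    uniqueness. *)
Lemma cond_c_b : cond_c e -> cond_b e.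
Proof.
move=> cc; have [_ [c4 _]] := cond_c_a cc; case: cc => Q [sp [UQ UcQ]].
have Qr := special_rough sp; have Qac := rough_anticonnected c4 Qr.
have univ v z : v \notin Q -> v != z -> e v z.
  move=> vQ vz; case: (boolP (z \in Q)) => zQ; first by apply: UcQ; rewrite ?inE.
  by apply: UQ; rewrite ?inE.
have inQ S v w : anticonnected e S -> v \in S -> w \in S -> v != w -> v \in Q.
  move=> ac vS wS vw; have [z vz] := anticonnected_nonneighbour ac vS wS vw.
  by apply: contraR => vQ; apply: univ.
have [/set0Pn[q qQ] Qn] := Qr.
have [_ [_ [w [[_ _ wQ] /and5P[_ _ _ _ /andP[_ qw]]]]]] := Qn q qQ.
have Qmax (S : {set T}) : Q \subset S -> anticonnected e S -> S = Q.
  move=> /subsetP QS ac; apply/eqP; rewrite eqEsubset; apply/andP; split; last exact/subsetP.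
  apply/subsetP => v vS; have [->//|vq] := eqVneq v q.
  exact: inQ ac vS (QS q qQ) vq.
exists Q; split; first by split; [apply/set0Pn; exists q|split].
split; first by rewrite (cardD1 q) qQ (cardD1 w) !inE eq_sym qw wQ.
split=> // S [_ [ac Smax]] /card_gt1P[a [b [aS bS ab]]].
apply/esym/Smax => //; apply/subsetP => v vS.
case: (eqVneq v a) => [->|va]; first exact: inQ ac aS bS ab.
exact: inQ ac vS aS va.
Qed.

(** A vertex outside [S] with a nonneighbour would lie, together with it, in a nontrivial component
    of the complement, hence in [S] by uniqueness. All vertices outside [S] are therefore
    universal. *)
Lemma cond_b_c : cond_b e -> cond_c e.
Proof.
case=> S [_ [_ [Suniq sp]]]; exists S; split=> //.
suff univ v w : v \notin S -> v != w -> e v w.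
  split=> x y; rewrite !inE => xS yS; first exact: univ.
  by apply: univ => //; apply: contraNneq xS => ->.
move=> vS vw; apply: contraR vS => nvw.
pose r := co_rel e setT; pose D := [set z | connect r v z].
have vD : v \in D by rewrite inE connect0.
have Dconn x z : connect r x z -> x \in D -> connect (co_rel e D) x z.
  case/connectP=> p; elim: p x => [|y p IH] x /=; first by move=> _ -> _; apply: connect0.
  case/andP=> rxy py zE xD; have yD : y \in D.
    by move: xD; rewrite !inE => h; apply: connect_trans h (connect1 rxy).
  apply: connect_trans (IH y py zE yD); apply: connect1.
  by case/and4P: rxy => _ _ xy nxy; apply/and4P.
rewrite -(Suniq D) //; last first.
  apply/card_gt1P; exists v, w; split=> //; rewrite inE; apply: connect1.
  by rewrite /r /co_rel !inE vw.
split; first by apply/set0Pn; exists v.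
split=> [x y|S' /subsetP DS' ac].
  rewrite !inE => vx vy; apply: Dconn; last by rewrite inE.
  by apply: connect_trans vy; rewrite (sym_connect_sym (co_rel_sym _)).
apply/eqP; rewrite eqEsubset; apply/andP; split; last exact/subsetP.
apply/subsetP => s sS'; rewrite inE; apply: connect_sub (ac v s (DS' v vD) sS').
by move=> a b /and4P[_ _ ab nab]; apply: connect1; rewrite /r /co_rel !inE ab.
Qed.

End Converse.

Theorem theorem7p1 (T : finType) (e : rel T)
  (e_sym : symmetric e) (e_irr : irreflexive e) (T_nonnull : 0 < #|T|) :
  (cond_a e <-> cond_b e) /\ (cond_b e <-> cond_c e).
Proof.
have ac := cond_a_c e_sym e_irr T_nonnull; have ca := cond_c_a e_sym e_irr.
have cb := cond_c_b e_sym; have bc := @cond_b_c T e e_sym.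
split; split; auto.
Qed.
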